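(* Let $A=T(V)/\langle R\rangle$ be a multi-Koszul algebra, let $\{J_i\}_{i\in\mathbb{N}_0}$ be the associated collection of graded vector subspaces of $T(V)$, and let $J=\bigoplus_{i\in\mathbb{N}_0}J_i$, considered as a homological bigraded vector space with $J_i$ in homological degree $i$ (and Adams grading induced by that of $V$). Let $\epsilon: J\to J_0=k$ be the canonical projection, $\eta:k=J_0\to J$ the inclusion, $\Delta_1=0$, and $\Delta_2|_{J_i}=\sum_{l=0}^{i}\iota_{l,i-l}$. For $n\ge3$ let $\Delta_n:J\to J^{\otimes n}$ be given by $$\Delta_n|_{J_i}=\sum\iota_{i_1,\dots,i_n},$$ where the sum is indexed over all $n$-tuples of odd positive integers $(i_1,\dots,i_n)$ such that $i_1+\dots+i_n+2-n=i$. Then $J$, with $\{\Delta_n\}_{n\in\mathbb{N}}$, $\epsilon$ and $\eta$, is a minimal Adams graded coaugmented $A_\infty$-coalgebra. This in turn implies that $J^{\#}$ is a minimal Adams graded augmented $A_\infty$-algebra, where, for $n\ge3$, the multiplication $m_n:(J^{\#})^{\otimes n}\to J^{\#}$ is the map whose restriction to $J_{i_1}^{\#}\otimes\dots\otimes J_{i_n}^{\#}$ is zero if there is $1\le l\le n$ such that $i_l$ is even, and is $\iota_{i_1,\dots,i_n}^{\#}\circ c_{J_{i_1},\dots,J_{i_n}}$ otherwise.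
   Context: Setting. $k$ is a field. $A=\bigoplus_{n\ge 0}A_n$ is a locally finite dimensional nonnegatively graded connected algebra ($A_0=k$, $\dim A_n<\infty$), written $A=T(V)/\langle R\rangle$, where $V\simeq A_{>0}/(A_{>0}\cdot A_{>0})$ is a positively graded vector space with finite dimensional components, $T(V)$ is its tensor algebra with the grading induced from $V$, and $R\subseteq \bigoplus_{n\ge2}V^{\otimes n}$ is a space of relations: a graded subspace with $R\cap(T(V)_{>0}\otimes R\otimes T(V)+T(V)\otimes R\otimes T(V)_{>0})=0$, $T(V)_{>0}=\bigoplus_{n\ge1}V^{\otimes n}$. $\pi:T(V)\to A$ is the projection. $V^{(n)}=V^{\otimes n}$, $V^{(0)}=k$. For subspaces $W_1,\dots,W_m$ of $T(V)$, $W_1\otimes\dots\otimes W_m$ denotes the subspace of $T(V)$ spanned by products $w_1\cdots w_m$; $R^{(i)}=R\otimes\dots\otimes R$ ($i$ factors), $R^{(0)}=k$. The spaces $J_i\subseteq T(V)$. $J_0=k$, $J_2=R$, $J_{2i+1}=(V\otimes J_{2i})\cap(J_{2i}\otimes V)$ for $i\ge0$ (so $J_1=V$), and for $i\ge1$ $$J_{2(i+1)}=\Big(\sum_{N\ge1}\ \bigcap_{\bar n,\bar m}V^{(m_1)}\otimes J_{2n_1}\otimes\dots\otimes V^{(m_i)}\otimes J_{2n_i}\otimes V^{(m_{i+1})}\Big)\cap R^{(i+1)},$$ where $\bar n=(n_1,\dots,n_i)$ runs over $i$-tuples of nonnegative integers with sum $i$ and $\bar m=(m_1,\dots,m_{i+1})$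 over $(i+1)$-tuples of nonnegative integers with sum $N$. (Products of the $J_i$ inside $T(V)$ are canonically isomorphic to the abstract tensor products.) Multi-Koszul algebras. $K_{L-R}(A)_i=A\otimes J_i\otimes A$, with $A$-bimodule maps $\delta_i^b:K_{L-R}(A)_i\to K_{L-R}(A)_{i-1}$: if $i=2j+1$ and $\omega=\sum\bar\omega_{(1)}\omega_{(2)}=\sum\omega'_{(1)}\bar\omega'_{(2)}\in J_{2j+1}$ with $\bar\omega_{(1)},\bar\omega'_{(2)}\in V$, $\omega_{(2)},\omega'_{(1)}\in J_{2j}$, then $\delta_i^b(1\otimes\omega\otimes1)=\sum\bar\omega_{(1)}\otimes\omega_{(2)}\otimes1-\sum1\otimes\omega'_{(1)}\otimes\bar\omega'_{(2)}$; if $i=2j\ge2$, then $J_{2j}\subseteq\bigoplus_{N\ge0}\bigcap_{l=0}^N V^{(l)}\otimes J_{2j-1}\otimes V^{(N-l)}$, and writing $\omega=\sum_N\omega^N$ accordingly and $\omega^N=\sum\omega^{N,l}_{(1)}\omega^{N,l}_{(2)}\omega^{N,l}_{(3)}\in V^{(l)}\otimes J_{2j-1}\otimes V^{(N-l)}$ for each $0\le l\le N$, $\delta_i^b(1\otimes\omega\otimes1)=\sum_N\sum_{l=0}^N\sum\pi(\omega^{N,l}_{(1)})\otimes\omega^{N,l}_{(2)}\otimes\pi(\omega^{N,l}_{(3)})$. The left (resp. right) multi-Koszul complex is $K_{L-R}(A)_\bullet\otimes_A k$ (resp. $k\otimes_A K_{L-R}(A)_\bullet$), augmented to $k$. $A$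 is multi-Koszul if the augmented left multi-Koszul complex is a resolution of the trivial left module $k$ (equivalently, the right one is a resolution of the trivial right module $k$). The maps $\iota_{i,i'}:J_{i+i'}\to J_i\otimes J_{i'}$. If $i$ or $i'$ is even, then $J_{i+i'}\subseteq J_i\otimes J_{i'}$ and $\iota_{i,i'}$ is this inclusion. If both are odd, then $J_{i+i'}\subseteq T(V)\otimes J_i\otimes J_{i'}$ and $\iota_{i,i'}$ is this inclusion followed by $\epsilon_{T(V)}\otimes\mathrm{id}\otimes\mathrm{id}$, $\epsilon_{T(V)}:T(V)\to k$ the augmentation. The maps $\iota_{i_1,\dots,i_n}:J_{i_1+\dots+i_n+2-n}\to J_{i_1}\otimes\dots\otimes J_{i_n}$, for $n\ge3$ and odd positive integers $i_l=2j'_l+1$. The space $J_{i_1+\dots+i_n+2-n}$ is contained in the (internal) direct sum $$\bigoplus_{N\ge2}\Big(\bigcap_{\bar m}V^{(m_1)}\otimes J_{2j'_1}\otimes\dots\otimes V^{(m_n)}\otimes J_{2j'_n}\otimes V^{(m_{n+1})}\Big),$$ $\bar m$ running over $(n+1)$-tuples of nonnegative integers with sum $N$; the direct summand with $N=n$ is contained in $J_{i_1}\otimes\dots\otimes J_{i_n}$. Then $\iota_{i_1,\dots,i_n}$ is the composition of the inclusion into the direct sum, the projection onto the summand with $N=n$, and the inclusion of the latter in $J_{i_1}\otimes\dots\otimes J_{i_n}$. As a map $J\to J^{\otimes n}$ it has homological degree $n-2$. Sign and duality conventions. The Koszul sign rule is applied to the (co)homological degree $\deg$ only, not to the Adams degree.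 An element of homological degree $n$ has cohomological degree $-n$; $W^{\#}$ is the bigraded dual, so $J_i^{\#}$ has cohomological degree $i$. For $f:W\to W'$ of degree $d$, $f^{\#}(\lambda)=(-1)^{d\deg(\lambda)}\lambda\circ f$. The map $c_{W_1,\dots,W_n}:W_1^{\#}\otimes\dots\otimes W_n^{\#}\to(W_1\otimes\dots\otimes W_n)^{\#}$ is $c(f_1\otimes\dots\otimes f_n)(w_1\otimes\dots\otimes w_n)=(-1)^sf_1(w_1)\cdots f_n(w_n)$ with $s=\sum_{l=1}^{n-1}\deg(w_l)(\deg(f_{l+1})+\dots+\deg(f_n))$. The graded dual $C^{\#}$ of an Adams graded coaugmented $A_\infty$-coalgebra has unit $\epsilon^{\#}$, augmentation $\eta^{\#}$ and $m_n=\Delta_n^{\#}\circ c_{C,\dots,C}$. $A_\infty$-structures. Let $\mathcal I_n=\{(r,s,t)\in\mathbb{N}_0\times\mathbb{N}\times\mathbb{N}_0:r+s+t=n\}$. An Adams graded augmented $A_\infty$-algebra is a cohomological bigraded vector space $B$, nonnegatively graded cohomologically with degree-zero component $k$ (in Adams degree $0$), with maps $m_i:B^{\otimes i}\to B$ ($i\ge1$) of cohomological degree $2-i$ and Adams degree $0$ satisfying $\sum_{(r,s,t)\in\mathcal I_n}(-1)^{r+st}m_{r+1+t}\circ(\mathrm{id}^{\otimes r}\otimes m_s\otimes\mathrm{id}^{\otimes t})=0$ for all $n\ge1$; a unit $\eta:k\to B$ of bidegree $(0,0)$ with $m_i\circ(\mathrm{id}^{\otimes r}\otimes\eta\otimes\mathrm{id}^{\otimes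 t})=0$ for $i\ne2$, $r+1+t=i$, and $m_2\circ(\mathrm{id}\otimes\eta)=\mathrm{id}=m_2\circ(\eta\otimes\mathrm{id})$; and an augmentation $\epsilon:B\to k$ of bidegree $(0,0)$ with $\epsilon\circ\eta=\mathrm{id}_k$, $\epsilon\circ m_2=\epsilon^{\otimes2}$, $\epsilon\circ m_i=0$ for $i\ne2$. It is minimal if $m_1=0$. An Adams graded coaugmented $A_\infty$-coalgebra is a homological bigraded vector space $C$, nonnegatively graded homologically with degree-zero component $k$ (in Adams degree $0$), with a locally finite family (for each $c\in C$ only finitely many $\Delta_i(c)$ are nonzero) of maps $\Delta_i:C\to C^{\otimes i}$ ($i\ge1$) of homological degree $i-2$ and Adams degree $0$ satisfying $\sum_{(r,s,t)\in\mathcal I_n}(-1)^{rs+t}(\mathrm{id}^{\otimes r}\otimes\Delta_s\otimes\mathrm{id}^{\otimes t})\circ\Delta_{r+1+t}=0$ for all $n\ge1$; a counit $\epsilon:C\to k$ of bidegree $(0,0)$ with $(\mathrm{id}^{\otimes r}\otimes\epsilon\otimes\mathrm{id}^{\otimes t})\circ\Delta_i=0$ for $i\ne2$, $r+1+t=i$, and $(\mathrm{id}\otimes\epsilon)\circ\Delta_2=\mathrm{id}=(\epsilon\otimes\mathrm{id})\circ\Delta_2$; and a coaugmentation $\eta:k\to C$ of bidegree $(0,0)$ with $\epsilon\circ\eta=\mathrm{id}_k$, $\Delta_2(\eta(1))=\eta(1)^{\otimes2}$, $\Delta_i(\eta(1))=0$ for $i\ne2$. It is minimal if $\Delta_1=0$.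 *)

(* Defs.v *)
From HB Require Import structures.
From mathcomp Require Import all_boot all_order all_algebra finmap.
From mathcomp Require Import boolp classical_sets functions fsbigop.
From mathcomp.multinomials Require Import monalg.

Set Implicit Arguments.
Unset Strict Implicit.
Unset Printing Implicit Defensive.

Import GRing.Theory.
Local Open Scope ring_scope.
Local Open Scope quotient_scope.

(** * Subspaces: spans, intersections, underlying modules, direct sums *)

Section Subspaces.
Variables (k : fieldType) (U : lmodType k).

Definition span_pred (P : set U) : {pred U} :=
  fun x => `[< exists s : seq (k * U),
     (forall q, q \in s -> P q.2) /\ x = \sum_(q <- s) q.1 *: q.2 >].

Lemma span_submod (P : set U) : submod_closed (span_pred P).
Proof.
split.
  by apply/asboolP; exists [::]; rewrite big_nil.
move=> a x y /asboolP[s [sP ->]] /asboolP[t [tP ->]]; apply/asboolP.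
exists ([seq (a * q.1, q.2) | q <- s] ++ t); split.
  move=> q; rewrite mem_cat => /orP[/mapP[q' q's ->]|]; last exact: tP.
  exact: sP q's.
rewrite big_cat /= big_map scaler_sumr; congr (_ + _).
by apply: eq_bigr => q _; rewrite scalerA.
Qed.
HB.instance Definition _ (P : set U) :=
  GRing.isSubmodClosed.Build k U (span_pred P) (span_submod P).
Definition lspan (P : set U) : submodClosed U := span_pred P.

Lemma mem_lspan (P : set U) (u : U) : P u -> u \in lspan P.
Proof.
move=> Pu; apply/asboolP; exists [:: (1, u)]; rewrite big_seq1 scale1r.
by split=> // q; rewrite inE => /eqP->.
Qed.

Definition cap_pred (I : Type) (P : set I) (F : I -> submodClosed U) :
  {pred U} := fun x => `[< forall i, P i -> x \in F i >].

Lemma cap_submod (I : Type) (P : set I) (F : I -> submodClosed U) :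
  submod_closed (cap_pred P F).
Proof.
split; first by apply/asboolP => i _; apply: rpred0.
move=> a x y /asboolP xF /asboolP yF; apply/asboolP => i Pi.
by apply: rpredD; [apply: rpredZ; apply: xF|apply: yF].
Qed.
HB.instance Definition _ (I : Type) (P : set I) (F : I -> submodClosed U) :=
  GRing.isSubmodClosed.Build k U (cap_pred P F) (cap_submod P F).
Definition cap (I : Type) (P : set I) (F : I -> submodClosed U) :
  submodClosed U := cap_pred P F.

Definition cap2 (S S' : submodClosed U) : submodClosed U :=
  cap setT (fun b : bool => if b then S else S').

Definition sumsp (I : Type) (P : set I) (F : I -> submodClosed U) :
  submodClosed U := lspan (fun x => exists2 i, P i & x \in F i).

Definition fin_dim (S : submodClosed U) : Prop :=
  exists s : seq U, forall x, x \in S -> x \in lspan (fun y => y \in s).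

Definition direct_sum (I : choiceType) (G : I -> submodClosed U) : Prop :=
  (forall x, x \in sumsp setT G) /\
  (forall (s : seq I) (x : I -> U), uniq s -> (forall i, x i \in G i) ->
     \sum_(i <- s) x i = 0 -> forall i, i \in s -> x i = 0).

(** The subspace [S] as a vector space of its own. *)
Record sub (S : submodClosed U) := SubElt { sub_val : U; _ : sub_val \in S }.
HB.instance Definition _ (S : submodClosed U) := [isSub for @sub_val S].
HB.instance Definition _ (S : submodClosed U) := [Choice of sub S by <:].
HB.instance Definition _ (S : submodClosed U) :=
  [SubChoice_isSubLmodule of sub S by <:].

End Subspaces.

(** * Quotients of vector spaces *)

Section Quotients.
Variables (k : fieldType) (U : lmodType k) (S : submodClosed U).

Lemma submod_zmod_closed : zmod_closed S.
Proof.
split=> [|x y xS yS]; first exact: rpred0.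
by rewrite -scaleN1r; apply: rpredD => //; apply: rpredZ.
Qed.
Definition in_submod : {pred U} := fun x => x \in S.
HB.instance Definition _ :=
  GRing.isZmodClosed.Build U in_submod submod_zmod_closed.

Definition submod_zmod : zmodClosed U := in_submod.

Definition lquot := Quotient.quot submod_zmod.
HB.instance Definition _ := GRing.Zmodule.on lquot.
HB.instance Definition _ := EqQuotient.on lquot.

Definition lquot_scale (a : k) : lquot -> lquot := lift_op1 lquot ( *:%R a).

Lemma lquot_eq (x y : U) : (\pi_lquot x = \pi y) <-> (x - y \in S).
Proof.
have -> : (x - y \in S) = (x == y %[mod lquot]).
  exact: (Quotient.idealrBE submod_zmod).
by split=> /eqP.
Qed.

Lemma lquot_piD (x y : U) : \pi_lquot (x + y) = \pi x + \pi y.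
Proof. exact: (raddfD (\pi_lquot)). Qed.

Lemma lquot_piZ (a : k) (x : U) : \pi_lquot (a *: x) = lquot_scale a (\pi x).
Proof.
rewrite /lquot_scale; unlock; apply/lquot_eq.
by rewrite -scalerBr rpredZ //; apply/lquot_eq; rewrite reprK.
Qed.

Lemma lquot_scaleA a b v :
  lquot_scale a (lquot_scale b v) = lquot_scale (a * b) v.
Proof. by elim/quotW: v => x; rewrite -!lquot_piZ scalerA. Qed.
Lemma lquot_scale1 : left_id 1 lquot_scale.
Proof. by move=> v; elim/quotW: v => x; rewrite -lquot_piZ scale1r. Qed.
Lemma lquot_scaleDr : right_distributive lquot_scale +%R.
Proof.
move=> a v w; elim/quotW: v => x; elim/quotW: w => y.
by rewrite -lquot_piD -!lquot_piZ -lquot_piD scalerDr.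
Qed.
Lemma lquot_scaleDl v : {morph lquot_scale^~ v : a b / a + b}.
Proof.
by move=> a b; elim/quotW: v => x; rewrite -!lquot_piZ -lquot_piD scalerDl.
Qed.
HB.instance Definition _ := GRing.Zmodule_isLmodule.Build k lquot
  lquot_scaleA lquot_scale1 lquot_scaleDr lquot_scaleDl.

End Quotients.

(** * Tensor products over [k]

  Quotients of the vector space of formal linear combinations of pairs. *)

Section Tensor.
Variables (k : fieldType) (U W : lmodType k).

Definition tens_rel (x : {malg k[(U * W)%type]}) : Prop :=
  (exists a u u' w,
     x = << (a *: u + u', w) >> - a *: << (u, w) >> - << (u', w) >>) \/
  (exists a u w w',
     x = << (u, a *: w + w') >> - a *: << (u, w) >> - << (u, w') >>).

Definition tens : lmodType k := lquot (lspan tens_rel).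

Definition tpure (u : U) (w : W) : tens := \pi_tens << (u, w) >>.

(** Linear map on [tens] induced by a bilinear map; computed on some formal
    representative, it is meaningful for bilinear [f] only. *)
Definition tlift2 (X : lmodType k) (f : U -> W -> X) (t : tens) : X :=
  \sum_(q <- msupp (repr t)) (repr t)@_q *: f q.1 q.2.

End Tensor.

Definition tmap (k : fieldType) (U W U' W' : lmodType k) (f : U -> U')
  (g : W -> W') : tens U W -> tens U' W' :=
  tlift2 (fun u w => tpure (f u) (g w)).

(** * The tensor algebra of a vector space

  Quotient of the algebra of noncommutative polynomials in the vectors of [W]
  by the two-sided ideal making the letter [w] linear in [w]. *)

Section TensorAlgebra.
Variables (k : fieldType) (W : lmodType k).

Local Notation free := {malg k[{fmonom W}]}.
Definition letter (w : W) : free := << fmu w >>.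

Definition talg_rel (x : free) : Prop :=
  exists (y z : free) (a : k) (w w' : W),
    x = y * (letter (a *: w + w') - a *: letter w - letter w') * z.

Definition talg := lquot (lspan talg_rel).
HB.instance Definition _ := GRing.Lmodule.on talg.
HB.instance Definition _ := EqQuotient.on talg.

Lemma free_mulC (a : k) (x : free) : x * a%:MP = a%:MP * x.
Proof.
rewrite mul_malgC malgZ_def malgM_def fgmulgU.
by apply: eq_bigr => m _; rewrite mulm1 mulrC.
Qed.

Lemma free_scalerAr (a : k) (x y : free) : a *: (x * y) = x * (a *: y).
Proof. by rewrite -!mul_malgC !mulrA free_mulC. Qed.

Lemma talg_rel_ideal (x y z : free) :
  x \in lspan talg_rel -> y * x * z \in lspan talg_rel.
Proof.
move=> /asboolP[s [sR ->]]; apply/asboolP.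
exists [seq (q.1, y * q.2 * z) | q <- s]; split.
  move=> q /mapP[q' q's ->] /=.
  have [y' [z' [a [w [w' ->]]]]] := sR _ q's.
  by exists (y * y'), (z' * z), a, w, w'; rewrite !mulrA.
rewrite big_map mulr_sumr mulr_suml; apply: eq_bigr => q _.
by rewrite -free_scalerAr -scalerAl.
Qed.

Lemma talg_rel_proper : 1 \notin lspan talg_rel.
Proof.
apply/negP => /asboolP[s [sR /(congr1 (mcoeff (mone : {fmonom W})))]].
rewrite mcoeffUU raddf_sum big_seq big1 /= ?oner_eq0 //.
  by move/eqP; rewrite oner_eq0.
move=> q /sR [y [z [a [w [w' ->]]]]].
rewrite mcoeffZ !rmorphM /= !mcoeffB mcoeffZ /letter !mcoeffU.
by rewrite !fmP fm1 !fmuE /= mulr0 !subr0 mulr0 mul0r mulr0.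
Qed.

Definition talg_one : talg := \pi_talg 1.
Definition talg_mul : talg -> talg -> talg := lift_op2 talg *%R.

Lemma talg_piM (x y : free) : \pi_talg (x * y) = talg_mul (\pi x) (\pi y).
Proof.
rewrite /talg_mul; unlock; apply/lquot_eq.
set x' := repr _; set y' := repr _.
have -> : x * y - x' * y' = 1 * (x - x') * y + x' * (y - y') * 1.
  by rewrite mul1r mulr1 mulrBl mulrBr addrA subrK.
by apply: rpredD; apply: talg_rel_ideal; apply/lquot_eq; rewrite reprK.
Qed.

Lemma talg_mulA : associative talg_mul.
Proof.
move=> u v w; elim/quotW: u => x; elim/quotW: v => y; elim/quotW: w => z.
by rewrite -!talg_piM mulrA.
Qed.
Lemma talg_mul1 : left_id talg_one talg_mul.
Proof. by move=> u; elim/quotW: u => x; rewrite -talg_piM mul1r. Qed.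
Lemma talg_mulr1 : right_id talg_one talg_mul.
Proof. by move=> u; elim/quotW: u => x; rewrite -talg_piM mulr1. Qed.
Lemma talg_mulDl : left_distributive talg_mul +%R.
Proof.
move=> u v w; elim/quotW: u => x; elim/quotW: v => y; elim/quotW: w => z.
by rewrite -lquot_piD -!talg_piM -lquot_piD mulrDl.
Qed.
Lemma talg_mulDr : right_distributive talg_mul +%R.
Proof.
move=> u v w; elim/quotW: u => x; elim/quotW: v => y; elim/quotW: w => z.
by rewrite -lquot_piD -!talg_piM -lquot_piD mulrDr.
Qed.
Lemma talg_one_neq0 : talg_one != 0.
Proof.
apply/negP => /eqP.
have -> : 0 = \pi_talg 0 by rewrite -(raddf0 (\pi_talg)).
by move/lquot_eq; rewrite subr0; apply/negP/talg_rel_proper.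
Qed.
HB.instance Definition _ := GRing.Zmodule_isNzRing.Build talg
  talg_mulA talg_mul1 talg_mulr1 talg_mulDl talg_mulDr talg_one_neq0.

Lemma talg_pi_scale (a : k) (x : free) : a *: \pi_talg x = \pi_talg (a *: x).
Proof. exact: esym (lquot_piZ _ _ _). Qed.
Lemma talg_pi_mul (x y : free) : \pi_talg x * \pi_talg y = \pi_talg (x * y).
Proof. exact: esym (talg_piM _ _). Qed.

Lemma talg_scalerAl (a : k) (u v : talg) : a *: (u * v) = a *: u * v.
Proof.
elim/quotW: u => x; elim/quotW: v => y.
by rewrite !talg_pi_scale !talg_pi_mul talg_pi_scale scalerAl.
Qed.
HB.instance Definition _ :=
  GRing.Lmodule_isLalgebra.Build k talg talg_scalerAl.

Lemma talg_scalerAr (a : k) (u v : talg) : a *: (u * v) = u * (a *: v).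
Proof.
elim/quotW: u => x; elim/quotW: v => y.
by rewrite !talg_pi_scale !talg_pi_mul talg_pi_scale free_scalerAr.
Qed.
HB.instance Definition _ :=
  GRing.Lalgebra_isAlgebra.Build k talg talg_scalerAr.

Definition tvec (w : W) : talg := \pi_talg (letter w).

(** Augmentation: the constant term. All relations have none, so that it does
    not depend on the representative. *)
Definition taug (x : talg) : k := (repr x)@_mone.

(** [Ws_1 (x) ... (x) Ws_m] inside the [m]-th tensor power of [W]. *)
Definition tensp (Ws : seq (submodClosed W)) : submodClosed talg :=
  lspan (fun x => exists2 ws : seq W,
    all2 (fun w (S : submodClosed W) => w \in S) ws Ws &
    x = \prod_(w <- ws) tvec w).

Definition tpow (n : nat) : submodClosed talg :=
  lspan (fun x => exists2 ws : seq W,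
    size ws = n & x = \prod_(w <- ws) tvec w).

End TensorAlgebra.

(** * Gradings *)

Section Gradings.
Variables (k : fieldType) (W : lmodType k) (I : nmodType).
Variable G : I -> submodClosed W.

(** Component of degree [d] of the [n]-th tensor power. *)
Definition gtens (n : nat) (d : I) : submodClosed (talg W) :=
  sumsp (fun ds : seq I => size ds = n /\ \sum_(e <- ds) e = d)
    (fun ds => tensp [seq G e | e <- ds]).

Definition gtalg (d : I) : submodClosed (talg W) :=
  sumsp setT (fun n => gtens n d).

End Gradings.

(** Positive grading with finite dimensional components. *)
Record positive_grading (k : fieldType) (V : lmodType k)
    (Vg : nat -> submodClosed V) : Prop := {
  pos_direct : direct_sum Vg;
  pos_positive : forall v, v \in Vg 0%N -> v = 0;
  pos_fin_dim : forall d, fin_dim (Vg d) }.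

(** * Relations, and the subspaces [J_i] of the tensor algebra *)

(** [W_1 (x) ... (x) W_m] as a subspace of an algebra: the span of the products
    [w_1 ... w_m]. *)
Definition prodsp (k : fieldType) (B : algType k)
    (Ws : seq (submodClosed B)) : submodClosed B :=
  lspan (fun x => exists2 ws : seq B,
    all2 (fun w (S : submodClosed B) => w \in S) ws Ws &
    x = \prod_(w <- ws) w).

Section MultiKoszulSpaces.
Variables (k : fieldType) (V : lmodType k).
Local Notation T := (talg V).
Implicit Types (R : submodClosed T).

Definition T_all : submodClosed T := lspan setT.
Definition T_ge (m : nat) : submodClosed T :=
  sumsp (fun n => (m <= n)%N) (@tpow k V).

Record relation_space (Vg : nat -> submodClosed V) R : Prop := {
  rel_ge2 : forall r, r \in R -> r \in T_ge 2;
  rel_graded : forall r, r \in R ->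
    r \in sumsp setT (fun d => cap2 R (gtalg Vg d));
  rel_minimal : forall r, r \in R ->
    r \in sumsp setT (fun b : bool =>
      if b then prodsp [:: T_ge 1; R; T_all]
      else prodsp [:: T_all; R; T_ge 1]) ->
    r = 0 }.

(** [pi] presents [A] as the quotient of [T(V)] by the ideal of [R]. *)
Definition presentation R (A : algType k) (pi : {lrmorphism T -> A}) : Prop :=
  (forall a, exists x, pi x = a) /\
  (forall x, pi x = 0 <-> x \in prodsp [:: T_all; R; T_all]).

(** [[:: V^(m_1); F n_1; ...; V^(m_i); F n_i; V^(m_(i+1))]] *)
Fixpoint braid (F : nat -> submodClosed T) (ms ns : seq nat) :
    seq (submodClosed T) :=
  match ms, ns with
  | m :: ms', n :: ns' => tpow V m :: F n :: braid F ms' ns'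
  | ms', _ => [seq tpow V m | m <- ms']
  end.

(** [J_(2(i+1))] in terms of [F n = J_(2n)], [n <= i]. *)
Definition J_even_step R (i : nat) (F : nat -> submodClosed T) :
    submodClosed T :=
  cap2
    (sumsp (fun N => (1 <= N)%N) (fun N =>
       cap (fun nm : seq nat * seq nat =>
              [/\ size nm.1 = i, sumn nm.1 = i,
                  size nm.2 = i.+1 & sumn nm.2 = N])
           (fun nm => prodsp (braid F nm.2 nm.1))))
    (prodsp (nseq i.+1 R)).

(** [J_table R n m] is [J_(2m)] for [m <= n]. *)
Fixpoint J_table R (n : nat) : nat -> submodClosed T :=
  match n with
  | 0 => fun=> prodsp [::]
  | i.+1 => fun m =>
      if (m <= i)%N then J_table R i m
      else if i == 0%N then R else J_even_step R i (J_table R i)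
  end.

Definition J_even R (n : nat) : submodClosed T := J_table R n n.

Definition J R (i : nat) : submodClosed T :=
  if odd i then cap2 (prodsp [:: tpow V 1; J_even R i./2])
                     (prodsp [:: J_even R i./2; tpow V 1])
  else J_even R i./2.

Lemma J_table_even R n m : (m <= n)%N -> J_table R n m = J_even R m.
Proof.
rewrite /J_even; elim: n => [|n IHn]; first by rewrite leqn0 => /eqP->.
by rewrite leq_eqVlt => /predU1P[->//|lemn]; rewrite -IHn //= -ltnS lemn.
Qed.

Lemma J_even_rec R i : (0 < i)%N ->
  J_even R i.+1 =i J_even_step R i (J_even R).
Proof.
move=> i_gt0 x; rewrite {1}/J_even /= ltnn -[i == _]negbK -lt0n i_gt0 /=.
have E ms ns : sumn ns = i ->
    braid (J_table R i) ms ns = braid (J_even R) ms ns.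
  move=> ns_i; have : (sumn ns <= i)%N by rewrite ns_i.
  elim: ns {ns_i} ms => [|n ns IHns] [|m ms] //= le_i.
  rewrite IHns ?(leq_trans _ le_i) ?leq_addl // J_table_even //.
  by rewrite (leq_trans _ le_i) ?leq_addr.
rewrite /J_even_step; congr (x \in cap2 (lspan _) _).
apply/funext => y; apply/propext.
by split=> -[N N1 /asboolP yF]; exists N => //; apply/asboolP => nm nmP;
  move: (yF nm nmP); rewrite E //; case: nmP.
Qed.

End MultiKoszulSpaces.

(** * Multi-Koszul algebras *)

Section MultiKoszul.
Variables (k : fieldType) (V : lmodType k).
Local Notation T := (talg V).
Variables (R : submodClosed T) (A : algType k) (pi : {lrmorphism T -> A}).

Definition KLR (i : nat) : lmodType k := tens (tens A (sub (J R i))) A.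

Definition elt3 (i : nat) (a : A) (w : sub (J R i)) (b : A) : KLR i :=
  tpure (tpure a w) b.

(** [x |-> a x b] *)
Definition bimod_act (i : nat) (a b : A) : KLR i -> KLR i :=
  tmap (tmap ( *%R a) id) ( *%R^~ b).

Record multi_Koszul_differential (delta : forall i, KLR i.+1 -> KLR i) :
    Prop := {
  delta_linear : forall i, linear (delta i);
  delta_bimod : forall i a b x,
    delta i (bimod_act a b x) = bimod_act a b (delta i x);
  delta_odd : forall j (w : sub (J R j.*2.+1))
      (s : seq (V * sub (J R j.*2))) (s' : seq (sub (J R j.*2) * V)),
    val w = \sum_(q <- s) tvec q.1 * val q.2 ->
    val w = \sum_(q <- s') val q.1 * tvec q.2 ->
    delta j.*2 (elt3 1 w 1) =
      \sum_(q <- s) elt3 (pi (tvec q.1)) q.2 1 -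
      \sum_(q <- s') elt3 1 q.1 (pi (tvec q.2));
  delta_even : forall j (w : sub (J R j.*2.+2)) (M : nat) (wN : nat -> T)
      (s : nat -> nat -> seq (T * sub (J R j.*2.+1) * T)),
    val w = \sum_(N < M) wN N ->
    (forall N l, (N < M)%N -> (l <= N)%N ->
       (forall q, q \in s N l ->
          q.1.1 \in tpow V l /\ q.2 \in tpow V (N - l)) /\
       wN N = \sum_(q <- s N l) q.1.1 * val q.1.2 * q.2) ->
    delta j.*2.+1 (elt3 1 w 1) =
      \sum_(N < M) \sum_(l < N.+1) \sum_(q <- s N l)
        elt3 (pi q.1.1) q.1.2 (pi q.2) }.

Section LeftComplex.
Variables (epsA : A -> k) (delta : forall i, KLR i.+1 -> KLR i).

(** [K_i (x)_A k]: the quotient of [K_i (x) k] by [x a (x) c - x (x) a c]. *)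
Definition left_rel (i : nat) (y : tens (KLR i) k^o) : Prop :=
  exists x a (c : k^o),
    y = tpure (bimod_act 1 a x) c - tpure x (epsA a * c : k^o).

Definition left_K (i : nat) : lmodType k := lquot (lspan (@left_rel i)).

(** [delta_(i+1) (x)_A id_k] *)
Definition left_d (i : nat) (y : left_K i.+1) : left_K i :=
  \pi_(left_K i) (tmap (@delta i) id (repr y)).

(** [(a (x) w (x) b) (x) c |-> eps(a) w eps(b) c], for [w] in [J_0 = k]. *)
Definition left_aug (y : left_K 0) : k :=
  tlift2 (X := k^o) (fun x c =>
    tlift2 (X := k^o) (fun z b =>
      tlift2 (X := k^o) (fun a w => epsA a * taug (val w)) z * epsA b) x * c)
    (repr y).

Definition left_resolution : Prop :=
  [/\ forall c, exists y, left_aug y = c,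
      forall y, left_aug y = 0 <-> exists x, left_d x = y &
      forall i (y : left_K i.+1), left_d y = 0 <-> exists x, left_d x = y].

End LeftComplex.

(** The augmentation of [A] is induced by that of [T(V)]. *)
Definition multi_Koszul : Prop :=
  exists (epsA : A -> k) (delta : forall i, KLR i.+1 -> KLR i),
    [/\ forall x, epsA (pi x) = taug x,
        multi_Koszul_differential delta &
        left_resolution epsA delta].

End MultiKoszul.

(** * A-infinity algebras and coalgebras

  In a bidegree [(p, a) : nat * int], [p] is the (co)homological degree and [a]
  the Adams degree. Maps between tensor powers of [C] are maps between the
  corresponding subspaces [tpow C n] of [talg C]. *)

Section Koszul.
Variables (k : fieldType) (C : lmodType k).
Variable G : nat * int -> submodClosed C.

Definition hpart (p : nat) : submodClosed C := sumsp setT (fun a => G (p, a)).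

(** The formal combination [s] of words in homogeneous vectors, each given with
    its degree, represents the tensor [x]. *)
Definition homog_repr (x : talg C) (s : seq (k * seq (nat * C))) : Prop :=
  (forall q, q \in s -> forall w, w \in q.2 -> w.2 \in hpart w.1) /\
  x = \sum_(q <- s) q.1 *: \prod_(w <- q.2) tvec w.2.

(** Linear map on [talg C] with value [F] on the pure tensors of homogeneous
    vectors; independent of the representation when [F] is multilinear. *)
Definition hlift (X : lmodType k) (F : seq (nat * C) -> X) (x : talg C) : X :=
  \sum_(q <- xget [::] (homog_repr x)) q.1 *: F q.2.

(** [id^r (x) f (x) id^t] with the Koszul sign, where [f] has degree [d] modulo
    2 and source [C^(x)p], and [F] is [f] on pure tensors. *)
Definition insert (r p t d : nat) (F : seq C -> talg C) : talg C -> talg C :=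
  hlift (fun ws =>
    if size ws == (r + p + t)%N then
      (-1) ^+ (d * \sum_(w <- take r ws) w.1) *:
      (\prod_(w <- take r ws) tvec w.2 *
       F [seq w.2 | w <- take p (drop r ws)] *
       \prod_(w <- drop (r + p) ws) tvec w.2)
    else 0).

(** The component of degree 0 is one-dimensional, in Adams degree 0. *)
Definition connected : Prop :=
  (exists2 e : C, e != 0 &
     forall x, x \in G (0%N, 0) <-> exists c, x = c *: e) /\
  (forall a x, a != 0 -> x \in G (0%N, a) -> x = 0).

Record coaugmented_Aoo_coalgebra (Delta : nat -> C -> talg C) (eps : C -> k)
    (eta : k -> C) : Prop := {
  coalg_bigraded : direct_sum G;
  coalg_connected : connected;
  coalg_linear : forall n, (0 < n)%N -> linear (Delta n);
  coalg_degree : forall n p a c, (0 < n)%N -> c \in G (p, a) ->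
    Delta n c \in
      sumsp (fun q => (q + 2 = p + n)%N) (fun q => gtens G n (q, a));
  coalg_loc_finite : forall c, exists N, forall n, (N <= n)%N -> Delta n c = 0;
  coalg_identity : forall n c, (0 < n)%N ->
    \sum_(r < n.+1) \sum_(s < n.+1) \sum_(t < n.+1 |
        (0 < s)%N && (r + s + t == n)%N)
      (-1) ^+ (r * s + t) *:
      insert r 1 t s (fun cs => Delta s cs`_0) (Delta (r + 1 + t)%N c) = 0;
  coalg_counit_linear : scalar eps;
  coalg_counit_degree : forall d c, d != (0%N, 0) -> c \in G d -> eps c = 0;
  coalg_counit : forall n r t c, (r + 1 + t = n)%N -> n != 2%N ->
    insert r 1 t 0 (fun cs => (eps cs`_0)%:A) (Delta n c) = 0;
  coalg_counit_l : forall c,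
    insert 0 1 1 0 (fun cs => (eps cs`_0)%:A) (Delta 2%N c) = tvec c;
  coalg_counit_r : forall c,
    insert 1 1 0 0 (fun cs => (eps cs`_0)%:A) (Delta 2%N c) = tvec c;
  coalg_coaug_linear : linear (eta : k^o -> C);
  coalg_coaug_degree : eta 1 \in G (0%N, 0);
  coalg_counit_coaug : forall x, eps (eta x) = x;
  coalg_coaug2 : Delta 2%N (eta 1) = tvec (eta 1) * tvec (eta 1);
  coalg_coaug : forall n, (0 < n)%N -> n != 2%N -> Delta n (eta 1) = 0 }.

Definition minimal_coalgebra (Delta : nat -> C -> talg C) : Prop :=
  forall c, Delta 1%N c = 0.

(** [m n] is a map on [talg C] of which only the restriction to [C^(x)n]
    matters. *)
Record augmented_Aoo_algebra (m : nat -> talg C -> C) (eta : k -> C)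
    (eps : C -> k) : Prop := {
  alg_bigraded : direct_sum G;
  alg_connected : connected;
  alg_linear : forall n x y (a : k), (0 < n)%N ->
    x \in tpow C n -> y \in tpow C n -> m n (a *: x + y) = a *: m n x + m n y;
  alg_degree : forall n p a x, (0 < n)%N -> x \in gtens G n (p, a) ->
    m n x \in sumsp (fun q => (q + n = p + 2)%N) (fun q => G (q, a));
  alg_identity : forall n x, (0 < n)%N -> x \in tpow C n ->
    \sum_(r < n.+1) \sum_(s < n.+1) \sum_(t < n.+1 |
        (0 < s)%N && (r + s + t == n)%N)
      (-1) ^+ (r + s * t) *:
      m (r + 1 + t)%N
        (insert r s t s (fun bs => tvec (m s (\prod_(b <- bs) tvec b))) x) = 0;
  alg_unit_linear : linear (eta : k^o -> C);
  alg_unit_degree : eta 1 \in G (0%N, 0);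
  alg_unit : forall n r t x, (r + 1 + t = n)%N -> n != 2%N ->
    x \in tpow C (r + t) ->
    m n (insert r 0 t 0 (fun=> tvec (eta 1)) x) = 0;
  alg_unit_r : forall b, m 2%N (tvec b * tvec (eta 1)) = b;
  alg_unit_l : forall b, m 2%N (tvec (eta 1) * tvec b) = b;
  alg_aug_linear : scalar eps;
  alg_aug_degree : forall d b, d != (0%N, 0) -> b \in G d -> eps b = 0;
  alg_aug_unit : forall x, eps (eta x) = x;
  alg_aug2 : forall b b', eps (m 2%N (tvec b * tvec b')) = eps b * eps b';
  alg_aug : forall n x, (0 < n)%N -> n != 2%N -> x \in tpow C n ->
    eps (m n x) = 0 }.

Definition minimal_algebra (m : nat -> talg C -> C) : Prop :=
  forall x, x \in tpow C 1%N -> m 1%N x = 0.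

(** ** Graded dual *)

Definition gdual_pred : submodClosed (C -> k^o) :=
  lspan (fun f : C -> k^o => scalar f /\
    exists d, forall d' c, d' != d -> c \in G d' -> f c = 0).

(** The direct sum of the duals of the components. *)
Definition gdual : lmodType k := sub gdual_pred.

Definition gdual_eval (f : gdual) (c : C) : k := val f c.

(** The functional [f] as an element of the graded dual, when it is one. *)
Definition to_gdual (f : C -> k^o) : gdual := insubd 0 f.

(** The dual of the component of homological degree [p] and Adams degree [a]
    has cohomological degree [p] and Adams degree [- a]. *)
Definition gdual_gr (d : nat * int) : submodClosed gdual :=
  lspan (fun f : gdual =>
    forall d' c, d' != (d.1, - d.2) -> c \in G d' -> gdual_eval f c = 0).

(** [c (f_1 (x) ... (x) f_n)], each [f_l] being given with its degree. *)
Definition dual_pairing (fs : seq (nat * gdual)) : talg C -> k :=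
  hlift (X := k^o) (fun ws =>
    if size ws == size fs then
      (-1) ^+ (\sum_(l < size fs)
                 nth 0 [seq w.1 | w <- ws] l * \sum_(f <- drop l.+1 fs) f.1) *
      \prod_(q <- zip fs ws) gdual_eval q.1.2 q.2.2
    else 0).

End Koszul.

(** [m_n = Delta_n^# o c]; the first sign is that of the transpose of a map of
    degree [n - 2]. *)
Definition dual_mult (k : fieldType) (C : lmodType k)
    (G : nat * int -> submodClosed C) (Delta : nat -> C -> talg C) (n : nat) :
    talg (gdual G) -> gdual G :=
  hlift (@gdual_gr k C G) (fun fs =>
    if size fs == n then
      to_gdual G (fun c => (-1) ^+ (n * \sum_(f <- fs) f.1) *
                           dual_pairing fs (Delta n c))
    else 0).

Definition dual_unit (k : fieldType) (C : lmodType k)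
    (G : nat * int -> submodClosed C) (eps : C -> k) (x : k) : gdual G :=
  to_gdual G (fun c => x * eps c).

Definition dual_aug (k : fieldType) (C : lmodType k)
    (G : nat * int -> submodClosed C) (eta : k -> C) (f : gdual G) : k :=
  gdual_eval f (eta 1).

(** * The A-infinity coalgebra structure on the direct sum of the [J_i] *)

Section JCoalgebra.
Variables (k : fieldType) (V : lmodType k) (Vg : nat -> submodClosed V).
Local Notation T := (talg V).
Variable R : submodClosed T.

(** Finitely supported families [f] with [f i] in [J_i]. *)
Definition Jsum_pred : submodClosed (nat -> T) :=
  lspan (fun f => exists2 i, f i \in J R i & forall j, j != i -> f j = 0).
Definition Jsum : lmodType k := sub Jsum_pred.

Definition Jcomp (c : Jsum) (i : nat) : T := val c i.

Definition Jgr (d : nat * int) : submodClosed Jsum :=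
  lspan (fun c : Jsum => (forall j, j != d.1 -> Jcomp c j = 0) /\
    exists2 a : nat, d.2 = a%:Z & Jcomp c d.1 \in gtalg Vg a).

(** [J_(i_1) (x) ... (x) J_(i_n)] inside [talg Jsum]. *)
Definition Jtens (ii : seq nat) : submodClosed (talg Jsum) :=
  tensp [seq hpart Jgr i | i <- ii].

(** The product [J_(i_1) (x) ... (x) J_(i_n) -> T(V)]. *)
Definition Jprod : talg Jsum -> T :=
  hlift Jgr (fun ws => \prod_(w <- ws) Jcomp w.2 w.1).

(** The maps iota are the inclusions of subspaces of [T(V)], possibly projected;
    their values are chosen as preimages under [Jprod], unique since the product
    of the [J_i] in [T(V)] is a tensor product. If [i] and [i'] are odd, [x] is
    written in [T(V) (x) J_i (x) J_i'] before applying [eps (x) id (x) id]. *)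
Definition iota2 (i i' : nat) (x : T) : talg Jsum :=
  if odd i && odd i' then
    xget 0 (fun t => exists s : seq (T * talg Jsum),
      [/\ forall q, q \in s -> q.2 \in Jtens [:: i; i'],
          x = \sum_(q <- s) q.1 * Jprod q.2 &
          t = \sum_(q <- s) taug q.1 *: q.2])
  else xget 0 (fun t => t \in Jtens [:: i; i'] /\ Jprod t = x).

(** For [ii = [:: 2 j_1 + 1; ...; 2 j_n + 1]]: the intersection of the
    [V^(m_1) J_(2 j_1) ... V^(m_n) J_(2 j_n) V^(m_(n+1))] over
    [m_1 + ... + m_(n+1) = N]. *)
Definition iota_summand (ii : seq nat) (N : nat) : submodClosed T :=
  cap (fun ms : seq nat => size ms = (size ii).+1 /\ sumn ms = N)
    (fun ms => prodsp (braid (J_even R) ms [seq i./2 | i <- ii])).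

Definition iota_odd (ii : seq nat) (x : T) : talg Jsum :=
  xget 0 (fun t => t \in Jtens ii /\
    exists (M : nat) (xN : nat -> T),
      [/\ (size ii < M)%N,
          forall N, xN N \in iota_summand ii N,
          x = \sum_(2 <= N < M) xN N &
          Jprod t = xN (size ii)]).

Definition JDelta (n : nat) (c : Jsum) : talg Jsum :=
  match n with
  | 0 | 1 => 0
  | 2 => \sum_(i \in [set: nat]) \sum_(l < i.+1) iota2 l (i - l) (Jcomp c i)
  | _ => \sum_(i \in [set: nat])
           \sum_(ii : n.-tuple 'I_(i + n) |
               all (fun l : 'I_(i + n) => odd l) ii &&
               (\sum_(l <- ii) l == i + n - 2)%N)
             iota_odd [seq nat_of_ord l | l <- ii] (Jcomp c i)
  end.

Definition Jeps (c : Jsum) : k := taug (Jcomp c 0).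

Lemma Jeta_subproof (x : k) :
  (fun i => if i == 0%N then x%:A else 0 : T) \in Jsum_pred.
Proof.
apply: mem_lspan; exists 0%N => [|j /negbTE->//].
by rewrite eqxx; apply/rpredZ/mem_lspan; exists [::]; rewrite ?big_nil.
Qed.

Definition Jeta (x : k) : Jsum := SubElt (Jeta_subproof x).

End JCoalgebra.

Arguments gdual_gr {k C} G d.
Arguments dual_mult {k C} G Delta n x.
Arguments dual_unit {k C} G eps x.
Arguments dual_aug {k C} G eta f.
Arguments JDelta {k V} Vg R n c.
Arguments Jeps {k V} R c.

(* Main.v *)
Require Import Defs.
From HB Require Import structures.
From mathcomp Require Import all_boot all_order all_algebra finmap.
From mathcomp Require Import boolp classical_sets functions fsbigop.
From mathcomp.multinomials Require Import monalg.
From mathcomp Require Import zify ring.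

(** Minimality of [R] makes it free on both sides in [T(V)], so that products of
    the [J_i] are tensor products and a tensor in [J (x) ... (x) J] is determined
    by the products in [T(V)] of its components. Each [x] in [J_(2s+2)] is
    uniquely a sum of [x_N] lying in all [V^(m_1) J_(2n_1) ... V^(m_(s+1))] with
    [m_1 + ... + m_(s+1) = N], and the component of [Delta_n] in
    [J_(i_1) (x) ... (x) J_(i_n)] is [x_n] when all the [i_l] are odd, [x] when
    [n = 2] and some [i_l] is even, and zero otherwise. By uniqueness, these
    decompositions are compatible with splitting off a factor [J_i] on either
    side; hence each component of the A-infinity identity has at most two nonzero
    terms, determined by the even indices, and they cancel.

    On the dual side, evaluating [m_n] on functionals of degrees [p_1, ..., p_n]
    amounts to pairing them with [Delta_n] up to the sign
    [(-1)^(n sum_l p_l + sum_(l < l') p_l p_l')]. With these signs the identities of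
    the algebra and of the coalgebra agree term by term up to a global sign. *)

Set Implicit Arguments.
Unset Strict Implicit.
Unset Printing Implicit Defensive.

Import GRing.Theory.
Local Open Scope ring_scope.

(** * Subspaces and functionals *)

(** Relations need not be homogeneous for word length, so the index $N$ of $x_N$ is no degree of
    $x$. The $x_N$ are unique because they all lie in spaces $F V^{(N)} A$ with $F \otimes T(V) \to
    T(V)$ and $T(V) \otimes A \to T(V)$ injective. A compatibility is then an equality of two
    decompositions, proved by choosing $F$ and $A$ so that $F V^{(N)} A$ contains both. Freeness of
    $R$ comes from contracting the last (or first) letter with functionals, a derivation twisted by
    the augmentation; minimality disposes of the constant terms. Injectivity is phrased with
    functionals on one factor, and such contractions also test membership in a product of subspaces;
    this turns intersections of products into products of intersections. The maps of the definitions
    are given on chosen representatives ([hlift], [xget]); they are compared with linear maps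
    obtained from the universal property of the tensor algebra, where signs depending on degrees
    become operators acting on letters. *)

Section LinearAlgebra.
Variables (k : fieldType).
Implicit Types (U W X Y : lmodType k).

Lemma linear_exists U W (f : U -> W) : linear f -> {g : {linear U -> W} | g =1 f}.
Proof.
move=> lf; pose g : {linear U -> W} :=
  HB.pack f (GRing.isLinear.Build _ _ _ _ f lf).
by exists g.
Qed.

Lemma scalar_exists U (f : U -> k) : scalar f -> {g : {scalar U} | g =1 f}.
Proof.
move=> lf; pose g : {scalar U} := HB.pack f (GRing.isLinear.Build _ _ _ _ f lf).
by exists g.
Qed.

Lemma rpredL U (S : submodClosed U) a x y :
  x \in S -> y \in S -> a *: x + y \in S.
Proof. by move=> xS yS; rewrite rpredD ?rpredZ. Qed.

Lemma rpredBm U (S : submodClosed U) x y : x \in S -> y \in S -> x - y \in S.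
Proof. by move=> xS yS; rewrite -scaleN1r addrC rpredL. Qed.

Lemma rpred_seq U (S : submodClosed U) (I : eqType) (s : seq I) (F : I -> U) :
  (forall i, i \in s -> F i \in S) -> \sum_(i <- s) F i \in S.
Proof. by move=> FS; rewrite big_seq rpred_sum. Qed.

Lemma lspan_ind U (P : set U) (Q : U -> Prop) :
  Q 0 -> (forall a x y, P x -> Q y -> Q (a *: x + y)) ->
  forall x, x \in lspan P -> Q x.
Proof.
move=> Q0 QD x /asboolP[s [sP ->]].
elim: s sP => [|q s IHs] sP; first by rewrite big_nil.
rewrite big_cons; apply: QD; first by apply: sP; rewrite mem_head.
by apply: IHs => q' q's; apply: sP; rewrite inE q's orbT.
Qed.

Lemma lspan_sub U (P : set U) (S : submodClosed U) :
  (forall x, P x -> x \in S) -> forall x, x \in lspan P -> x \in S.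
Proof. by move=> PS; apply: lspan_ind => [|a x y /PS]; [apply: rpred0|apply: rpredL]. Qed.

Lemma lspan_linear U W (P : set U) (f g : {linear U -> W}) :
  (forall x, P x -> f x = g x) -> forall x, x \in lspan P -> f x = g x.
Proof.
move=> fg; apply: lspan_ind => [|a x y /fg xE yE]; first by rewrite !linear0.
by rewrite !linearP xE yE.
Qed.

Lemma sumsp_sub U I (P : set I) (F : I -> submodClosed U) (S : submodClosed U) :
  (forall i x, P i -> x \in F i -> x \in S) ->
  forall x, x \in sumsp P F -> x \in S.
Proof. by move=> FS; apply: lspan_sub => x [i Pi /FS]; apply. Qed.

Lemma mem_sumsp U I (P : set I) (F : I -> submodClosed U) i x :
  P i -> x \in F i -> x \in sumsp P F.
Proof. by move=> Pi xF; apply: mem_lspan; exists i. Qed.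

Lemma mem_cap2 U (S S' : submodClosed U) x :
  (x \in cap2 S S') = (x \in S) && (x \in S').
Proof.
apply/asboolP/andP => [h|[xS xS'] [] _ //].
by split; [apply: (h true)|apply: (h false)].
Qed.

(** Closure proofs are irrelevant, so equality is extensional; associativity and unit laws of
    products of subspaces can then be used by rewriting. *)
Lemma submod_ext U (S S' : submodClosed U) : S =i S' -> S = S'.
Proof.
case: S => f [[a1] [a2]]; case: S' => g [[b1] [b2]] /= e.
have efg : f = g by apply/funext => x; exact: (e x).
case: _ / efg in b1 b2 e *; congr (GRing.SubmodClosed.Pack _).
by rewrite (Prop_irrelevance a1 b1) (Prop_irrelevance a2 b2).
Qed.

(** A subspace maximal among those containing [S] and avoiding [u] is a complement of the line
    [k u]; the functional is the coordinate along [u]. *)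
Lemma functional_separation U (S : submodClosed U) u : u \notin S ->
  exists f : {scalar U}, (forall x, x \in S -> f x = 0) /\ f u = 1.
Proof.
move=> uS.
pose good (M : set U) := [/\ forall x, x \in S -> M x,
   forall (a : k) x y, M x -> M y -> M (a *: x + y) & ~ M u].
pose P (M : set U) := M = set0 \/ good M.
have S0 : good (fun x => x \in S).
  by split=> [|a x y|] //; [apply: rpredL|apply/negP].
have [F FP Ftot|M [PM Mmax]] := @Zorn_bigcup _ P.
  have [[A FA [a Aa]]|Fe] := pselect (exists2 A, F A & exists a, A a); last first.
    left; apply/seteqP; split=> x // [A FA Ax].
    by case: Fe; exists A => //; exists x.
  right; have gF B b : F B -> B b -> good B.
    by move=> /FP[->|].
  split=> [x xS|c x y [B FB Bx] [B' FB' B'y]|[B FB Bu]].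
  - by exists A => //; have [h _ _] := gF _ _ FA Aa; apply: h.
  - have [sB|sB] := Ftot _ _ FB FB'.
      exists B' => //; have [_ h _] := gF _ _ FB' B'y.
      by apply: h => //; apply: sB.
    exists B => //; have [_ h _] := gF _ _ FB Bx.
    by apply: h => //; apply: sB.
  - by have [_ _] := gF _ _ FB Bu; apply.
have gM : good M.
  case: PM => // M0; case: (Mmax (fun x => x \in S)); last by right.
  rewrite M0; split=> // /(_ 0); apply; exact: rpred0.
have [SM Mlin Mu] := gM.
have M0 : M 0 by apply: SM; apply: rpred0.
have MZ a x : M x -> M (a *: x) by move=> Mx; rewrite -[_ *: _]addr0; apply: Mlin.
(* If [x] is not in [M], maximality puts [u] in [M + k x]; the coefficient of [x] is nonzero since
   [u] is not in [M], so [x] can be solved for. *)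
have decomp x : exists a : k, M (x - a *: u).
  have [Mx|Mx] := pselect (M x); first by exists 0; rewrite scale0r subr0.
  pose M' : set U := fun y => exists2 a : k, M (y - a *: x) & True.
  have nM' : M' u.
    apply: contrapT => M'u; apply: (Mmax M'); first split.
    - by move=> y My; exists 0 => //; rewrite scale0r subr0.
    - by move=> /(_ x) h; apply/Mx/h; exists 1 => //; rewrite scale1r subrr.
    right; split=> // [y yS|a y z [b Mb _] [c Mc _]].
      by exists 0 => //; rewrite scale0r subr0; apply: SM.
    exists (a * b + c) => //.
    suff -> : a *: y + z - (a * b + c) *: x = a *: (y - b *: x) + (z - c *: x).
      exact: Mlin.
    by rewrite scalerBr scalerDl scalerA opprD addrACA.
  case: nM' => a Ma _.
  have [a0|a0] := eqVneq a 0; first by case: Mu; rewrite a0 scale0r subr0 in Ma.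
  exists a^-1; move: (MZ (- a^-1) _ Ma).
  by rewrite scalerBr scalerA !scaleNr mulNr mulVf // scaleN1r opprK addrC.
have uniq_dec x a b : M (x - a *: u) -> M (x - b *: u) -> a = b.
  move=> Ma Mb; apply/eqP; rewrite -subr_eq0; apply/negPn/negP => ab.
  apply: Mu; have := Mlin (-1) _ _ Ma Mb.
  rewrite scaleN1r opprB addrA subrK -scaleNr -scalerDl.
  by move/(MZ (a - b)^-1); rewrite scalerA mulVf ?scale1r.
pose f x := projT1 (cid (decomp x)).
have fP x : M (x - f x *: u) := projT2 (cid (decomp x)).
have lf : scalar f.
  move=> a x y; apply: (uniq_dec (a *: x + y)); first exact: fP.
  have -> : a *: x + y - (a * f x + f y) *: u
    = a *: (x - f x *: u) + (y - f y *: u).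
    by rewrite scalerBr scalerDl scalerA opprD addrACA.
  by apply: Mlin; apply: fP.
have [g gE] := scalar_exists lf; exists g; split=> [x xS|].
  rewrite gE; apply: (uniq_dec x); first exact: fP.
  by rewrite scale0r subr0; apply: SM.
rewrite gE; apply: (uniq_dec u); first exact: fP.
by rewrite scale1r subrr.
Qed.

(** Vectors are added one at a time: for [c] outside the span of [s], the new vector is the error of
    the expansion already available, and its functional vanishes on [s] and is 1 at [c]. *)
Lemma dual_family U (S : submodClosed U) (s : seq U) :
  (forall c, c \in s -> c \in S) ->
  exists (n : nat) (b : nat -> U) (f : nat -> {scalar U}),
    (forall i, b i \in S) /\
    forall c, c \in s -> c = \sum_(i < n) f i c *: b i.
Proof.
elim: s => [|c s IHs] sS.
  by exists 0%N, (fun=> 0), (fun=> \0); split=> // i; apply: rpred0.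
have [x xs|n [b [f [bS bE]]]] := IHs; first by apply: sS; rewrite inE xs orbT.
have [cs|cs] := boolP (c \in lspan (fun x => x \in s)).
  exists n, b, f; split=> // x; rewrite inE => /predU1P[->|/bE //].
  elim/lspan_ind: cs => [|a u v us vE].
    by rewrite big1 // => i _; rewrite linear0 scale0r.
  rewrite {1}vE {1}[u]bE // scaler_sumr -big_split; apply: eq_bigr => i _ /=.
  by rewrite linearP scalerDl scalerA.
have [g [g0 g1]] := functional_separation cs.
pose c' := c - \sum_(i < n) f i c *: b i.
have c'S : c' \in S.
  apply: rpredBm; first by apply: sS; rewrite mem_head.
  by apply: rpred_sum => i _; apply: rpredZ.
exists n.+1, (fun i => if (i < n)%N then b i else c'),
  (fun i => if (i < n)%N then f i else g).
split=> [i|x]; first by case: ifP.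
rewrite big_ord_recr /= ltnn => xs.
under eq_bigr => i _ do rewrite ltn_ord.
move: xs; rewrite inE => /predU1P[->|xs]; first by rewrite g1 scale1r addrC subrK.
by rewrite g0 ?scale0r ?addr0 -?bE //; apply: mem_lspan.
Qed.

(** The tensor [\sum_(q <- s) q.1 (x) q.2] vanishes. *)
Definition tensor0 U X (s : seq (U * X)) :=
  forall f : {scalar U}, \sum_(q <- s) f q.1 *: q.2 = 0.

(** The inclusion [jin] of $J_i$ into the direct sum is linear only on $J_i$, hence a relative
    notion. *)
Definition linear_on U X (S : submodClosed U) (f : U -> X) :=
  forall a u v, u \in S -> v \in S -> f (a *: u + v) = a *: f u + f v.

Lemma linear_on0 U X (S : submodClosed U) (f : U -> X) : linear_on S f -> f 0 = 0.
Proof.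
move=> fl; have := fl (-1) 0 0 (rpred0 _) (rpred0 _).
by rewrite scaler0 addr0 scaleN1r addNr.
Qed.

Lemma linear_on_sum U X (S : submodClosed U) (f : U -> X) n (a : nat -> k)
    (b : nat -> U) :
  linear_on S f -> (forall i, b i \in S) ->
  f (\sum_(i < n) a i *: b i) = \sum_(i < n) a i *: f (b i).
Proof.
move=> fl bS; elim: n => [|n IHn]; first by rewrite !big_ord0 (linear_on0 fl).
rewrite !big_ord_recr /= addrC fl ?IHn 1?addrC //.
by apply: rpred_sum => i _; apply: rpredZ.
Qed.

(** Expanding the left factors along a finite family [b] moves all the information of the tensor
    into its contractions by the functionals [f i]. *)
Lemma tensor_regroup U X (S : submodClosed U) (s : seq (U * X)) :
  (forall q, q \in s -> q.1 \in S) ->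
  exists (n : nat) (b : nat -> U) (f : nat -> {scalar U}),
    (forall i, b i \in S) /\
    forall (Y : lmodType k) (g : U -> X -> Y),
      (forall x, linear_on S (g^~ x)) -> (forall u, linear (g u)) ->
      \sum_(q <- s) g q.1 q.2 =
      \sum_(i < n) g (b i) (\sum_(q <- s) f i q.1 *: q.2).
Proof.
move=> sS; have [|n [b [f [bS bE]]]] := @dual_family _ S [seq q.1 | q <- s].
  by move=> c /mapP[q qs ->]; apply: sS.
exists n, b, f; split=> // Y g g1 g2.
have -> : \sum_(q <- s) g q.1 q.2 =
    \sum_(q <- s) \sum_(i < n) f i q.1 *: g (b i) q.2.
  rewrite !big_seq; apply: eq_bigr => q qs; rewrite {1}[q.1]bE ?map_f //.
  exact: (linear_on_sum n (fun i => f i q.1) (g1 _)).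
rewrite exchange_big; apply: eq_bigr => i _ /=.
have [h hE] := linear_exists (g2 (b i)).
by rewrite -hE linear_sum; apply: eq_bigr => q _; rewrite linearZ hE.
Qed.

(** Justifies [tensor0] as the vanishing of a tensor: after regrouping, the value of a bilinear map
    involves only contractions. *)
Lemma tensor0_bilinear U X Y (S : submodClosed U) (s : seq (U * X))
    (g : U -> X -> Y) :
  (forall x, linear_on S (g^~ x)) -> (forall u, linear (g u)) ->
  (forall q, q \in s -> q.1 \in S) -> tensor0 s ->
  \sum_(q <- s) g q.1 q.2 = 0.
Proof.
move=> g1 g2 sS s0; have [n [b [f [_ ->]]]] // := tensor_regroup sS.
rewrite big1 // => i _; rewrite s0.
by have [h hE] := linear_exists (g2 (b i)); rewrite -hE linear0.
Qed.

End LinearAlgebra.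

(** * The tensor algebra *)

Section TensorAlgebraTheory.
Variables (k : fieldType) (W : lmodType k).
Local Notation free := {malg k[{fmonom W}]}.
Local Notation T := (talg W).

Definition tword (ws : seq W) : T := \prod_(w <- ws) tvec w.

Lemma tword_nil : tword [::] = 1. Proof. exact: big_nil. Qed.
Lemma tword_cons w ws : tword (w :: ws) = tvec w * tword ws.
Proof. exact: big_cons. Qed.
Lemma tword_cat ws ws' : tword (ws ++ ws') = tword ws * tword ws'.
Proof. exact: big_cat. Qed.
Lemma tword1 w : tword [:: w] = tvec w. Proof. exact: big_seq1. Qed.

Lemma malg_monomE (c : k) (m : {fmonom W}) : << c *g m >> = c *: (<< m >> : free).
Proof. by apply/malgP => m'; rewrite mcoeffZ !mcoeffU mulrnAr mulr1. Qed.

Lemma malg_sumE (x : free) : x = \sum_(m <- msupp x) x@_m *: << m >>.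
Proof. by rewrite {1}[x]monalgE; apply: eq_bigr => m _; rewrite malg_monomE. Qed.

Lemma malg_mulUU (m m' : {fmonom W}) :
  (<< m >> : free) * << m' >> = << monalg.fmmul m m' >>.
Proof. by rewrite malgM_def fgmulUU mulr1. Qed.

Lemma tword_pi (ws : seq W) :
  tword ws = (\pi_T (<< monalg.FMonom ws >> : free))%qT.
Proof.
elim: ws => [|w ws IHws].
  rewrite tword_nil; congr (\pi_T _)%qT; apply/malgP => m.
  by rewrite !mcoeffU !fmP fm1.
rewrite tword_cons IHws talg_pi_mul malg_mulUU; congr (\pi_T (<< _ >> : free))%qT.
by rewrite /fmmul /fmu !fmE.
Qed.

Lemma talg_ind (Q : T -> Prop) : Q 0 ->
  (forall a ws y, Q y -> Q (a *: tword ws + y)) -> forall x, Q x.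
Proof.
move=> Q0 QD x; elim/quotW: x => x.
rewrite [x]malg_sumE; elim: (msupp x : seq _) => [|m s IHs].
  by rewrite big_nil (raddf0 (\pi_T)%qT).
rewrite big_cons lquot_piD -talg_pi_scale; case: m => ws.
by rewrite -tword_pi; apply: QD.
Qed.

Lemma talg_linear_ext (X : lmodType k) (f g : {linear T -> X}) :
  (forall ws, f (tword ws) = g (tword ws)) -> f =1 g.
Proof.
move=> fg; elim/talg_ind => [|a ws y fgy]; first by rewrite !linear0.
by rewrite !linearP fg fgy.
Qed.

Definition multilinear (X : lmodType k) (F : seq W -> X) :=
  forall s1 s2 a u v,
    F (s1 ++ (a *: u + v) :: s2) = a *: F (s1 ++ u :: s2) + F (s1 ++ v :: s2).

Lemma malg_linear_exists (X : lmodType k) (F : seq W -> X) :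
  exists f : {linear free -> X}, forall m, f << m >> = F m.
Proof.
pose f (x : free) := \sum_(m <- msupp x) x@_m *: F m.
(* Summing over any finite set that contains the support makes additivity visible. *)
have fE (d : {fset {fmonom W}}) x : (msupp x `<=` d)%fset ->
    f x = \sum_(m <- d) x@_m *: F m.
  move=> sd; rewrite /f (big_fset_incl _ sd) //= => m _ /mcoeff_outdom ->.
  by rewrite scale0r.
have lf : linear f.
  move=> a x y; pose d := (msupp (a *: x + y) `|` msupp x `|` msupp y)%fset.
  have [d1 d2 d3] : [/\ msupp (a *: x + y) `<=` d, msupp x `<=` d & msupp y `<=` d]%fset.
    split; apply/fsubsetP => m; rewrite !inE => ->; rewrite ?orbT //.
  rewrite !(fE d) // scaler_sumr -big_split; apply: eq_bigr => m _ /=.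
  by rewrite mcoeffD mcoeffZ scalerDl scalerA.
have [g gE] := linear_exists lf; exists g => m.
by rewrite gE /f msuppU1 big_seq_fset1 mcoeffUU scale1r.
Qed.

(** The linear extension of [F] to noncommutative polynomials kills the defining relations because
    [F] is linear in each letter. *)
Lemma talg_universal (X : lmodType k) (F : seq W -> X) : multilinear F ->
  {f : {linear T -> X} | forall ws, f (tword ws) = F ws}.
Proof.
move=> Fl; apply: cid; have [f fE] := malg_linear_exists F.
have f0 x : x \in lspan (@talg_rel k W) -> f x = 0.
  move: x; refine (@lspan_ind _ free _ (fun x => f x = 0) _ _) => [|a u z].
    exact: linear0.
  move=> [y [y' [b [w [w' ->]]]]] z0.
  rewrite linearP z0 addr0.
  set r : free := (letter _ - _ - _).
  (* By bilinearity the two outer polynomials may be taken to be monomials. *)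
  suff h m m' : f (<< m >> * r * << m' >>) = 0.
    rewrite -mulrA {1}[y]malg_sumE; move: r h => r h.
    rewrite mulr_suml linear_sum big1 ?scaler0 // => m _.
    rewrite -scalerAl linearZ mulrA {1}[y']malg_sumE mulr_sumr linear_sum.
    rewrite big1 /= ?scaler0 // => m' _.
    by rewrite -free_scalerAr linearZ h /= scaler0.
  rewrite /r /letter !mulrBr !mulrBl.
  rewrite -free_scalerAr -scalerAl !malg_mulUU.
  rewrite 2!linearB linearZ !fE /fmmul /fmu !fmE /= -!catA !cat_cons Fl /=.
  by rewrite addrAC addrK subrr.
have fpi x : f (repr (\pi_T x)%qT) = f x.
  apply/eqP; rewrite -subr_eq0 -linearB; apply/eqP/f0.
  by apply/lquot_eq; rewrite reprK.
have lg : linear (fun x : T => f (repr x)).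
  move=> a x y; elim/quotW: x => x; elim/quotW: y => y.
  by rewrite talg_pi_scale -lquot_piD !fpi linearP.
have [g gE] := linear_exists lg; exists g => ws.
by rewrite gE tword_pi fpi fE.
Qed.

Lemma fold_multilinear (X : lmodType k) (m : W -> X -> X) x0 :
  (forall x, linear (m^~ x)) -> (forall w, linear (m w)) ->
  multilinear (foldr m x0).
Proof.
move=> m1 m2 s1 s2 a u v; rewrite !foldr_cat /= m1.
elim: s1 => //= w s1 ->; exact: m2.
Qed.

(** Recursion on the first letter, the source of most linear maps below: Adams components, products
    of components, pairings and sign operators. *)
Lemma talg_fold (X : lmodType k) (m : W -> X -> X) x0 :
  (forall x, linear (m^~ x)) -> (forall w, linear (m w)) ->
  {f : {linear T -> X} | f 1 = x0 /\ forall w t, f (tvec w * t) = m w (f t)}.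
Proof.
move=> m1 m2; have [f fE] := talg_universal (fold_multilinear x0 m1 m2).
exists f; split=> [|w]; first by rewrite -tword_nil fE.
elim/talg_ind => [|a ws y IHy].
  have [g gE] := linear_exists (m2 w); rewrite mulr0 -gE !linear0 //.
rewrite mulrDr -scalerAr !linearP IHy -tword_cons !fE /=.
by have [g gE] := linear_exists (m2 w); rewrite -!gE linearP.
Qed.

Lemma tvec_linear : linear (@tvec k W).
Proof.
move=> a u v; rewrite /tvec talg_pi_scale -lquot_piD; apply/lquot_eq.
apply: mem_lspan; exists 1, 1, a, u, v.
by rewrite mul1r mulr1 opprD addrA.
Qed.
HB.instance Definition _ := GRing.isLinear.Build k W T _ (@tvec k W) tvec_linear.

Lemma tword_multilinear : multilinear tword.
Proof.
move=> s1 s2 a u v; rewrite !tword_cat !tword_cons linearP.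
by rewrite mulrDl mulrDr -scalerAl -scalerAr.
Qed.

Lemma taug_pi (x : free) : taug (\pi_T x)%qT = x@_mone.
Proof.
apply/eqP; rewrite -subr_eq0 /taug -mcoeffB; apply/eqP.
have : repr (\pi_T x)%qT - x \in lspan (@talg_rel k W).
  by apply/lquot_eq; rewrite reprK.
move: (repr _ - x); refine (@lspan_ind _ free _ (fun x => x@_mone = 0) _ _) => [|a u z].
  exact: mcoeff0.
move=> [y [y' [b [w [w' ->]]]]] z0.
rewrite mcoeffD z0 addr0 mcoeffZ !rmorphM /= !mcoeffB mcoeffZ /letter !mcoeffU.
by rewrite !fmP fm1 !fmuE /= mulr0 !subr0 mulr0 mul0r mulr0.
Qed.

Lemma taug_linear : scalar (@taug k W : T -> k).
Proof.
move=> a x y; elim/quotW: x => x; elim/quotW: y => y.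
by rewrite talg_pi_scale -lquot_piD !taug_pi mcoeffD mcoeffZ.
Qed.
HB.instance Definition _ := GRing.isLinear.Build k T k *%R (@taug k W) taug_linear.

Lemma taug_word ws : taug (tword ws) = (ws == [::])%:R.
Proof.
by rewrite tword_pi taug_pi mcoeffU fmP fm1.
Qed.

End TensorAlgebraTheory.

(** * Word length, and contraction of the first or last letter *)

Section WordMaps.
Variables (k : fieldType) (W : lmodType k).
Local Notation T := (talg W).

Lemma tpow_word ws : tword ws \in tpow W (size ws).
Proof. by apply: mem_lspan; exists ws. Qed.

Lemma tpow_ind n (Q : T -> Prop) : Q 0 ->
  (forall a ws y, size ws = n -> Q y -> Q (a *: tword ws + y)) ->
  forall x, x \in tpow W n -> Q x.
Proof. by move=> Q0 QD; apply: lspan_ind => // a ? y [ws sz ->]; apply: QD. Qed.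

Lemma tpow_linear_ext n (X : lmodType k) (f g : {linear T -> X}) :
  (forall ws, size ws = n -> f (tword ws) = g (tword ws)) ->
  forall x, x \in tpow W n -> f x = g x.
Proof. by move=> fg; apply: lspan_linear => ? [ws sz ->]; apply: fg. Qed.

Lemma len_multilinear n :
  multilinear (fun ws : seq W => if size ws == n then tword ws else 0).
Proof.
move=> s1 s2 a u v; rewrite !size_cat /=; case: eqP => _.
  by rewrite tword_multilinear.
by rewrite scaler0 addr0.
Qed.
Definition tlen n : {linear T -> T} := sval (talg_universal (len_multilinear n)).

Lemma tlen_word n ws : tlen n (tword ws) = if size ws == n then tword ws else 0.
Proof. exact: (svalP (talg_universal (len_multilinear n))). Qed.

Lemma tlen_tpow m n x : x \in tpow W n -> tlen m x = if n == m then x else 0.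
Proof.
case: eqP => [<-|nm] xn.
  apply: (tpow_linear_ext (n := n) (g := idfun)) => // ws <-.
  by rewrite tlen_word eqxx.
apply: (tpow_linear_ext (n := n) (g := \0)) => // ws wsn.
by rewrite tlen_word wsn; case: eqP nm.
Qed.

Lemma tlen_mem n x : tlen n x \in tpow W n.
Proof.
elim/talg_ind: x => [|a ws y IH]; first by rewrite linear0 rpred0.
rewrite linearP rpredL // tlen_word; case: eqP => [<-|_]; first exact: tpow_word.
exact: rpred0.
Qed.

Lemma tlen_bound x : exists n, forall m, (n <= m)%N -> tlen m x = 0.
Proof.
elim/talg_ind: x => [|a ws y [n IH]]; first by exists 0%N => m _; rewrite linear0.
exists (maxn n (size ws).+1) => m; rewrite geq_max => /andP[nm wm].
by rewrite linearP IH // tlen_word ltn_eqF // scaler0 addr0.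
Qed.

Lemma tlen_sum n x : (forall m, (n <= m)%N -> tlen m x = 0) ->
  x = \sum_(m < n) tlen m x.
Proof.
have [n' xE] : exists n', forall m, (n' <= m)%N -> x = \sum_(i < m) tlen i x.
  elim/talg_ind: x => [|a ws y [n' IH]].
    by exists 0%N => m _; rewrite big1 // => i _; rewrite linear0.
  exists (maxn n' (size ws).+1) => m; rewrite geq_max => /andP[nm wm].
  under eq_bigr => i _ do rewrite linearP.
  rewrite big_split -scaler_sumr -IH //=; congr (_ *: _ + _).
  rewrite (bigD1 (Ordinal wm)) //= tlen_word eqxx big1 ?addr0 // => i /negP ni.
  rewrite tlen_word; case: eqP => // e; case: ni; apply/eqP/val_inj; exact: esym e.
move=> x0; rewrite {1}[x](xE (maxn n n')) ?leq_maxr //.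
rewrite -!(big_mkord xpredT (fun i => tlen i x)).
rewrite (big_cat_nat (n := n)) ?leq_maxl //= [X in _ + X]big1_seq ?addr0 // => i.
by rewrite mem_index_iota => /andP[_ /andP[/x0]].
Qed.

Variable psi : {scalar W}.

Lemma contr_multilinear : multilinear (fun ws : seq W =>
  if ws is w :: ws' then psi w *: tword ws' else 0).
Proof.
move=> [|w s1] s2 a u v /=; first by rewrite linearP scalerDl scalerA.
by rewrite tword_multilinear scalerDr !scalerA mulrC.
Qed.
Definition contr : {linear T -> T} := sval (talg_universal contr_multilinear).

Lemma contr_word ws :
  contr (tword ws) = if ws is w :: ws' then psi w *: tword ws' else 0.
Proof. exact: (svalP (talg_universal contr_multilinear)). Qed.

Lemma contr_vec w t : contr (tvec w * t) = psi w *: t.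
Proof.
elim/talg_ind: t => [|a ws y IH]; first by rewrite mulr0 linear0 scaler0.
rewrite mulrDr -scalerAr -tword_cons !linearP IH contr_word.
by rewrite !scalerA mulrC.
Qed.

(** A derivation twisted by the augmentation: the first letter of [t * r] comes from [r] only
    through the constant term of [t]. *)
Lemma contr_mul t r : contr (t * r) = contr t * r + taug t *: contr r.
Proof.
elim/talg_ind: t => [|a ws y IH]; first by rewrite !linear0 !mul0r scale0r addr0 linear0.
rewrite mulrDl -scalerAl !linearP IH mulrDl -scalerAl scalerDl addrACA; congr (_ + _).
rewrite -scalerA -scalerDr; congr (_ *: _); rewrite /= contr_word taug_word.
case: ws => [|w ws].
  by rewrite tword_nil mul1r mul0r add0r scale1r.
by rewrite tword_cons -mulrA contr_vec scale0r addr0 scalerAl.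
Qed.

Lemma contr_len n t : tlen n (contr t) = contr (tlen n.+1 t).
Proof.
elim/talg_ind: t => [|a ws y IH]; first by rewrite !linear0.
rewrite !linearP IH contr_word tlen_word; congr (_ *: _ + _).
case: ws => [|w ws] /=; first by rewrite !linear0.
rewrite eqSS linearZ /= tlen_word; case: eqP => _; last by rewrite scaler0 linear0.
by rewrite contr_word.
Qed.

Lemma contrr_multilinear : multilinear (fun ws : seq W =>
  if rev ws is w :: ws' then psi w *: tword (rev ws') else 0).
Proof.
move=> s1 s2 a u v; case/lastP: s2 => [|s2 w].
  by rewrite !cats1 !rev_rcons /= linearP scalerDl scalerA.
rewrite -!rcons_cons -!rcons_cat !rev_rcons /= !revK.
by rewrite tword_multilinear scalerDr !scalerA mulrC.
Qed.
Definition contrr : {linear T -> T} := sval (talg_universal contrr_multilinear).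

Lemma contrr_word ws w : contrr (tword (rcons ws w)) = psi w *: tword ws.
Proof.
by rewrite (svalP (talg_universal contrr_multilinear)) rev_rcons /= revK.
Qed.

Lemma contrr1 : contrr 1 = 0.
Proof. by rewrite -tword_nil (svalP (talg_universal contrr_multilinear)). Qed.

Lemma contrr_vec w t : contrr (t * tvec w) = psi w *: t.
Proof.
elim/talg_ind: t => [|a ws y IH]; first by rewrite mul0r linear0 scaler0.
rewrite mulrDl -scalerAl -tword1 -tword_cat cats1 !linearP contrr_word.
by rewrite tword1 IH !scalerA mulrC.
Qed.

Lemma contrr_mul t r : contrr (r * t) = r * contrr t + taug t *: contrr r.
Proof.
elim/talg_ind: t => [|a ws y IH]; first by rewrite !linear0 !mulr0 scale0r addr0 linear0.
rewrite mulrDr -scalerAr !linearP IH mulrDr -scalerAr scalerDl addrACA; congr (_ + _).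
rewrite -scalerA -scalerDr; congr (_ *: _); rewrite /= taug_word.
case/lastP: ws => [|ws w].
  by rewrite tword_nil mulr1 contrr1 mulr0 add0r scale1r.
rewrite contrr_word -cats1 tword_cat tword1 mulrA contrr_vec.
by rewrite cats1 -size_eq0 size_rcons scale0r addr0 scalerAr.
Qed.

Lemma contrr_len n t : tlen n (contrr t) = contrr (tlen n.+1 t).
Proof.
elim/talg_ind: t => [|a ws y IH]; first by rewrite !linear0.
rewrite !linearP IH tlen_word; congr (_ *: _ + _).
case/lastP: ws => [|ws w] /=; first by rewrite tword_nil contrr1 !linear0.
rewrite contrr_word size_rcons eqSS linearZ /= tlen_word.
by case: eqP => _; [rewrite contrr_word|rewrite scaler0 linear0].
Qed.

End WordMaps.
Arguments tlen {k W} n.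

(** * Detecting a tensor by its contractions *)

Section Separation.
Variables (k : fieldType) (W : lmodType k).
Local Notation T := (talg W).

Lemma tensor0_bilinearT (U X Y : lmodType k) (s : seq (U * X)) (g : U -> X -> Y) :
  (forall x, linear (g^~ x)) -> (forall u, linear (g u)) -> tensor0 s ->
  \sum_(q <- s) g q.1 q.2 = 0.
Proof.
move=> g1 g2; apply: (tensor0_bilinear (S := lspan setT)) => // [x a u v _ _|q _].
  exact: g1.
exact: mem_lspan.
Qed.

Lemma mulr_linearl (t : T) : linear (fun x : T => x * t).
Proof. by move=> a x y; rewrite mulrDl scalerAl. Qed.
Lemma mulr_linearr (t : T) : linear (fun x : T => t * x).
Proof. by move=> a x y; rewrite mulrDr scalerAr. Qed.

(** Without constant term, [u] is a sum of products of a letter and a tensor, and its contractions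
    are those of the corresponding element of $W \otimes T(W)$. *)
Lemma contr_separation (u : T) :
  taug u = 0 -> (forall psi, contr psi u = 0) -> u = 0.
Proof.
have [s uE] : exists s : seq (W * T), u = (taug u)%:A + \sum_(q <- s) tvec q.1 * q.2.
  elim/talg_ind: u => [|a ws y [s IH]].
    by exists [::]; rewrite linear0 scale0r big_nil addr0.
  case: ws => [|w ws].
    by exists s; rewrite {1}IH linearP scalerDl /= taug_word mulr1 addrA tword_nil.
  exists ((w, a *: tword ws) :: s); rewrite big_cons linearP /= taug_word mulr0 add0r /=.
  by rewrite {1}IH tword_cons addrCA scalerAr.
move=> u0 uD; rewrite uE u0 scale0r add0r in uD *.
apply: (tensor0_bilinearT (g := fun w t => tvec w * t)) => [x a v w|w|f].
- by rewrite linearP mulrDl scalerAl.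
- exact: mulr_linearr.
- rewrite -[RHS](uD f) linear_sum; apply: eq_bigr => q _.
  by rewrite contr_vec.
Qed.

Lemma contrr_separation (u : T) :
  taug u = 0 -> (forall psi, contrr psi u = 0) -> u = 0.
Proof.
have [s uE] : exists s : seq (W * T), u = (taug u)%:A + \sum_(q <- s) q.2 * tvec q.1.
  elim/talg_ind: u => [|a ws y [s IH]].
    by exists [::]; rewrite linear0 scale0r big_nil addr0.
  case/lastP: ws => [|ws w].
    by exists s; rewrite {1}IH linearP scalerDl /= taug_word mulr1 addrA tword_nil.
  exists ((w, a *: tword ws) :: s); rewrite big_cons linearP /= taug_word.
  rewrite -size_eq0 size_rcons mulr0 add0r /=.
  by rewrite {1}IH -cats1 tword_cat tword1 addrCA scalerAl.
move=> u0 uD; rewrite uE u0 scale0r add0r in uD *.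
apply: (tensor0_bilinearT (g := fun w t => t * tvec w)) => [x a v w|w|f].
- by rewrite linearP mulrDr scalerAr.
- exact: mulr_linearl.
- rewrite -[RHS](uD f) linear_sum; apply: eq_bigr => q _.
  by rewrite contrr_vec.
Qed.

End Separation.

(** * Free subspaces *)

(** Everything is stated for an associative product [op], to be instantiated
    with the product of [T(V)] and with the opposite product. *)
Section Free.
Variables (k : fieldType) (W : lmodType k).
Local Notation T := (talg W).
Variable op : T -> T -> T.
Hypothesis op_linl : forall t, linear (op^~ t).
Hypothesis op_linr : forall t, linear (op t).
Hypothesis opA : associative op.
Implicit Types (S A B F : submodClosed T) (X Y : nat -> submodClosed T).
Implicit Types (s : seq (T * T)).

Definition mulo S A : submodClosed T :=
  lspan (fun x => exists a b, [/\ a \in S, b \in A & x = op a b]).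

Lemma mem_mulo S A a b : a \in S -> b \in A -> op a b \in mulo S A.
Proof. by move=> aS bA; apply: mem_lspan; exists a, b. Qed.

Lemma mulo_sumP S A x : x \in mulo S A ->
  exists s, (forall q, q \in s -> q.1 \in S /\ q.2 \in A) /\
    x = \sum_(q <- s) op q.1 q.2.
Proof.
move: x; apply: lspan_ind => [|c ? y [a [b [aS bA ->]]] [s [sP ->]]].
  by exists [::]; rewrite big_nil.
exists ((c *: a, b) :: s); split=> [q|].
  by rewrite inE => /predU1P[->|/sP //]; rewrite rpredZ.
rewrite big_cons /=; congr (_ + _).
by have [h hE] := linear_exists (op_linl b); rewrite -!hE linearZ.
Qed.

Lemma mulo_sum S A s : (forall q, q \in s -> q.1 \in S /\ q.2 \in A) ->
  \sum_(q <- s) op q.1 q.2 \in mulo S A.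
Proof. by move=> sP; apply: rpred_seq => q /sP[]; apply: mem_mulo. Qed.

Lemma mulo_sub S A S' A' : {subset S <= S'} -> {subset A <= A'} ->
  {subset mulo S A <= mulo S' A'}.
Proof.
move=> sS sA; apply: lspan_sub => _ [a [b [aS bA ->]]].
by apply: mem_mulo; [apply: sS|apply: sA].
Qed.

Lemma muloA S A B : mulo S (mulo A B) = mulo (mulo S A) B.
Proof.
apply: submod_ext => x; apply/idP/idP; move: x; apply: lspan_sub.
  move=> _ [a [_ [aS /mulo_sumP[s [sP ->]] ->]]].
  have [h hE] := linear_exists (op_linr a); rewrite -hE linear_sum /=.
  apply: rpred_seq => q /sP[q1 q2]; rewrite hE opA.
  by apply: mem_mulo => //; apply: mem_mulo.
move=> _ [_ [b [/mulo_sumP[s [sP ->]] bB ->]]].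
have [h hE] := linear_exists (op_linl b); rewrite -hE linear_sum /=.
apply: rpred_seq => q /sP[q1 q2]; rewrite hE -opA.
by apply: mem_mulo => //; apply: mem_mulo.
Qed.

(** Injectivity of $S \otimes T \to T$ for the product [op], stated on formal sums so that no tensor
    product has to be formed. *)
Definition is_free S :=
  forall s, (forall q, q \in s -> q.1 \in S) ->
    \sum_(q <- s) op q.1 q.2 = 0 -> tensor0 s.

Lemma free_sub S S' : {subset S <= S'} -> is_free S' -> is_free S.
Proof. by move=> sS S'f s sP; apply: S'f => q /sP /sS. Qed.

Lemma tensor0_op (h : {linear T -> T}) s :
  tensor0 s -> \sum_(q <- s) op q.1 (h q.2) = 0.
Proof.
apply: (tensor0_bilinearT (g := fun x y => op x (h y))) => [x|u].
  exact: op_linl.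
by move=> a x y; rewrite linearP; apply: op_linr.
Qed.

Lemma free_map F (h : {linear T -> T}) s : is_free F ->
  (forall q, q \in s -> q.1 \in F) -> \sum_(q <- s) op q.1 q.2 = 0 ->
  \sum_(q <- s) op q.1 (h q.2) = 0.
Proof. by move=> Ff sF s0; apply: tensor0_op; apply: Ff. Qed.

(** Subtract an expression of the same element with right factors in [A]: the difference is zero as
    a tensor, so both have the same contractions. *)
Lemma free_coef F A s : is_free F -> (forall q, q \in s -> q.1 \in F) ->
  \sum_(q <- s) op q.1 q.2 \in mulo F A ->
  forall f : {scalar T}, \sum_(q <- s) f q.1 *: q.2 \in A.
Proof.
move=> Ff sF /mulo_sumP[s' [s'P sE]] f.
have /(_ f) : tensor0 (s ++ [seq (- q.1, q.2) | q <- s']).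
  apply: Ff => [q|].
    rewrite mem_cat => /orP[/sF //|/mapP[q' /s'P[q'F _] ->]] /=.
    by rewrite -scaleN1r rpredZ.
  rewrite big_cat big_map /= sE -big_split big1 //= => q _.
  have [g gE] := linear_exists (op_linl q.2).
  by rewrite -!gE linearN addrN.
rewrite big_cat big_map /= => /eqP; rewrite addr_eq0 -sumrN => /eqP ->.
apply: rpred_seq => q /s'P[_ qA]; rewrite linearN scaleNr opprK.
exact: rpredZ.
Qed.

(** Converse of [free_coef]; together they test membership in a product by functionals. *)
Lemma coef_mulo F A s : (forall q, q \in s -> q.1 \in F) ->
  (forall f : {scalar T}, \sum_(q <- s) f q.1 *: q.2 \in A) ->
  \sum_(q <- s) op q.1 q.2 \in mulo F A.
Proof.
move=> sF sA; have [n [b [f [bF E]]]] := tensor_regroup sF.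
rewrite (E _ op) => [|t a u v _ _|//]; last exact: op_linl.
by apply: rpred_sum => i _; apply: mem_mulo.
Qed.

(** Membership in [mulo F A] is a condition on contractions, and two such conditions can be imposed
    on the same expression. *)
Lemma free_cap F A B x : is_free F -> x \in mulo F A -> x \in mulo F B ->
  x \in mulo F (cap2 A B).
Proof.
move=> Ff /mulo_sumP[s [sP ->]] xB.
have sF q : q \in s -> q.1 \in F by case/sP.
apply: coef_mulo => // f; rewrite mem_cap2 (free_coef _ _ xB) // andbT.
by apply: rpred_seq => q /sP[_ qA]; apply: rpredZ.
Qed.

(** An expression with left factors in [S] is kept, and its contractions are tested in the larger
    free space [F]. *)
Lemma free_restr F S A B x : is_free F -> {subset S <= F} ->
  x \in mulo S B -> x \in mulo F A -> x \in mulo S A.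
Proof.
move=> Ff SF /mulo_sumP[s [sP ->]] xA.
apply: coef_mulo => [q /sP[]//|f]; apply: free_coef xA _ => // q /sP[qS _].
exact: SF.
Qed.

Lemma mulo_expand S A s : (forall q, q \in s -> q.1 \in mulo S A) ->
  exists s3 : seq (T * T * T),
    (forall p, p \in s3 -> p.1.1 \in S /\ p.1.2 \in A) /\
    forall (Y : lmodType k) (g : T -> T -> Y), (forall t, linear (g^~ t)) ->
      \sum_(q <- s) g q.1 q.2 = \sum_(p <- s3) g (op p.1.1 p.1.2) p.2.
Proof.
elim: s => [|[x t] s IHs] sP; first by exists [::]; split=> // Y g _; rewrite !big_nil.
have [q qs|s3 [s3P s3E]] := IHs; first by apply: sP; rewrite inE qs orbT.
have /mulo_sumP[s' [s'P xE]] := sP _ (mem_head _ _).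
exists ([seq (q, t) | q <- s'] ++ s3); split=> [p|Y g gl].
  by rewrite mem_cat => /orP[/mapP[q /s'P h ->]|/s3P].
rewrite big_cons big_cat big_map /= s3E //; congr (_ + _).
rewrite [x]xE; have [h hE] := linear_exists (gl t); rewrite -hE linear_sum /=.
by apply: eq_bigr => q _; rewrite hE.
Qed.

(** Freeness of [S] is applied first, then that of [A]. A functional on products $ab$ does not
    split, so the factors $a$ are expanded in a finite family $b_i$; what remains are the
    functionals $x \mapsto f(b_i x)$. *)
Lemma free_mulo S A : is_free S -> is_free A -> is_free (mulo S A).
Proof.
move=> Sf Af s sP s0 f; have [s3 [s3P s3E]] := mulo_expand sP.
rewrite (s3E _ (fun x t => f x *: t)) => [|t a u v]; last first.
  by rewrite linearP scalerDl scalerA.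
have {s0} s0 : \sum_(p <- s3) op p.1.1 (op p.1.2 p.2) = 0.
  by rewrite -[RHS]s0 (s3E _ op op_linl); apply: eq_bigr => p _; rewrite opA.
have {s0} : tensor0 [seq (p.1.1, op p.1.2 p.2) | p <- s3].
  by apply: Sf => [_ /mapP[p /s3P[pS _] ->] //|]; rewrite big_map.
move=> s0; have [|n [b [g [bS bE]]]] := @dual_family _ _ S [seq p.1.1 | p <- s3].
  by move=> _ /mapP[p /s3P[pS _] ->].
have -> : \sum_(p <- s3) f (op p.1.1 p.1.2) *: p.2 =
    \sum_(p <- s3) \sum_(i < n) f (op (b i) p.1.2) *: (g i p.1.1 *: p.2).
  rewrite !big_seq; apply: eq_bigr => p ps.
  rewrite {1}[p.1.1]bE ?(map_f (fun p : T * T * T => p.1.1)) //.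
  have [h hE] := linear_exists (op_linl p.1.2).
  rewrite -hE !linear_sum scaler_suml; apply: eq_bigr => i _.
  by rewrite !linearZ /= hE scalerA mulrC.
rewrite exchange_big big1 //= => i _.
have [h hE] : {h : {scalar T} | forall x, h x = f (op (b i) x)}.
  by apply: scalar_exists => a x y; rewrite op_linr linearP.
have h0 : tensor0 [seq (p.1.2, g i p.1.1 *: p.2) | p <- s3].
  apply: Af => [_ /mapP[p /s3P[_ pA] ->] //|].
  rewrite -[RHS](s0 (g i)) !big_map; apply: eq_bigr => p _ /=.
  by have [r rE] := linear_exists (op_linr p.1.2); rewrite -!rE linearZ.
by rewrite -[RHS](h0 h) big_map; apply: eq_bigr => p _; rewrite hE.
Qed.

(** The sum of the [X N] is direct: a finitely supported family is encoded as a polynomial, and its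
    sum is the value at 1. *)
Definition indep (X : nat -> submodClosed T) :=
  forall p : {poly T}, (forall N, p`_N \in X N) -> p.[1] = 0 -> p = 0.

Lemma poly_at1 n (p : {poly T}) : (size p <= n)%N -> p.[1] = \sum_(i < n) p`_i.
Proof.
move=> sp; rewrite (horner_coef_wide _ sp).
by apply: eq_bigr => i _; rewrite expr1n mulr1.
Qed.

Lemma poly_fam_at1 n (F : nat -> T) : (\poly_(i < n) F i).[1] = \sum_(i < n) F i.
Proof.
by rewrite (poly_at1 (size_poly _ _)); apply: eq_bigr => i _; rewrite coef_poly ltn_ord.
Qed.

Lemma indep_mulo F X : is_free F -> indep X -> indep (fun N => mulo F (X N)).
Proof.
move=> Ff Xi p pX p1.
have [s sE] := choice (fun N => mulo_sumP (pX N)).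
pose n := size p; rewrite (poly_at1 (leqnn n)) in p1.
have t0 : tensor0 (flatten [seq s N | N <- iota 0 n]).
  apply: Ff => [q /flattenP[_ /mapP[N _ ->] qs]|].
    by case: (sE N) => /(_ _ qs)[].
  rewrite big_flatten big_map -[RHS]p1 -(big_mkord xpredT (fun i => p`_i)).
  by rewrite /index_iota subn0; apply: eq_bigr => N _; case: (sE N) => _ ->.
(* Contracting all left factors by [f] turns a relation among the products into one among the
   [X N]. *)
have sN0 N : (N < n)%N -> tensor0 (s N).
  move=> Nn f; pose pf : {poly T} := \poly_(N < n) \sum_(q <- s N) f q.1 *: q.2.
  have /(congr1 (fun p : {poly T} => p`_N)) : pf = 0.
    apply: Xi => [M|]; first rewrite coef_poly; last rewrite poly_fam_at1.
      case: ifP => _; last exact: rpred0.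
      by apply: rpred_seq => q qs; case: (sE M) => /(_ _ qs)[_ qX] _; apply: rpredZ.
    rewrite -[RHS](t0 f) big_flatten big_map /index_iota.
    by rewrite -(big_mkord xpredT (fun N => \sum_(q <- s N) f q.1 *: q.2)) /index_iota subn0.
  by rewrite coef_poly Nn coef0.
apply/polyP => N; rewrite coef0; have [nN|Nn] := leqP n N; first by rewrite nth_default.
case: (sE N) => _ ->.
exact: (tensor0_op idfun (sN0 _ Nn)).
Qed.

(** Induction on a bound for the lengths of the right factors. [D f] stands for the contraction of
    the last letter by [f] (of the first one for the opposite product). The last hypothesis is
    minimality: no nonzero element of [S] is a combination of elements of [S] with coefficients
    lacking a constant term. *)
Lemma free_criterion S (D : {scalar W} -> {linear T -> T}) :
  (forall r, op r 1 = r) ->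
  (forall f r t, D f (op r t) = op r (D f t) + taug t *: D f r) ->
  (forall f (n : nat) t, tlen n (D f t) = D f (tlen n.+1 t)) ->
  (forall u, taug u = 0 -> (forall f, D f u = 0) -> u = 0) ->
  (forall e s, e \in S -> (forall q, q \in s -> q.1 \in S /\ taug q.2 = 0) ->
     e = \sum_(q <- s) op q.1 q.2 -> e = 0) ->
  is_free S.
Proof.
move=> op1 Dmul Dlen Dsep Smin s sS s0.
have [n nP] : exists n, forall q, q \in s -> forall m, (n <= m)%N -> tlen m q.2 = 0.
  elim: s {sS s0} => [|q s [n nP]]; first by exists 0%N.
  have [m mP] := tlen_bound q.2; exists (maxn m n) => q'.
  rewrite inE => /predU1P[->|/nP h] i; rewrite geq_max => /andP[mi ni]; first exact: mP.
  exact: h.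
elim: n s sS s0 nP => [|n IHn] s sS s0 nP f.
  rewrite big_seq big1 // => q qs; rewrite (tlen_sum (nP _ qs)) big_ord0.
  exact: scaler0.
(* The constant terms of the right factors combine to an element of [S], which the relation also
   expresses with coefficients lacking a constant term; minimality makes it zero. *)
pose e := \sum_(q <- s) taug q.2 *: q.1.
have e0 : e = 0.
  apply: (Smin e [seq (q.1, (taug q.2)%:A - q.2) | q <- s]).
  - by apply: rpred_seq => q qs; apply/rpredZ/sS.
  - move=> _ /mapP[q qs ->] /=; split; first exact: sS.
    by rewrite linearB linearZ /= -tword_nil taug_word mulr1 subrr.
  rewrite big_map /= -[LHS]subr0 -[X in _ - X]s0 -sumrB; apply: eq_bigr => q _.
  have [h hE] := linear_exists (op_linr q.1).
  by rewrite -!hE linearB linearZ /= !hE op1.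
(* The constant term of $\sum f(s_i) t_i$ is $f(e) = 0$, and its contractions vanish by induction
   applied to the pairs $(s_i, D_g t_i)$. *)
apply: Dsep => [|g].
  transitivity (f e); last by rewrite e0 linear0.
  by rewrite /e !linear_sum; apply: eq_bigr => q _; rewrite !linearZ /= mulrC.
have h : tensor0 [seq (q.1, D g q.2) | q <- s].
  apply: IHn => [_ /mapP[q qs ->]||_ /mapP[q qs ->] m nm]; first exact: (sS _ qs).
    rewrite big_map /=.
    have : D g (\sum_(q <- s) op q.1 q.2) = 0 by rewrite s0 linear0.
    rewrite linear_sum (eq_bigr _ (fun q _ => Dmul g q.1 q.2)) big_split /=.
    have -> : \sum_(q <- s) taug q.2 *: D g q.1 = D g e.
      by rewrite linear_sum; apply: eq_bigr => q _; rewrite linearZ.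
    by rewrite e0 linear0 addr0.
  by rewrite Dlen nP // linear0.
by rewrite -[RHS](h f) linear_sum big_map; apply: eq_bigr => q _; rewrite linearZ.
Qed.

End Free.

(** * Products of subspaces of the tensor algebra *)

Section ProductSpaces.
Variables (k : fieldType) (V : lmodType k).
Local Notation T := (talg V).
Implicit Types (S A B F : submodClosed T) (X Y : nat -> submodClosed T).
Implicit Types (s : seq (T * T)).

Definition opp_mul (x y : T) : T := y * x.
Lemma opp_mulA : associative opp_mul.
Proof. by move=> x y z; rewrite /opp_mul mulrA. Qed.

Local Notation linl := (@mulr_linearl k V).
Local Notation linr := (@mulr_linearr k V).

Definition mul S A := mulo (@GRing.mul T) S A.
Local Infix "⊙" := mul (at level 40, left associativity).
(** [S (x) T -> T] and [T (x) S -> T] are injective. *)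
Definition rfree S := is_free (@GRing.mul T) S.
Definition lfree S := is_free opp_mul S.

Lemma mulo_opp S A : mulo opp_mul S A = A ⊙ S.
Proof.
by congr (lspan _); apply/funext => x; apply/propext; split=> -[a [b [? ? ->]]];
  exists b, a; split.
Qed.

Lemma mem_mul S A a b : a \in S -> b \in A -> a * b \in S ⊙ A.
Proof. exact: mem_mulo. Qed.

Lemma mul_sumP S A x : x \in S ⊙ A -> exists s,
  (forall q, q \in s -> q.1 \in S /\ q.2 \in A) /\ x = \sum_(q <- s) q.1 * q.2.
Proof. exact: mulo_sumP linl _ _ _. Qed.

Lemma mul_sub S A S' A' : {subset S <= S'} -> {subset A <= A'} ->
  {subset S ⊙ A <= S' ⊙ A'}.
Proof. exact: mulo_sub. Qed.

Lemma mul_subl S S' A : {subset S <= S'} -> {subset S ⊙ A <= S' ⊙ A}.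
Proof. by move=> h; apply: mul_sub. Qed.
Lemma mul_subr S A A' : {subset A <= A'} -> {subset S ⊙ A <= S ⊙ A'}.
Proof. by move=> h; apply: mul_sub. Qed.

Lemma mulSA S A B : S ⊙ (A ⊙ B) = S ⊙ A ⊙ B.
Proof. exact: (muloA linl linr (@mulrA T)). Qed.

Lemma rfree_mul S A : rfree S -> rfree A -> rfree (S ⊙ A).
Proof. exact: (free_mulo linl linr (@mulrA T)). Qed.
Lemma lfree_mul S A : lfree S -> lfree A -> lfree (S ⊙ A).
Proof.
by move=> Sf Af; rewrite -mulo_opp; apply: (free_mulo linr linl opp_mulA).
Qed.
Lemma rfree_sub S A : {subset S <= A} -> rfree A -> rfree S.
Proof. exact: free_sub. Qed.
Lemma lfree_sub S A : {subset S <= A} -> lfree A -> lfree S.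
Proof. exact: free_sub. Qed.

Lemma rfree_cap F A B x : rfree F -> x \in F ⊙ A -> x \in F ⊙ B ->
  x \in F ⊙ cap2 A B.
Proof. exact: (free_cap linl linr). Qed.
Lemma lfree_cap F A B x : lfree F -> x \in A ⊙ F -> x \in B ⊙ F ->
  x \in cap2 A B ⊙ F.
Proof. by rewrite -!mulo_opp; apply: (free_cap linr linl). Qed.

Lemma rfree_restr F S A B x : rfree F -> {subset S <= F} ->
  x \in S ⊙ B -> x \in F ⊙ A -> x \in S ⊙ A.
Proof. exact: (free_restr linl linr). Qed.
Lemma lfree_restr F S A B x : lfree F -> {subset S <= F} ->
  x \in B ⊙ S -> x \in A ⊙ F -> x \in A ⊙ S.
Proof. by rewrite -!mulo_opp; apply: (free_restr linr linl). Qed.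

Lemma rfree_coef F A s : rfree F -> (forall q, q \in s -> q.1 \in F) ->
  \sum_(q <- s) q.1 * q.2 \in F ⊙ A ->
  forall f : {scalar T}, \sum_(q <- s) f q.1 *: q.2 \in A.
Proof. exact: (free_coef linl). Qed.

Lemma coef_rmul F A s : (forall q, q \in s -> q.1 \in F) ->
  (forall f : {scalar T}, \sum_(q <- s) f q.1 *: q.2 \in A) ->
  \sum_(q <- s) q.1 * q.2 \in F ⊙ A.
Proof. exact: (coef_mulo linl linr). Qed.

Definition swap (q : T * T) := (q.2, q.1).

Lemma lfree_coef F A s : lfree F -> (forall q, q \in s -> q.2 \in F) ->
  \sum_(q <- s) q.1 * q.2 \in A ⊙ F ->
  forall f : {scalar T}, \sum_(q <- s) f q.2 *: q.1 \in A.
Proof.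
rewrite -mulo_opp => Ff sF sA f.
have := free_coef (op := opp_mul) linr (A := A) (s := map swap s) Ff.
move=> /(_ _ _ f); rewrite !big_map; apply=> //.
by move=> _ /mapP[q /sF qF ->].
Qed.

Lemma coef_lmul F A s : (forall q, q \in s -> q.2 \in F) ->
  (forall f : {scalar T}, \sum_(q <- s) f q.2 *: q.1 \in A) ->
  \sum_(q <- s) q.1 * q.2 \in A ⊙ F.
Proof.
rewrite -mulo_opp => sF sA.
have := coef_mulo (op := opp_mul) linr linl (F := F) (A := A) (s := map swap s).
rewrite big_map; apply=> [_ /mapP[q /sF qF ->] //|f]; rewrite big_map; exact: sA.
Qed.

(** Right factors in a left free space determine the tensor, so applying [h] to the left factors is
    well defined. Needed for the augmentation in [iota2]. *)
Lemma lfree_map F (h : {linear T -> T}) s : lfree F ->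
  (forall q, q \in s -> q.2 \in F) -> \sum_(q <- s) q.1 * q.2 = 0 ->
  \sum_(q <- s) h q.1 * q.2 = 0.
Proof.
move=> Ff sF s0; have := free_map (op := opp_mul) linr linl h (s := map swap s) Ff.
rewrite !big_map; apply=> // _ /mapP[q /sF qF ->] //.
Qed.

Lemma indep_mull F X : rfree F -> indep X -> indep (fun N => F ⊙ X N).
Proof. exact: (indep_mulo linl linr). Qed.
Lemma indep_mulr F X : lfree F -> indep X -> indep (fun N => X N ⊙ F).
Proof.
move=> Ff Xi; have -> : (fun N => X N ⊙ F) = (fun N => mulo opp_mul F (X N)).
  by apply/funext => N; rewrite mulo_opp.
exact: (indep_mulo linr linl).
Qed.

Definition oneS : submodClosed T := prodsp [::].
Lemma oneSP x : x \in oneS <-> exists c : k, x = c%:A.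
Proof.
split=> [|[c ->]]; last first.
  by apply/rpredZ/mem_lspan; exists [::] => //; rewrite big_nil.
move: x; apply: lspan_ind => [|a ? y [[|//] _ ->] [c ->]].
  by exists 0; rewrite scale0r.
by exists (a + c); rewrite big_nil scalerDl.
Qed.
Lemma mem1 : 1 \in oneS. Proof. by apply/oneSP; exists 1; rewrite scale1r. Qed.

Lemma mul1S S : oneS ⊙ S = S.
Proof.
apply: submod_ext => x; apply/idP/idP => [|xS]; last first.
  by rewrite -[x]mul1r mem_mul ?mem1.
move: x; apply: lspan_sub => _ [a [b [/oneSP[c ->] bS ->]]].
by rewrite -scalerAl mul1r rpredZ.
Qed.
Lemma mulS1 S : S ⊙ oneS = S.
Proof.
apply: submod_ext => x; apply/idP/idP => [|xS]; last first.
  by rewrite -[x]mulr1 mem_mul ?mem1.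
move: x; apply: lspan_sub => _ [a [b [bS /oneSP[c ->] ->]]].
by rewrite -scalerAr mulr1 rpredZ.
Qed.

Lemma prodsp_cons S Ws : prodsp (S :: Ws) = S ⊙ prodsp Ws.
Proof.
apply: submod_ext => x; apply/idP/idP; move: x.
  apply: lspan_sub => _ [[|w ws] //= /andP[wS wsW] ->].
  by rewrite big_cons mem_mul //; apply: mem_lspan; exists ws.
apply: lspan_sub => _ [a [b [aS bW ->]]].
move: b bW; apply: lspan_ind => [|c ? y [ws wsW ->] yS]; first by rewrite mulr0 rpred0.
rewrite mulrDr -scalerAr rpredL //; apply: mem_lspan.
by exists (a :: ws); [rewrite /= aS|rewrite big_cons].
Qed.
Lemma prodsp1 S : prodsp [:: S] = S. Proof. by rewrite prodsp_cons mulS1. Qed.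
Lemma tpow0 : tpow V 0 = oneS.
Proof.
apply: submod_ext => x; apply/idP/idP; move: x; apply: lspan_sub.
  by move=> _ [[|//] _ ->]; rewrite big_nil mem1.
by move=> _ [[|//] _ ->]; rewrite big_nil -[1](@tword_nil k V); apply: tpow_word.
Qed.
Lemma tpowD m n : tpow V (m + n) = tpow V m ⊙ tpow V n.
Proof.
apply: submod_ext => x; apply/idP/idP; move: x.
  apply: lspan_sub => _ [ws sz ->]; rewrite -(cat_take_drop m ws) big_cat.
  apply: mem_mul; apply: mem_lspan; eexists; try reflexivity.
    by rewrite size_take sz; case: ltnP => //; lia.
  by rewrite size_drop sz addKn.
apply: lspan_sub => _ [a [b [am bn ->]]]; move: a am; apply: tpow_ind => [|c ws y sz yS].
  by rewrite mul0r rpred0.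
rewrite mulrDl -scalerAl rpredL //; move: b bn {y yS}.
apply: tpow_ind => [|c' ws' y sz' yS]; first by rewrite mulr0 rpred0.
by rewrite mulrDr -scalerAr rpredL // -tword_cat -sz -sz' -size_cat tpow_word.
Qed.

Lemma tpow1P x : x \in tpow V 1 -> exists v, x = tvec v.
Proof.
move: x; apply: tpow_ind => [|a [|v [|//]] y // _ [w ->]].
  by exists 0; rewrite linear0.
by exists (a *: v + w); rewrite linearP tword1.
Qed.
Lemma tvec_mem (v : V) : tvec v \in tpow V 1.
Proof. by rewrite -tword1; apply: tpow_word. Qed.

Lemma rfree_one : rfree oneS.
Proof.
move=> s s1 s0 f; have /= := congr1 (fun x => f 1 *: x) s0; rewrite scaler0 => h; rewrite -[RHS]h.
rewrite scaler_sumr !big_seq.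
by apply: eq_bigr => q /s1/oneSP[c ->]; rewrite linearZ /= -scalerAl mul1r scalerA mulrC.
Qed.
Lemma lfree_one : lfree oneS.
Proof.
move=> s s1 s0 f; have /= := congr1 (fun x => f 1 *: x) s0; rewrite scaler0 => h; rewrite -[RHS]h.
rewrite scaler_sumr !big_seq.
apply: eq_bigr => q /s1/oneSP[c ->].
by rewrite linearZ /opp_mul /= -scalerAr mulr1 scalerA mulrC.
Qed.

(** For one letter, a functional on $T(V)$ restricts to $V$, and contracting the first letter by
    this restriction gives the contraction of the tensor. *)
Lemma rfree_tpow n : rfree (tpow V n).
Proof.
elim: n => [|n IHn]; first by rewrite tpow0; apply: rfree_one.
rewrite -addn1 tpowD; apply: rfree_mul => // s s1 s0 f.
have [g gE] : {g : {scalar V} | forall v, g v = f (tvec v)}.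
  by apply: scalar_exists => a u v; rewrite !linearP.
have := congr1 (contr g) s0; rewrite linear0 => h; rewrite -[RHS]h.
rewrite linear_sum !big_seq.
by apply: eq_bigr => q /s1/tpow1P[v ->]; rewrite contr_vec gE.
Qed.
Lemma lfree_tpow n : lfree (tpow V n).
Proof.
elim: n => [|n IHn]; first by rewrite tpow0; apply: lfree_one.
rewrite -addn1 tpowD; apply: lfree_mul => // s s1 s0 f.
have [g gE] : {g : {scalar V} | forall v, g v = f (tvec v)}.
  by apply: scalar_exists => a u v; rewrite !linearP.
have := congr1 (contrr g) s0; rewrite linear0 => h; rewrite -[RHS]h.
rewrite linear_sum !big_seq.
by apply: eq_bigr => q /s1/tpow1P[v ->]; rewrite contrr_vec gE.
Qed.

Lemma indep_tpow : indep (tpow V).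
Proof.
move=> p pV p0; apply/polyP => N; rewrite coef0.
have [sN|Ns] := leqP (size p) N; first by rewrite nth_default.
have := congr1 (tlen N) p0; rewrite linear0 => h; rewrite -[RHS]h (poly_at1 (leqnn _)) linear_sum.
rewrite (bigD1 (Ordinal Ns)) //= (tlen_tpow _ (pV N)) eqxx big1 ?addr0 // => i.
by rewrite (tlen_tpow _ (pV i)) -val_eqE /= => /negbTE->.
Qed.

Lemma tlen0 (x : T) : tlen 0 x = (taug x)%:A.
Proof.
have [h hE] : {h : {linear T -> T} | forall x, h x = (taug x)%:A}.
  by apply: linear_exists => a u v; rewrite linearP scalerDl scalerA.
rewrite -hE; move: x; apply: talg_linear_ext => ws.
rewrite tlen_word hE taug_word size_eq0; case: eqP => [->|_].
  by rewrite tword_nil scale1r.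
by rewrite scale0r.
Qed.

Lemma taug0_ge1 (x : T) : taug x = 0 -> x \in T_ge V 1.
Proof.
move=> x0; have [n nP] := tlen_bound x; rewrite (tlen_sum nP); apply: rpred_sum => i _.
have [->|i0] := posnP i; first by rewrite tlen0 x0 scale0r rpred0.
by apply: (mem_sumsp (i := i : nat)) => //; apply: tlen_mem.
Qed.

Lemma mem_T_all (x : T) : x \in T_all V. Proof. exact: mem_lspan. Qed.

End ProductSpaces.
Infix "⊙" := mul (at level 40, left associativity).
Arguments mul : simpl never.
Arguments lspan : simpl never.
Arguments cap : simpl never.
Arguments cap2 : simpl never.
Arguments sumsp : simpl never.
Arguments prodsp : simpl never.
Arguments tensp : simpl never.
Arguments tpow : simpl never.

(** * The spaces [J_i] *)

Section JSpaces.
Variables (k : fieldType) (V : lmodType k) (Vg : nat -> submodClosed V).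
Local Notation T := (talg V).
Variable R : submodClosed T.
Hypothesis Rrel : relation_space Vg R.
Implicit Types (S A B F : submodClosed T).

Local Notation Je := (J_even R).
Local Notation Vn := (tpow V).

(** Contraction of the last letter satisfies the criterion; its minimality hypothesis comes from $R
    \cap T(V) R T(V)_{>0} = 0$. *)
Lemma rfree_R : rfree R.
Proof.
apply: (@free_criterion _ _ *%R (@mulr_linearr k V) _ (@contrr k V)).
- exact: mulr1.
- by move=> f r t; rewrite contrr_mul.
- by move=> f n t; rewrite contrr_len.
- exact: contrr_separation.
move=> e s eR sP eE; apply: (rel_minimal Rrel eR); rewrite eE.
apply: (mem_sumsp (i := false)) => //.
rewrite !prodsp_cons mulS1.
apply: rpred_seq => q /sP[qR q0].
by rewrite -[q.1]mul1r -mulrA !mem_mul ?mem_T_all ?taug0_ge1.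
Qed.

Lemma lfree_R : lfree R.
Proof.
apply: (@free_criterion _ _ (@opp_mul k V) (@mulr_linearl k V) _ (@contr k V)).
- exact: mul1r.
- by move=> f r t; rewrite /opp_mul contr_mul.
- by move=> f n t; rewrite contr_len.
- exact: contr_separation.
move=> e s eR sP eE; apply: (rel_minimal Rrel eR); rewrite eE.
apply: (mem_sumsp (i := true)) => //.
rewrite !prodsp_cons mulS1.
apply: rpred_seq => q /sP[qR q0].
by rewrite /opp_mul -[q.1]mulr1 !mem_mul ?mem_T_all ?taug0_ge1.
Qed.

Definition Rpow n := prodsp (nseq n R).
Arguments Rpow : simpl never.
Lemma RpowS n : Rpow n.+1 = R ⊙ Rpow n. Proof. exact: prodsp_cons. Qed.
Lemma RpowD m n : Rpow (m + n) = Rpow m ⊙ Rpow n.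
Proof. by elim: m => [|m IHm]; rewrite ?mul1S // addSn !RpowS IHm mulSA. Qed.
Lemma rfree_Rpow n : rfree (Rpow n).
Proof.
elim: n => [|n IHn]; first exact: rfree_one.
by rewrite RpowS; apply: rfree_mul => //; apply: rfree_R.
Qed.
Lemma lfree_Rpow n : lfree (Rpow n).
Proof.
elim: n => [|n IHn]; first exact: lfree_one.
by rewrite RpowS; apply: lfree_mul => //; apply: lfree_R.
Qed.

Lemma Je0 : Je 0 = oneS V. Proof. by []. Qed.
Lemma Je1 : Je 1 = R. Proof. by []. Qed.

Lemma Je_sub n : {subset Je n <= Rpow n}.
Proof.
case: n => [|[|n]] x //; first by rewrite Je1 RpowS mulS1.
by rewrite J_even_rec // mem_cap2 => /andP[].
Qed.

Lemma rfree_Je n : rfree (Je n).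
Proof. by apply: rfree_sub (@rfree_Rpow n) => x; apply: Je_sub. Qed.
Lemma lfree_Je n : lfree (Je n).
Proof. by apply: lfree_sub (@lfree_Rpow n) => x; apply: Je_sub. Qed.

Definition br ms ns := prodsp (braid Je ms ns).
Arguments br : simpl never.
Lemma br_cons m ms n ns : br (m :: ms) (n :: ns) = Vn m ⊙ (Je n ⊙ br ms ns).
Proof.
transitivity (prodsp [:: Vn m, Je n & braid Je ms ns]) => //.
by rewrite !prodsp_cons.
Qed.
Lemma br1 m : br [:: m] [::] = Vn m. Proof. exact: prodsp1. Qed.

(** Here the number of factors $J$ is arbitrary, whereas [J_even_step] fixes it to be the sum of
    their indices; the splitting arguments read off lists with one or two factors. *)
Definition Dsp (s N : nat) : submodClosed T :=
  cap (fun mn : seq nat * seq nat =>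
         [/\ size mn.1 = (size mn.2).+1, sumn mn.1 = N & sumn mn.2 = s])
    (fun mn => br mn.1 mn.2).

Lemma DspP s N x : x \in Dsp s N <-> forall ms ns, size ms = (size ns).+1 ->
  sumn ms = N -> sumn ns = s -> x \in br ms ns.
Proof.
split=> [/asboolP h ms ns *|h]; first exact: (h (ms, ns)).
by apply/asboolP => -[ms ns] [/= *]; apply: h.
Qed.

Lemma Dsp_br s N ms ns : size ms = (size ns).+1 -> sumn ms = N -> sumn ns = s ->
  {subset Dsp s N <= br ms ns}.
Proof. by move=> *; move=> x /DspP; apply. Qed.

Lemma Dsp1 s N a b : (a + b = N)%N -> {subset Dsp s N <= Vn a ⊙ Je s ⊙ Vn b}.
Proof.
move=> abN x xD; rewrite -mulSA -[Vn b]br1 -br_cons.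
by apply: Dsp_br xD => //=; lia.
Qed.

Lemma Dsp2 s N a b c i j : (a + b + c = N)%N -> (i + j = s)%N ->
  {subset Dsp s N <= Vn a ⊙ Je i ⊙ Vn b ⊙ Je j ⊙ Vn c}.
Proof.
move=> abN ij x xD; rewrite -!mulSA -[Vn c]br1 -!br_cons.
by apply: Dsp_br xD => //=; lia.
Qed.

(** A factor $J_0 = k$ can be deleted, merging the powers of $V$ around it, or inserted next to
    $V^{(0)}$. Deleting all of them leaves at most [sumn ns] factors, and the list is then filled up
    to length [L]. *)
Lemma br_pad ms ns L : size ms = (size ns).+1 -> (sumn ns <= L)%N ->
  exists ms' ns', [/\ size ns' = L, size ms' = L.+1, sumn ms' = sumn ms,
    sumn ns' = sumn ns & br ms' ns' = br ms ns].
Proof.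
elim: ns ms L => [|n ns IH] [|m ms] L //= [szE].
  case: ms szE => //= _ _; exists (m :: nseq L 0%N), (nseq L 0%N).
  rewrite /= !size_nseq !sumn_nseq mul0n; split=> //; rewrite br1.
  elim: L m => [|L IHL] m; first by rewrite br1.
  by rewrite /= br_cons IHL Je0 mul1S tpow0 mulS1.
case: n => [|n].
  rewrite add0n => sL; case: ms szE => // m' ms [szE].
  have [||ms' [ns' [h1 h2 h3 h4 brE]]] := IH ((m + m')%N :: ms) L => //.
    by rewrite /= szE.
  exists ms', ns'; split=> //; first by rewrite h3 /= addnA.
  rewrite brE br_cons Je0 mul1S.
  by case: ns ms szE {IH sL h1 h2 h3 h4 brE} => [|n ns] [|m'' ms] //= _;
    rewrite ?br1 ?br_cons ?tpowD ?mulSA.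
case: L => // L sL; have [||ms' [ns' [s1 s2 s3 s4 brE]]] := IH ms L => //; first by lia.
exists (m :: ms'), (n.+1 :: ns').
by rewrite /= s1 s2 s3 s4; split=> //; rewrite !br_cons brE.
Qed.

Lemma Dsp_step s N x : (0 < s)%N ->
  x \in cap (fun nm : seq nat * seq nat =>
              [/\ size nm.1 = s, sumn nm.1 = s, size nm.2 = s.+1 & sumn nm.2 = N])
           (fun nm => prodsp (braid Je nm.2 nm.1)) -> x \in Dsp s N.
Proof.
move=> s0 /asboolP h; apply/DspP => ms ns szE msN nss.
have [|ms' [ns' [h1 h2 h3 h4 brE]]] := br_pad szE (L := s); first by rewrite nss.
rewrite -brE; apply: (h (ns', ms')).
by split=> //=; rewrite ?h3 ?h4.
Qed.

(** A decomposition [x = \sum_N x_N] with [x_N] in [D s N] is encoded by the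
    polynomial with coefficients [x_N]. *)
Definition is_dec s x (p : {poly T}) := p.[1] = x /\ forall N, p`_N \in Dsp s N.

(** Makes the decomposition of an element of $J_2 = R$ by word length an instance of the general
    pattern, with $s = 0$. *)
Lemma Dsp00 N : Dsp 0 N = Vn N.
Proof.
apply: submod_ext => x; apply/idP/idP => [/(Dsp1 (a := 0) (b := N))|xN].
  by rewrite Je0 mulS1 tpow0 mul1S; apply.
apply/DspP => ms ns szE msN ns0.
have [|ms' [ns' [h1 h2 h3 h4 <-]]] := br_pad szE (L := 0); first by rewrite ns0.
case: ns' h1 h4 => // _ _; case: ms' h2 h3 => [|m [|//]] // _ mE.
by rewrite br1; move: mE; rewrite /= addn0 msN => ->.
Qed.

Lemma dec_exists s x : x \in Je s.+1 -> exists p, is_dec s x p.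
Proof.
case: s => [|s].
  rewrite Je1 => xR; have [n nP] := tlen_bound x.
  exists (\poly_(N < n) tlen N x); split; first by rewrite poly_fam_at1 -tlen_sum.
  by move=> N; rewrite coef_poly Dsp00; case: ifP => _; rewrite ?rpred0 ?tlen_mem.
rewrite J_even_rec // mem_cap2 => /andP[xJ _].
move: x xJ; apply: lspan_ind => [|a x y [N _ xN] [p [p1 pD]]].
  by exists 0; split=> [|N]; rewrite ?horner0 ?coef0 ?rpred0.
exists ((a *: x)%:P * 'X^N + p); split.
  by rewrite hornerD hornerCM hornerXn expr1n mulr1 p1.
move=> M; rewrite coefD coefCM coefXn rpredD //.
case: eqP => [->|_]; rewrite ?mulr0 ?rpred0 // mulr1 rpredZ //.
exact: Dsp_step.
Qed.

(** The powers $V^{(N)}$ are independent, and multiplication by free spaces on either side preserves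
    independence. *)
Lemma dec_uniq (p q : {poly T}) F A : p.[1] = q.[1] -> rfree F -> lfree A ->
  (forall N, p`_N \in F ⊙ Vn N ⊙ A) -> (forall N, q`_N \in F ⊙ Vn N ⊙ A) ->
  p = q.
Proof.
move=> pq Ff Af pD qD; apply/eqP; rewrite -subr_eq0; apply/eqP.
have := indep_mulr Af (indep_mull Ff (@indep_tpow k V)); apply.
  by move=> N; rewrite coefB rpredBm.
by rewrite hornerD hornerN pq subrr.
Qed.

(** The polynomial encoding the decomposition of [x] in [J_(2(s+1))]. *)
Definition cmp s x : {poly T} := xget 0 (is_dec s x).

Lemma cmpP s x : x \in Je s.+1 -> is_dec s x (cmp s x).
Proof. by move=> /dec_exists; apply: xgetPex. Qed.

(** Membership of the coefficients of [p] in [Dsp s N] is not assumed: a common ambient space $F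
    V^{(N)} A$ forces equality. Compatibility with products is proved in this way. *)
Lemma cmp_uniq s x p F A : x \in Je s.+1 -> p.[1] = x -> rfree F -> lfree A ->
  (forall N, p`_N \in F ⊙ Vn N ⊙ A) ->
  (forall N, {subset Dsp s N <= F ⊙ Vn N ⊙ A}) -> p = cmp s x.
Proof.
move=> xJ p1 Ff Af pD sD; have [c1 cD] := cmpP xJ.
by apply: (dec_uniq (F := F) (A := A)) => // [|N]; [rewrite c1|apply/sD/cD].
Qed.

Lemma Dsp_subV s N : {subset Dsp s N <= oneS V ⊙ Vn N ⊙ Je s}.
Proof.
by move=> x xD; rewrite mul1S -[_ ⊙ Je s]mulS1 -tpow0; apply: (Dsp1 _ xD); rewrite addn0.
Qed.
Lemma Dsp_subV' s N : {subset Dsp s N <= Je s ⊙ Vn N ⊙ oneS V}.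
Proof. by move=> x xD; rewrite mulS1 -[Je s]mul1S -tpow0; apply: (Dsp1 _ xD). Qed.

Lemma cmp_dec s x p : x \in Je s.+1 -> is_dec s x p -> p = cmp s x.
Proof.
move=> xJ [p1 pD]; have sV := @Dsp_subV s.
by apply: (cmp_uniq xJ p1 (@rfree_one k V) (@lfree_Je s)) => // N; apply/sV/pD.
Qed.

(** Relations have length at least 2. Decomposing by length the first factor of $x \in R \cdot
    R^{(s)}$ also gives coefficients in $V^{(N)} R^{(s)}$, so it must agree with [cmp s x]. *)
Lemma cmp_small s x N : x \in Je s.+1 -> (N < 2)%N -> (cmp s x)`_N = 0.
Proof.
move=> xJ N2.
have /mul_sumP[t [tP xE]] : x \in R ⊙ Rpow s by rewrite -RpowS Je_sub.
have [n nP] : exists n, forall q, q \in t -> forall m, (n <= m)%N -> tlen m q.1 = 0.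
  elim: t {tP xE} => [|q t [n nP]]; first by exists 0%N.
  have [m mP] := tlen_bound q.1; exists (maxn m n) => q'.
  rewrite inE => /predU1P[->|/nP h] i; rewrite geq_max => /andP[mi ni]; first exact: mP.
  exact: h.
pose p := \poly_(M < n) \sum_(q <- t) tlen M q.1 * q.2.
have -> : cmp s x = p.
  have [c1 cD] := cmpP xJ; apply: (dec_uniq (F := oneS V) (A := Rpow s)).
  - rewrite c1 poly_fam_at1 exchange_big xE !big_seq; apply: eq_bigr => q qt /=.
    by rewrite -mulr_suml -tlen_sum //; apply: nP.
  - exact: rfree_one.
  - exact: lfree_Rpow.
  - by move=> M; have /Dsp_subV := cD M; apply: mul_subr; apply: Je_sub.
  - move=> M; rewrite coef_poly mul1S; case: ifP => _; last exact: rpred0.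
    by apply: rpred_seq => q /tP[_ q2]; rewrite mem_mul ?tlen_mem.
rewrite coef_poly; case: ifP => // _; rewrite big_seq big1 // => q /tP[qR _].
have -> : tlen N q.1 = 0; last exact: mul0r.
have := rel_ge2 Rrel qR; move: q.1.
apply: (lspan_linear (f := tlen N) (g := \0)) => r [n' n2 rn].
rewrite (tlen_tpow _ rn); case: eqP n2 => // ->; lia.
Qed.

Lemma cmp_sum s x : x \in Je s.+1 -> exists n, forall m, (n <= m)%N ->
  x = \sum_(N < m) (cmp s x)`_N.
Proof.
move=> xJ; have [c1 _] := cmpP xJ; exists (size (cmp s x)) => m sm.
by rewrite -{1}c1; apply: poly_at1.
Qed.

Lemma cmp_in s x S : x \in Je s.+1 ->
  (forall N, {subset Dsp s N <= S}) -> x \in S.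
Proof.
move=> xJ sD; have [c1 cD] := cmpP xJ; rewrite -c1 (poly_at1 (leqnn _)).
by apply: rpred_sum => N _; apply/sD/cD.
Qed.

(** The coefficients of the decomposition lie in $J_{2a} T(V)$ and in $T(V) J_{2b}$. Inside $R^{(a)}
    R^{(b)}$, freeness combines the two one-sided memberships. *)
Lemma Je_split a b : {subset Je (a + b) <= Je a ⊙ Je b}.
Proof.
case: a => [|a] x; first by rewrite mul1S.
case: b => [|b]; first by rewrite addn0 mulS1.
rewrite addSn => xJ.
have x1 : x \in Je a.+1 ⊙ T_all V.
  apply: (cmp_in xJ) => N y; rewrite addnS -addSn.
  move/(Dsp2 (a := 0) (b := N) (c := 0)) => /(_ _ _ (addn0 _) erefl).
  by rewrite tpow0 mul1S mulS1 -mulSA; apply: mul_subr => z _; apply: mem_T_all.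
have x2 : x \in T_all V ⊙ Je b.+1.
  apply: (cmp_in xJ) => N y.
  move/(Dsp2 (a := 0) (b := N) (c := 0)) => /(_ _ _ (addn0 _) erefl).
  by rewrite tpow0 mul1S mulS1; apply: mul_subl => z _; apply: mem_T_all.
have x3 : x \in Rpow a.+1 ⊙ Rpow b.+1 by rewrite -RpowD addSn Je_sub.
have x4 : x \in Je a.+1 ⊙ Rpow b.+1.
  by apply: rfree_restr x1 x3; [apply: rfree_Rpow|apply: Je_sub].
by apply: lfree_restr x2 x4; [apply: lfree_Rpow|apply: Je_sub].
Qed.

Lemma horner_lmul (I : Type) (s : seq I) (f : I -> T) (p : I -> {poly T}) :
  (\sum_(i <- s) (f i)%:P * p i).[1] = \sum_(i <- s) f i * (p i).[1].
Proof. by rewrite horner_sum; apply: eq_bigr => i _; rewrite hornerCM. Qed.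
Lemma horner_rmul (I : Type) (s : seq I) (f : I -> T) (p : I -> {poly T}) :
  (\sum_(i <- s) p i * (f i)%:P).[1] = \sum_(i <- s) (p i).[1] * f i.
Proof.
rewrite horner_sum; apply: eq_bigr => i _.
set q := _ * _; rewrite (poly_at1 (leq_maxl (size q) (size (p i)))).
rewrite (poly_at1 (leq_maxr (size q) (size (p i)))) mulr_suml.
by apply: eq_bigr => j _; rewrite coefMC.
Qed.

Lemma coef_lmulp (s : seq (T * T)) (p : T -> {poly T}) N :
  (\sum_(q <- s) q.1%:P * p q.2)`_N = \sum_(q <- s) q.1 * (p q.2)`_N.
Proof. by rewrite coef_sum; apply: eq_bigr => q _; rewrite coefCM. Qed.
Lemma coef_rmulp (s : seq (T * T)) (p : T -> {poly T}) N :
  (\sum_(q <- s) p q.1 * q.2%:P)`_N = \sum_(q <- s) (p q.1)`_N * q.2.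
Proof. by rewrite coef_sum; apply: eq_bigr => q _; rewrite coefMC. Qed.

Lemma lmulp_at1 b (s : seq (T * T)) : (forall q, q \in s -> q.2 \in Je b.+1) ->
  (\sum_(q <- s) q.1%:P * cmp b q.2).[1] = \sum_(q <- s) q.1 * q.2.
Proof.
move=> sJ; rewrite (horner_lmul s fst (fun q => cmp b q.2)) !big_seq.
by apply: eq_bigr => q /sJ/cmpP[->].
Qed.
Lemma rmulp_at1 b (s : seq (T * T)) : (forall q, q \in s -> q.1 \in Je b.+1) ->
  (\sum_(q <- s) cmp b q.1 * q.2%:P).[1] = \sum_(q <- s) q.1 * q.2.
Proof.
move=> sJ; rewrite (horner_rmul s snd (fun q => cmp b q.1)) !big_seq.
by apply: eq_bigr => q /sJ/cmpP[->].
Qed.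

Lemma lmulp_coef S b (s : seq (T * T)) N :
  (forall q, q \in s -> q.1 \in S /\ q.2 \in Je b.+1) ->
  (\sum_(q <- s) q.1%:P * cmp b q.2)`_N \in S ⊙ Dsp b N.
Proof.
move=> sP; rewrite coef_lmulp; apply: rpred_seq => q /sP[q1 /cmpP[_ qD]].
by rewrite mem_mul.
Qed.
Lemma rmulp_coef S b (s : seq (T * T)) N :
  (forall q, q \in s -> q.1 \in Je b.+1 /\ q.2 \in S) ->
  (\sum_(q <- s) cmp b q.1 * q.2%:P)`_N \in Dsp b N ⊙ S.
Proof.
move=> sP; rewrite coef_rmulp; apply: rpred_seq => q /sP[/cmpP[_ qD] q2].
by rewrite mem_mul.
Qed.

(** Both sides decompose the same element with coefficients in $J_{2a} V^{(N)} J_{2b}$. *)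
Lemma cmp_lmul a b (s : seq (T * T)) :
  (forall q, q \in s -> q.1 \in Je a /\ q.2 \in Je b.+1) ->
  \sum_(q <- s) q.1 * q.2 \in Je (a + b).+1 ->
  \sum_(q <- s) q.1%:P * cmp b q.2 = cmp (a + b) (\sum_(q <- s) q.1 * q.2).
Proof.
move=> sP xJ; apply: (cmp_uniq xJ _ (@rfree_Je a) (@lfree_Je b)) => [|N|N x].
- by apply: lmulp_at1 => q /sP[].
- have := lmulp_coef N sP; rewrite -mulSA; apply: mul_subr => x /Dsp_subV.
  by rewrite mul1S.
- move/(Dsp2 (a := 0) (b := N) (c := 0)) => /(_ _ _ (addn0 _) erefl).
  by rewrite tpow0 mul1S mulS1.
Qed.

Lemma cmp_rmul a b (s : seq (T * T)) :
  (forall q, q \in s -> q.1 \in Je b.+1 /\ q.2 \in Je a) ->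
  \sum_(q <- s) q.1 * q.2 \in Je (b + a).+1 ->
  \sum_(q <- s) cmp b q.1 * q.2%:P = cmp (b + a) (\sum_(q <- s) q.1 * q.2).
Proof.
move=> sP xJ; apply: (cmp_uniq xJ _ (@rfree_Je b) (@lfree_Je a)) => [|N|N x].
- by apply: rmulp_at1 => q /sP[].
- have := rmulp_coef N sP; apply: mul_subl => x /Dsp_subV'.
  by rewrite mulS1.
- move/(Dsp2 (a := 0) (b := N) (c := 0)) => /(_ _ _ (addn0 _) erefl).
  by rewrite tpow0 mul1S mulS1.
Qed.

Definition Jo p := cap2 (Vn 1 ⊙ Je p) (Je p ⊙ Vn 1).
Arguments Jo : simpl never.

Lemma Jo_subl p : {subset Jo p <= Vn 1 ⊙ Je p}.
Proof. by move=> x; rewrite mem_cap2 => /andP[]. Qed.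
Lemma Jo_subr p : {subset Jo p <= Je p ⊙ Vn 1}.
Proof. by move=> x; rewrite mem_cap2 => /andP[]. Qed.
Lemma lfree_Jo p : lfree (Jo p).
Proof.
apply: (lfree_sub (@Jo_subl p)).
by apply: lfree_mul; [apply: lfree_tpow|apply: lfree_Je].
Qed.
Lemma rfree_Jo p : rfree (Jo p).
Proof.
apply: (rfree_sub (@Jo_subr p)).
by apply: rfree_mul; [apply: rfree_Je|apply: rfree_tpow].
Qed.

Definition is_odec p x (q : {poly T}) := q.[1] = x /\
  forall N, q`_N \in Vn 1 ⊙ Dsp p N /\ q`_N \in Dsp p N ⊙ Vn 1.

(** The decompositions induced by [J_(2p+3) <= V J_(2p+2)] and by
    [J_(2p+3) <= J_(2p+2) V] coincide: compare them in [V J_(2p) T(V)]. *)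
Lemma odec_exists p x : x \in Jo p.+1 -> exists q, is_odec p x q.
Proof.
move=> xJ; have /mul_sumP[s [sP xE]] := Jo_subl xJ.
have /mul_sumP[t [tP xE']] := Jo_subr xJ.
exists (\sum_(q <- s) q.1%:P * cmp p q.2).
suff E : \sum_(q <- s) q.1%:P * cmp p q.2 = \sum_(q <- t) cmp p q.1 * q.2%:P.
  split=> [|N]; first by rewrite lmulp_at1 // => q /sP[].
  by split; [apply: lmulp_coef|rewrite E; apply: rmulp_coef].
apply: (@dec_uniq _ _ (Vn 1 ⊙ Je p) (oneS V)).
- by rewrite lmulp_at1 ?rmulp_at1 -?xE // => q; [case/tP|case/sP].
- by apply: rfree_mul; [apply: rfree_tpow|apply: rfree_Je].
- exact: lfree_one.
- move=> N; have := lmulp_coef N sP; rewrite -!mulSA; apply: mul_subr => y /Dsp_subV'.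
  by rewrite -mulSA.
(* A letter is taken off $V^{(N)}$ to serve as the leading factor $V$, so the coefficient of index 0
   is treated apart; it vanishes. *)
case=> [|N]; rewrite mulS1.
  rewrite coef_rmulp big_seq big1 ?rpred0 // => q /tP[q1 _].
  by rewrite cmp_small ?mul0r.
have := rmulp_coef N.+1 tP; have -> : Vn N.+1 = Vn N ⊙ Vn 1 by rewrite -tpowD addn1.
by rewrite mulSA; apply: mul_subl; apply: Dsp1; rewrite add1n.
Qed.

Definition cmpo p x : {poly T} := xget 0 (is_odec p x).
Lemma cmpoP p x : x \in Jo p.+1 -> is_odec p x (cmpo p x).
Proof. by move=> /odec_exists; apply: xgetPex. Qed.

(** The comparison takes place in $V J_{2a} J_{2b} V^{(N)}$, where the power of $V$ comes last. *)
Lemma cmpo_lmul a b (s : seq (T * T)) :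
  (forall q, q \in s -> q.1 \in Vn 1 ⊙ Je a /\ q.2 \in Je b.+1) ->
  \sum_(q <- s) q.1 * q.2 \in Jo (a + b).+1 ->
  \sum_(q <- s) q.1%:P * cmp b q.2 = cmpo (a + b) (\sum_(q <- s) q.1 * q.2).
Proof.
move=> sP xJ; have [c1 cD] := cmpoP xJ.
apply: (@dec_uniq _ _ (Vn 1 ⊙ Je a ⊙ Je b) (oneS V)).
- by rewrite lmulp_at1 ?c1 // => q /sP[].
- by repeat apply: rfree_mul; [apply: rfree_tpow|apply: rfree_Je|apply: rfree_Je].
- exact: lfree_one.
- move=> N; have := lmulp_coef N sP; rewrite mulS1 -[_ ⊙ Vn N]mulSA.
  by apply: mul_subr => y /Dsp_subV'; rewrite mulS1.
move=> N; have [+ _] := cD N; rewrite mulS1 -!mulSA; apply: mul_subr => y /Dsp_subV'.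
by rewrite mulS1 mulSA; apply: mul_subl; apply: Je_split.
Qed.

Lemma cmpo_rmul a b (s : seq (T * T)) :
  (forall q, q \in s -> q.1 \in Je b.+1 /\ q.2 \in Je a ⊙ Vn 1) ->
  \sum_(q <- s) q.1 * q.2 \in Jo (b + a).+1 ->
  \sum_(q <- s) cmp b q.1 * q.2%:P = cmpo (b + a) (\sum_(q <- s) q.1 * q.2).
Proof.
move=> sP xJ; have [c1 cD] := cmpoP xJ.
apply: (@dec_uniq _ _ (oneS V) (Je b ⊙ (Je a ⊙ Vn 1))).
- by rewrite rmulp_at1 ?c1 // => q /sP[].
- exact: rfree_one.
- by repeat apply: lfree_mul; [apply: lfree_Je|apply: lfree_Je|apply: lfree_tpow].
- move=> N; have := rmulp_coef N sP; rewrite mul1S [Vn N ⊙ _]mulSA.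
  by apply: mul_subl => y /Dsp_subV; rewrite mul1S.
move=> N; have [_] := cD N; rewrite mul1S [Je b ⊙ _]mulSA.
rewrite [Vn N ⊙ _]mulSA.
by apply: mul_subl => y /Dsp_subV; rewrite mul1S; apply: mul_subr; apply: Je_split.
Qed.

(** Each right factor is the sum of the coefficients of its decomposition, so contractions may be
    tested one coefficient at a time. *)
Lemma scalar_cmp_mem b (S : submodClosed T) (s : seq (T * T)) :
  (forall q, q \in s -> q.2 \in Je b.+1) ->
  (forall N (f : {scalar T}), \sum_(q <- s) f (cmp b q.2)`_N *: q.1 \in S) ->
  forall f : {scalar T}, \sum_(q <- s) f q.2 *: q.1 \in S.
Proof.
move=> sJ sS f.
have [n nP] : exists n, forall q, q \in s -> q.2 = \sum_(N < n) (cmp b q.2)`_N.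
  have [n nP] : exists n, forall q, q \in s ->
      forall m, (n <= m)%N -> q.2 = \sum_(N < m) (cmp b q.2)`_N.
    elim: s sJ {sS} => [|q s IHs] sJ; first by exists 0%N.
    have [|n nP] := IHs; first by move=> q' q's; apply: sJ; rewrite inE q's orbT.
    have [m mP] := cmp_sum (sJ _ (mem_head _ _)); exists (maxn m n) => q'.
    rewrite inE => /predU1P[->|/nP h] i; rewrite geq_max => /andP[mi ni].
      exact: mP.
    exact: h.
  by exists n => q qs; apply: nP.
have -> : \sum_(q <- s) f q.2 *: q.1 =
    \sum_(N < n) \sum_(q <- s) f (cmp b q.2)`_N *: q.1.
  rewrite exchange_big !big_seq; apply: eq_bigr => q qs /=.
  by rewrite {1}[q.2]nP // linear_sum scaler_suml.
by apply: rpred_sum => N _.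
Qed.

(** Splitting $J_{2(a+b)}$ after the leading letter puts $x$ in $V J_{2a} J_{2b}$; it remains to see
    the left factors in $J_{2a} V$. This is tested on coefficients: for $b > 0$ that of index $N+1$
    lies in $J_{2a} V J_{2(b-1)} V^{(N+1)}$, by the other description of the decomposition of
    $x$. *)
Lemma Jo_split_oe a b : {subset Jo (a + b) <= Jo a ⊙ Je b}.
Proof.
case: b => [|b] x; first by rewrite addn0 mulS1.
rewrite addnS => xJ; have /mul_sumP[s [sP xE]] : x \in Vn 1 ⊙ Je a ⊙ Je b.+1.
  rewrite -mulSA; have := Jo_subl xJ; apply: mul_subr.
  by rewrite -addnS; apply: Je_split.
have s2 q : q \in s -> q.2 \in Je b.+1 by case/sP.
rewrite xE in xJ *; have E := cmpo_lmul sP xJ; have [_ cD] := cmpoP xJ.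
apply: lfree_cap; [exact: lfree_Je|exact: mulo_sum|].
apply: coef_lmul => //; apply: (@scalar_cmp_mem b) => // -[|N] f.
  rewrite big_seq big1 ?rpred0 // => q /s2 q2.
  by rewrite cmp_small // linear0 scale0r.
have := @lfree_coef _ _ (Je b ⊙ Vn N.+1) (Je a ⊙ Vn 1)
  [seq (q.1, (cmp b q.2)`_N.+1) | q <- s].
move=> /(_ _ _ _ f); rewrite !big_map; apply=> [|_ /mapP[q /s2 q2 ->] /=|].
- by apply: lfree_mul; [apply: lfree_Je|apply: lfree_tpow].
- by have [_ /(_ N.+1)/Dsp_subV'] := cmpP q2; rewrite mulS1.
rewrite -(coef_lmulp s (cmp b)) E; have [_] := cD N.+1.
have -> : Vn N.+1 = Vn N ⊙ Vn 1 by rewrite -tpowD addn1.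
rewrite !mulSA; apply: mul_subl => y.
move/(Dsp2 (a := 0) (b := 1) (c := N)) => /(_ _ _ (add1n _) erefl).
by rewrite tpow0 mul1S.
Qed.

Lemma Jo_split_eo a b : {subset Jo (b + a) <= Je b ⊙ Jo a}.
Proof.
case: b => [|b] x; first by rewrite mul1S.
rewrite addSn => xJ; have /mul_sumP[s [sP xE]] : x \in Je b.+1 ⊙ (Je a ⊙ Vn 1).
  rewrite mulSA; have := Jo_subr xJ; apply: mul_subl.
  by rewrite -addSn; apply: Je_split.
have s1 q : q \in s -> q.1 \in Je b.+1 by case/sP.
rewrite xE in xJ *; have E := cmpo_rmul sP xJ; have [_ cD] := cmpoP xJ.
apply: rfree_cap; [exact: rfree_Je| |exact: mulo_sum].
apply: coef_rmul => // f.
(* After swapping, the test by coefficients applies to the left factors. *)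
rewrite -(big_map (@swap k V) xpredT (fun q : T * T => f q.2 *: q.1)).
apply: (@scalar_cmp_mem b) => [_ /mapP[q /s1 q1 ->]|N g]; first exact: q1.
rewrite big_map /=.
case: N => [|N].
  rewrite big_seq big1 ?rpred0 // => q /s1 q1.
  by rewrite cmp_small // linear0 scale0r.
have := @rfree_coef _ _ (Vn N.+1 ⊙ Je b) (Vn 1 ⊙ Je a)
  [seq ((cmp b q.1)`_N.+1, q.2) | q <- s].
move=> /(_ _ _ _ g); rewrite !big_map; apply=> [|_ /mapP[q /s1 q1 ->] /=|].
- by apply: rfree_mul; [apply: rfree_tpow|apply: rfree_Je].
- by have [_ /(_ N.+1)/Dsp_subV] := cmpP q1; rewrite mul1S.
rewrite -(coef_rmulp s (cmp b)) E; have [+ _] := cD N.+1.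
have -> : Vn N.+1 = Vn 1 ⊙ Vn N by rewrite -tpowD.
rewrite -!mulSA; apply: mul_subr => y.
move/(Dsp2 (a := N) (b := 1) (c := 0)) => /(_ b a).
rewrite addn0 addn1 => /(_ erefl erefl).
by rewrite tpow0 mulS1 -!mulSA.
Qed.

Lemma lfree_br ms ns : size ms = (size ns).+1 -> lfree (br ms ns).
Proof.
elim: ns ms => [|n ns IH] [|m ms] //=.
  by case: ms => // _; rewrite br1; apply: lfree_tpow.
move=> [szE]; rewrite br_cons; apply: lfree_mul; first exact: lfree_tpow.
by apply: lfree_mul; [apply: lfree_Je|apply: IH].
Qed.

Lemma br_succ m ms ns : size ms = size ns -> br (m.+1 :: ms) ns = Vn 1 ⊙ br (m :: ms) ns.
Proof.
case: ns ms => [|n ns] [|m' ms] // _; first by rewrite !br1 -add1n tpowD.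
by rewrite !br_cons -[m.+1]add1n tpowD -mulSA.
Qed.

(** One letter is placed either before or after the factor $J_{2j}$, the rest of the list being
    unchanged. As [S] is right free and the rest is left free, the two memberships combine to
    $J_{2j+1}$ followed by the rest. *)
Lemma br_Jo js N S x : rfree S ->
  (forall ms, size ms = (size js).+1 -> sumn ms = N -> x \in S ⊙ br ms js) ->
  (size js <= N)%N -> x \in S ⊙ prodsp (map Jo js) ⊙ Vn (N - size js).
Proof.
elim: js N S => [|j js IH] N S Sf h jN.
  by rewrite mulS1 subn0 -br1; apply: h => //=; rewrite addn0.
case: N => // N in h jN *; rewrite prodsp_cons mulSA subSS.
apply: IH => // [|ms szE msN]; first by apply: rfree_mul => //; apply: rfree_Jo.
case: ms szE msN => // m ms [szE] msN; rewrite /= in msN.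
have Bf := @lfree_br (m :: ms) js; set B := br _ _ in Bf *.
have x1 : x \in S ⊙ (Je j ⊙ Vn 1 ⊙ B).
  have := h (0 :: m.+1 :: ms)%N; rewrite br_cons br_succ // tpow0 mul1S.
  by rewrite -/B -[Je j ⊙ Vn 1 ⊙ B]mulSA; apply=> /=; rewrite ?szE // addSn msN.
have x2 : x \in S ⊙ (Vn 1 ⊙ Je j ⊙ B).
  have := h (1 :: m :: ms)%N; rewrite br_cons -/B -[Vn 1 ⊙ Je j ⊙ B]mulSA.
  by apply=> /=; rewrite ?szE // msN.
have := rfree_cap Sf x2 x1; rewrite -[S ⊙ Jo j ⊙ _]mulSA; apply: mul_subr => y.
rewrite mem_cap2 => /andP[y1 y2]; apply: lfree_cap => //; apply: Bf.
by rewrite /= szE.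
Qed.

Lemma Dsp_Jo js s N : sumn js = s -> (size js <= N)%N ->
  {subset Dsp s N <= prodsp (map Jo js) ⊙ Vn (N - size js)}.
Proof.
move=> jss jN x /DspP xD; rewrite -[prodsp _]mul1S; apply: br_Jo => //.
  exact: rfree_one.
by move=> ms *; rewrite mul1S; apply: xD.
Qed.

(** The letters not absorbed by the two odd factors are kept on the left, where [iota2] applies the
    augmentation. *)
Lemma Dsp_Jo2 a b N : (2 <= N)%N ->
  {subset Dsp (a + b) N <= Vn (N - 2) ⊙ (Jo a ⊙ Jo b)}.
Proof.
move=> N2 x /DspP xD.
have := @br_Jo [:: a; b] 2 (Vn (N - 2)) x (@rfree_tpow _ _ _).
rewrite subnn tpow0 mulS1 !prodsp_cons mulS1; apply=> // -[|m ms] // szE msN.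
have : x \in br ((N - 2 + m)%N :: ms) [:: a; b].
  by apply: xD => //=; rewrite ?addn0 //; move: msN => /=; lia.
by rewrite br_cons tpowD -!mulSA -br_cons.
Qed.

End JSpaces.

(** * Gradings and homogeneous words *)

Section DirectSum.
Variables (k : fieldType) (C : lmodType k) (I : choiceType).
Variable G : I -> submodClosed C.
Hypothesis Gdir : direct_sum G.

Lemma big_supp (s s' : seq I) (x : I -> C) : uniq s -> uniq s' ->
  {subset s <= s'} -> (forall i, i \notin s -> x i = 0) ->
  \sum_(i <- s') x i = \sum_(i <- s) x i.
Proof.
move=> us us' ss' x0; rewrite (bigID (mem s)) /= [X in _ + X]big1 ?addr0 //.
rewrite -big_filter; apply: perm_big; apply: uniq_perm; rewrite ?filter_uniq //.
by move=> i; rewrite mem_filter andb_idr //; apply: ss'.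
Qed.

(** Graph of the projection onto the degrees in [A]; directness makes the value unique, and the
    function is then chosen. *)
Definition proj_rel (A : pred I) (c y : C) := exists (s : seq I) (x : I -> C),
  [/\ uniq s, forall i, x i \in G i, forall i, i \notin s -> x i = 0,
      c = \sum_(i <- s) x i & y = \sum_(i <- s | A i) x i].

Lemma proj_rel_linear A a c y c' y' :
  proj_rel A c y -> proj_rel A c' y' -> proj_rel A (a *: c + c') (a *: y + y').
Proof.
move=> [s [x [us xG x0 -> ->]]] [s' [x' [us' xG' x0' -> ->]]].
pose t := undup (s ++ s').
have ut : uniq t by apply: undup_uniq.
have st : {subset s <= t} by move=> i si; rewrite mem_undup mem_cat si.
have st' : {subset s' <= t} by move=> i si; rewrite mem_undup mem_cat si orbT.
exists t, (fun i => a *: x i + x' i); split=> // [i|i||].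
- by rewrite rpredL.
- rewrite mem_undup mem_cat negb_or => /andP[/x0-> /x0'->].
  by rewrite scaler0 addr0.
- by rewrite big_split -scaler_sumr /= (big_supp us ut st x0) (big_supp us' ut st' x0').
- rewrite big_split -scaler_sumr /= !(big_mkcond A) /=.
  rewrite (big_supp us ut st) ?(big_supp us' ut st') // => i.
    by move=> /x0' ->; case: ifP.
  by move=> /x0 ->; case: ifP.
Qed.

Lemma proj_rel_gen (A : pred I) d c : c \in G d -> proj_rel A c (if A d then c else 0).
Proof.
move=> cG; exists [:: d], (fun i => if i == d then c else 0); split=> // [i|i||].
- by case: eqP => [->//|_]; apply: rpred0.
- by rewrite inE => /negbTE->.
- by rewrite big_seq1 eqxx.
- by rewrite big_mkcond big_seq1 eqxx.
Qed.

Lemma proj_rel_zero A y : proj_rel A 0 y -> y = 0.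
Proof.
move=> [s [x [us xG x0 s0 ->]]]; rewrite big_seq_cond big1 // => i /andP[si _].
by case: Gdir => _ /(_ s x us xG (esym s0)); apply.
Qed.

Lemma projection_exists (A : pred I) :
  {e : {linear C -> C} | forall d c, c \in G d -> e c = if A d then c else 0}.
Proof.
have tot c : exists y, proj_rel A c y.
  have [/(_ c) cG _] := Gdir; move: c cG.
  apply: lspan_ind => [|a x y [d _ xG] [y' h]].
    exists 0, [::], (fun=> 0); split=> // [i||]; rewrite ?big_nil ?rpred0 //.
  by exists (a *: (if A d then x else 0) + y'); apply: proj_rel_linear => //; apply: proj_rel_gen.
have uni c y y' : proj_rel A c y -> proj_rel A c y' -> y = y'.
  move=> h h'; apply/eqP; rewrite -subr_eq0; apply/eqP; apply: (@proj_rel_zero A).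
  have := proj_rel_linear (-1) h' h; rewrite scaleN1r addNr.
  by rewrite scaleN1r addrC.
pose f c := projT1 (cid (tot c)).
have fP c : proj_rel A c (f c) := projT2 (cid (tot c)).
have lf : linear f.
  by move=> a c c'; apply: (uni (a *: c + c')) => //; apply: proj_rel_linear.
have [e eE] := linear_exists lf; exists e => d c cG.
by rewrite eE; apply: (uni c) => //; apply: proj_rel_gen.
Qed.

Definition dproj A := sval (projection_exists A).
Lemma dprojE A d c : c \in G d -> dproj A c = if A d then c else 0.
Proof. exact: (svalP (projection_exists A)). Qed.

Lemma gdir_ind (Q : C -> Prop) : Q 0 ->
  (forall a d x y, x \in G d -> Q y -> Q (a *: x + y)) -> forall c, Q c.
Proof.
move=> Q0 QD c; have [/(_ c) cG _] := Gdir; move: c cG.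
by apply: lspan_ind => // a x y [d _ xG] Qy; apply: (QD a d).
Qed.

Lemma dproj_mem d c : dproj (pred1 d) c \in G d.
Proof.
elim/gdir_ind: c => [|a e x y xG yG]; first by rewrite linear0 rpred0.
rewrite linearP rpredL // (dprojE _ xG) /=.
by case: eqP => [<- //|_]; apply: rpred0.
Qed.

Lemma gdir_ext (X : lmodType k) (f g : {linear C -> X}) :
  (forall d c, c \in G d -> f c = g c) -> f =1 g.
Proof.
move=> fg; elim/gdir_ind => [|a d x y /fg xE yE]; first by rewrite !linear0.
by rewrite !linearP xE yE.
Qed.

Lemma dproj_sum c : exists s : seq I, uniq s /\ forall s', uniq s' -> {subset s <= s'} ->
  c = \sum_(d <- s') dproj (pred1 d) c.
Proof.
elim/gdir_ind: c => [|a d x y xG [s [us sP]]].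
  by exists [::]; split=> // s' _ _; rewrite big1 // => i _; rewrite linear0.
exists (undup (d :: s)); split=> [|s' us' ss']; first exact: undup_uniq.
under eq_bigr => i _ do rewrite linearP.
rewrite big_split -scaler_sumr -sP //=; last first.
  by move=> i si; apply: ss'; rewrite mem_undup inE si orbT.
congr (_ *: _ + _); rewrite (bigD1_seq d) //=; last first.
  by apply: ss'; rewrite mem_undup mem_head.
rewrite (dprojE _ xG) /= eqxx big1 ?addr0 // => i id.
by rewrite (dprojE _ xG) /= eq_sym (negbTE id).
Qed.

End DirectSum.

(** * Homogeneous words, and insertion of maps with Koszul signs *)

Section HomogeneousWords.
Variables (k : fieldType) (C : lmodType k).
Variable G : nat * int -> submodClosed C.
Hypothesis Gdir : direct_sum G.
Local Notation H := (hpart G).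

Lemma hpart_mem p a c : c \in G (p, a) -> c \in H p.
Proof. by move=> cG; apply: (mem_sumsp (i := a)). Qed.

Lemma hpart_proj (A : pred nat) p c : c \in H p ->
  dproj Gdir (fun d => A d.1) c = if A p then c else 0.
Proof.
case Ap: (A p); move: c.
  apply: (lspan_linear (g := idfun)) => x [a _ xG].
  by rewrite (dprojE _ _ xG) /= Ap.
apply: (lspan_linear (g := \0)) => x [a _ xG].
by rewrite (dprojE _ _ xG) /= Ap.
Qed.

Definition hproj p : {linear C -> C} := dproj Gdir (fun d => d.1 == p).
Definition evn : {linear C -> C} := dproj Gdir (fun d => ~~ odd d.1).

Lemma hprojE p q c : c \in H p -> hproj q c = if p == q then c else 0.
Proof. by move=> /(hpart_proj (pred1 q)). Qed.
Lemma evnE p c : c \in H p -> evn c = if odd p then 0 else c.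
Proof. by move=> /(hpart_proj (fun p => ~~ odd p)) ->; rewrite if_neg. Qed.

Lemma hpart_ind (Q : C -> Prop) : Q 0 ->
  (forall a p x y, x \in H p -> Q y -> Q (a *: x + y)) -> forall c, Q c.
Proof.
move=> Q0 QD; apply: (gdir_ind Gdir) => // a [p b] x y /hpart_mem.
exact: QD.
Qed.

Lemma hproj_mem p c : hproj p c \in H p.
Proof.
elim/hpart_ind: c => [|a q x y xG yG]; first by rewrite linear0 rpred0.
rewrite linearP rpredL // (hprojE _ xG).
by case: eqP => [<- //|_]; apply: rpred0.
Qed.

(** Multiplication by [(-1)^(d p)] in degree [p]. *)
Definition sgn d c := if odd d then evn c + evn c - c else c.
Lemma sgn_linear d : linear (sgn d).
Proof.
rewrite /sgn; case: (odd d) => [] a u v //; rewrite !(linearP evn).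
by rewrite scalerBr scalerDr opprD -[RHS]addrACA [X in X + _ = _]addrACA.
Qed.
Lemma sgnE d p c : c \in H p -> sgn d c = (-1) ^+ (d * p) *: c.
Proof.
move=> cH; rewrite /sgn -signr_odd oddM (evnE cH).
case: (odd d) => /=; last by rewrite expr0 scale1r.
case: (odd p) => /=; first by rewrite expr1 scaleN1r addr0 sub0r.
by rewrite expr0 scale1r addrK.
Qed.

Definition homogeneous (ws : seq (nat * C)) := forall w, w \in ws -> w.2 \in H w.1.
Definition hword (ws : seq (nat * C)) := \prod_(w <- ws) tvec w.2.

Lemma hwordE ws : hword ws = tword [seq w.2 | w <- ws].
Proof. by rewrite /tword big_map. Qed.
Lemma hword_cons w ws : hword (w :: ws) = tvec w.2 * hword ws.
Proof. exact: big_cons. Qed.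
Lemma hom_cons w ws : homogeneous (w :: ws) <-> w.2 \in H w.1 /\ homogeneous ws.
Proof.
split=> [h|[h1 h2] w']; last by rewrite inE => /predU1P[->|/h2].
by split=> [|w' ws']; apply: h; rewrite inE ?eqxx // ws' orbT.
Qed.
(** Letters are replaced one at a time by their homogeneous components; the arbitrary [y]
    accumulates the resulting sum. *)
Lemma hom_word_ind n (Q : talg C -> Prop) : Q 0 ->
  (forall a ws y, homogeneous ws -> size ws = n -> Q y -> Q (a *: hword ws + y)) ->
  forall cs, size cs = n -> forall a y, Q y -> Q (a *: tword cs + y).
Proof.
move=> Q0 QD cs; elim: cs n Q Q0 QD => [|c cs IH] n Q Q0 QD sz a y Qy.
  have -> : tword [::] = hword [::] :> talg C by rewrite hwordE.
  exact: QD.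
case: n sz QD => // n [sz] QD; rewrite tword_cons.
pose Q' (z : talg C) := forall a y, Q y -> Q (a *: (tvec c * z) + y).
suff : Q' (1 *: tword cs + 0) by rewrite scale1r addr0; apply.
apply: (IH n Q') => // {a y Qy} [a y Qy|b ws z hws wsn Qz a y Qy|a y Qy].
- by rewrite mulr0 scaler0 add0r.
- rewrite mulrDr scalerDr -addrA -scalerAr scalerA.
  move: (a *: (tvec c * z) + y) (Qz a y Qy) => z' Qz'.
  elim/hpart_ind: c z' Qz' {Q' Qz} => [|e p x u xH IHu] z' Qz'.
    by rewrite linear0 mul0r scaler0 add0r.
  rewrite tvec_linear mulrDl scalerDr -addrA -scalerAl scalerA.
  have -> : tvec x * hword ws = hword ((p, x) :: ws) by rewrite hword_cons.
  apply: QD; [by apply/hom_cons|by rewrite /= wsn|exact: IHu].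
- by rewrite mulr0 scaler0 add0r.
Qed.

Lemma hom_tpow_ind n (Q : talg C -> Prop) : Q 0 ->
  (forall a ws y, homogeneous ws -> size ws = n -> Q y -> Q (a *: hword ws + y)) ->
  forall x, x \in tpow C n -> Q x.
Proof.
move=> Q0 QD; apply: tpow_ind => // a ws y sz Qy.
exact: (hom_word_ind Q0 QD).
Qed.

Lemma hom_ind (Q : talg C -> Prop) : Q 0 ->
  (forall a ws y, homogeneous ws -> Q y -> Q (a *: hword ws + y)) -> forall x, Q x.
Proof.
move=> Q0 QD; elim/talg_ind => // a ws y Qy.
by apply: (@hom_word_ind (size ws)) => // b ws' z hws _; apply: QD.
Qed.

Lemma homog_repr_exists x : exists s, homog_repr G x s.
Proof.
elim/hom_ind: x => [|a ws y hws [s [sH sE]]].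
  by exists [::]; split=> //; rewrite big_nil.
exists ((a, ws) :: s); split=> [q|]; last by rewrite big_cons sE.
by rewrite inE => /predU1P[->|/sH].
Qed.

(** Removes the choice in [hlift]: a linear map with the right values on homogeneous words gives the
    same result on every representative. *)
Lemma hliftE (X : lmodType k) (F : seq (nat * C) -> X) (L : {linear talg C -> X}) :
  (forall ws, homogeneous ws -> L (hword ws) = F ws) -> hlift G F =1 L.
Proof.
move=> LF x; rewrite /hlift; case: xgetP => [s _ [sH sE]|/(_ _ _) no]; last first.
  by have [s /no] := homog_repr_exists x.
rewrite [in RHS]sE linear_sum !big_seq; apply: eq_bigr => q /sH qH.
by rewrite linearZ /= LF.
Qed.

Definition multilinear_at (X : lmodType k) p (F : seq C -> X) :=
  forall s1 s2 a u v, (size s1 + size s2).+1 = p ->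
    F (s1 ++ (a *: u + v) :: s2) = a *: F (s1 ++ u :: s2) + F (s1 ++ v :: s2).

(** The Koszul sign is distributed over the letters by [sgn d], so the formula makes sense, and is
    multilinear, on words that are not homogeneous. *)
Definition insert_word r p t d (F : seq C -> talg C) (cs : seq C) : talg C :=
  if size cs == (r + p + t)%N then
    tword (map (sgn d) (take r cs)) * F (take p (drop r cs)) * tword (drop (r + p) cs)
  else 0.

Lemma insert_word_multilinear r p t d F :
  multilinear_at p F -> multilinear (insert_word r p t d F).
Proof.
move=> Fl s1 s2 a u v; rewrite /insert_word !size_cat /=.
case: eqP => [sz0|_]; last by rewrite scaler0 addr0.
have sz : (size s1 + (size s2).+1 = r + p + t)%N := sz0.
rewrite !take_cat !drop_cat.
(* The varying letter stands in the suffix, the slot or the prefix; the boundary cases are those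
   where it comes right after the slot. *)
have [r1|r1] := ltnP r (size s1).
  rewrite !take_cat size_drop ltn_subRL; have [r2|r2] := ltnP (r + p)%N (size s1).
    by rewrite tword_multilinear mulrDr -scalerAr.
  have [m pE] : exists m, (r + p - size s1 = m)%N by eexists.
  case: m pE => [|m] pE.
    have -> : (p - (size s1 - r) = 0)%N by lia.
    rewrite pE !drop0 !take0 !tword_cons tvec_linear mulrDl mulrDr -!scalerAl -scalerAr //.
  have -> : (p - (size s1 - r) = m.+1)%N by lia.
  rewrite pE /= Fl.
    by rewrite mulrDr mulrDl -scalerAr -scalerAl.
  have ms : (m <= size s2)%N by lia.
  rewrite size_drop (size_takel ms). lia.
have -> : (r + p < size s1)%N = false by apply/negbTE; rewrite -leqNgt; lia.
have [m rE] : exists m, (r - size s1 = m)%N by eexists.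
case: m rE => [|m] rE.
  rewrite rE !take0 !drop0 !cats0; have [q pE] : exists q, p = q by eexists.
  have -> : (r + p - size s1 = p)%N by lia.
  case: q pE => [|q] pE.
    by rewrite pE !take0 !drop0 !tword_cons tvec_linear mulrDl mulrDr -!scalerAl -scalerAr.
  rewrite pE /=.
  have := Fl [::] (take q s2) a u v; rewrite /= => ->.
    by rewrite mulrDr mulrDl -scalerAr -scalerAl.
  have qs : (q <= size s2)%N by lia.
  by rewrite /= (size_takel qs).
have -> : (r + p - size s1 = (m + p).+1)%N by lia.
rewrite rE /= !map_cat /=.
have [h hE] := linear_exists (sgn_linear d); rewrite -!hE linearP.
by rewrite tword_multilinear !mulrDl -!scalerAl.
Qed.

Lemma tword_sgn d ws : homogeneous ws ->
  tword [seq sgn d w.2 | w <- ws] = (-1) ^+ (d * \sum_(w <- ws) w.1) *: hword ws.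
Proof.
elim: ws => [|w ws IH] /=; first by rewrite big_nil muln0 scale1r /hword big_nil tword_nil.
move=> /hom_cons[wH /IH E]; rewrite tword_cons E hword_cons big_cons (sgnE _ wH).
by rewrite linearZ /= -scalerAl -scalerAr scalerA mulnDr exprD.
Qed.

Lemma insertE r p t d F : multilinear_at p F ->
  {L : {linear talg C -> talg C} | insert G r p t d F =1 L /\
     forall cs, L (tword cs) = insert_word r p t d F cs}.
Proof.
move=> Fl; have [L LE] := talg_universal (insert_word_multilinear r t d Fl).
exists L; split=> //; apply: hliftE => ws wsH; rewrite hwordE LE /insert_word size_map.
case: eqP => // sz; rewrite -!map_take -!map_drop -!map_comp.
rewrite -map_take -[X in tword X * _ * _]/[seq sgn d w.2 | w <- take r ws] tword_sgn.
  by rewrite -!scalerAl -hwordE.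
by move=> w /mem_take; apply: wsH.
Qed.

Lemma insert1E r t d (f : C -> talg C) : linear f ->
  {L : {linear talg C -> talg C} |
     insert G r 1 t d (fun cs => f cs`_0) =1 L /\
     forall A c B, size A = r -> size B = t ->
       L (tword (A ++ c :: B)) = tword (map (sgn d) A) * f c * tword B}.
Proof.
move=> fl; have F1 : multilinear_at 1 (fun cs : seq C => f cs`_0).
  by move=> [|//] [|//] a u v _ /=; apply: fl.
have [L [LI LE]] := insertE r t d F1; exists L; split=> // A c B rA tB.
rewrite LE /insert_word.
have -> : (size (A ++ c :: B) == r + 1 + t)%N by rewrite size_cat /= rA tB; lia.
have -> : take r (A ++ c :: B) = A by rewrite -rA take_size_cat.
have -> : drop r (A ++ c :: B) = c :: B by rewrite -rA drop_size_cat.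
have -> // : drop (r + 1) (A ++ c :: B) = B.
by rewrite -cat_rcons drop_size_cat // size_rcons rA addn1.
Qed.

Lemma word_split r t (cs : seq C) : size cs = (r + 1 + t)%N ->
  exists A c B, [/\ size A = r, size B = t & cs = A ++ c :: B].
Proof.
move=> sz; have rcs : (r < size cs)%N by lia.
have c0 : C by case: cs sz rcs.
exists (take r cs), (nth c0 cs r), (drop r.+1 cs); split.
- by rewrite size_takel // ltnW.
- by rewrite size_drop; lia.
- by rewrite -drop_nth // cat_take_drop.
Qed.

End HomogeneousWords.

(** * The Adams grading of the spaces [J_i] *)

Lemma lspan_mul (k : fieldType) (V : lmodType k) (P Q : set (talg V))
    (S : submodClosed (talg V)) :
  (forall x y, P x -> Q y -> x * y \in S) ->
  forall x y, x \in lspan P -> y \in lspan Q -> x * y \in S.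
Proof.
move=> PQ x y; move: x; apply: lspan_ind => [_|a x z Px zS yQ].
  by rewrite mul0r rpred0.
rewrite mulrDl -scalerAl rpredL ?zS //; move: y yQ {zS}.
apply: lspan_ind => [|b y z' Qy zS]; first by rewrite mulr0 rpred0.
by rewrite mulrDr -scalerAr rpredL //; apply: PQ.
Qed.

Section TensorGrading.
Variables (k : fieldType) (W : lmodType k) (I : nmodType).
Variable G : I -> submodClosed W.

Lemma gtens_mul m n (d e : I) x y : x \in gtens G m d -> y \in gtens G n e ->
  x * y \in gtens G (m + n) (d + e).
Proof.
apply: lspan_mul => {}x {}y [ds [sd sumd] xd] [es [se sume] ye].
apply: lspan_mul x y xd ye => _ _ [ws wsd ->] [ws' wse ->].
apply: (mem_sumsp (i := ds ++ es)).
  by split; [rewrite size_cat sd se|rewrite big_cat sumd sume].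
apply: mem_lspan; exists (ws ++ ws'); last by rewrite big_cat.
rewrite map_cat; elim: ws ds {sd sumd} wsd => [|w ws IH] [|d' ds] //=.
by move=> /andP[-> /IH].
Qed.

Lemma gtens1 d w : w \in G d -> tvec w \in gtens G 1 d.
Proof.
move=> wd; apply: (mem_sumsp (i := [:: d])); first by rewrite big_seq1.
by apply: mem_lspan; exists [:: w]; rewrite /= ?wd ?big_seq1.
Qed.

Lemma gtens0 : 1 \in gtens G 0 0.
Proof.
apply: (mem_sumsp (i := [::])); first by rewrite big_nil.
by apply: mem_lspan; exists [::]; rewrite ?big_nil.
Qed.

Lemma gtalg_gtens n d x : x \in gtens G n d -> x \in gtalg G d.
Proof. by move=> xg; apply: (mem_sumsp (i := n)). Qed.

Lemma gtalg_mul (d e : I) x y : x \in gtalg G d -> y \in gtalg G e ->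
  x * y \in gtalg G (d + e).
Proof.
apply: lspan_mul => {}x {}y [m _ xd] [n _ ye].
by apply: (gtalg_gtens (n := m + n)); apply: gtens_mul.
Qed.

Lemma gtalg_linear_ext d (X : lmodType k) (f g : {linear talg W -> X}) :
  (forall ds ws, \sum_(e <- ds) e = d -> all2 (fun w e => w \in G e) ws ds ->
     f (tword ws) = g (tword ws)) ->
  forall x, x \in gtalg G d -> f x = g x.
Proof.
move=> fg; apply: lspan_linear => x [n _]; move: x.
apply: lspan_linear => x [ds [_ dsd]]; move: x.
apply: lspan_linear => _ [ws wsG ->]; apply: (fg ds) => //.
elim: ws ds wsG {dsd} => [|w ws IH] [|d' ds] //= /andP[-> /IH //].
Qed.

End TensorGrading.

Section AdamsGrading.
Variables (k : fieldType) (V : lmodType k) (Vg : nat -> submodClosed V).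
Hypothesis Vdir : direct_sum Vg.
Local Notation T := (talg V).
Local Notation gT := (gtalg Vg).
Local Notation pr e := (dproj Vdir (pred1 (e : nat))).
Implicit Types (S A : submodClosed T).

(** Values are families indexed by the degree, so that the components of a word are convolutions
    over its letters and can be computed by recursion. *)
Definition adams_step (w : V) (g : nat -> T) : nat -> T :=
  fun d => \sum_(e < d.+1) tvec (pr e w) * g (d - e)%N.

Lemma adams_step_linl g : linear (adams_step^~ g).
Proof.
move=> a u v; apply/funext => d.
transitivity (a *: adams_step u g d + adams_step v g d); last by [].
rewrite /adams_step scaler_sumr -big_split; apply: eq_bigr => e _ /=.
by rewrite linearP tvec_linear mulrDl scalerAl.
Qed.
Lemma adams_step_linr w : linear (adams_step w).
Proof.
move=> a u v; apply/funext => d.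
transitivity (a *: adams_step w u d + adams_step w v d); last by [].
rewrite /adams_step scaler_sumr -big_split; apply: eq_bigr => e _ /=.
by rewrite -[(a *: u + v) _]/(a *: u _ + v _) mulrDr scalerAr.
Qed.

Definition adams_fold :=
  talg_fold (fun d : nat => (d == 0%N)%:R : T) adams_step_linl adams_step_linr.

Lemma adams_exists d : {f : {linear T -> T} | forall x, f x = sval adams_fold x d}.
Proof. by apply: linear_exists => a x y; rewrite linearP. Qed.
Definition adams d := sval (adams_exists d).

Lemma adams1 d : adams d 1 = (d == 0%N)%:R.
Proof. by rewrite (svalP (adams_exists d)) (svalP adams_fold).1. Qed.
Lemma adams_vec d w t :
  adams d (tvec w * t) = \sum_(e < d.+1) tvec (pr e w) * adams (d - e) t.
Proof.
rewrite (svalP (adams_exists d)) (svalP adams_fold).2 /adams_step.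
by apply: eq_bigr => e _; rewrite (svalP (adams_exists _)).
Qed.

Lemma adams_word d ds ws : all2 (fun w e => w \in Vg e) ws ds ->
  adams d (tword ws) = if sumn ds == d then tword ws else 0.
Proof.
elim: ws ds d => [|w ws IH] [|e ds] d //=.
  by rewrite tword_nil adams1 eq_sym; case: eqP.
move=> /andP[we wsd]; rewrite tword_cons adams_vec.
under eq_bigr => i _ do rewrite (dprojE _ _ we) (IH _ _ wsd) /=.
have [ed|de] := leqP e d; last first.
  rewrite big1 => [|i _]; last first.
    by have := ltn_ord i; case: eqP => [<-|_]; [lia|rewrite linear0 mul0r].
  by case: eqP => // /eqP; lia.
have ed' : (e < d.+1)%N by [].
rewrite (bigD1 (Ordinal ed')) //= eqxx big1 ?addr0 => [|i /negP ie]; last first.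
  case: eqP => [ei|_]; last by rewrite linear0 mul0r.
  by case: ie; apply/eqP/val_inj.
have -> : (sumn ds == d - e)%N = (e + sumn ds == d)%N by lia.
by case: eqP => // _; rewrite mulr0.
Qed.

Lemma adams_gtalg d e x : x \in gT e -> adams d x = if e == d then x else 0.
Proof.
have sE ds : \sum_(i <- ds) i = sumn ds by rewrite sumnE.
case: eqP => [<-|ed].
  apply: (gtalg_linear_ext (g := idfun)) => ds ws dse wsd.
  by rewrite (adams_word _ wsd) -sE dse eqxx.
apply: (gtalg_linear_ext (g := \0)) => ds ws dse wsd.
by rewrite (adams_word _ wsd) -sE dse; case: eqP ed.
Qed.

Lemma gtalg_total x : x \in sumsp setT gT.
Proof.
elim/talg_ind: x => [|a ws y yS]; first exact: rpred0.
apply: rpredL => // {y yS a}; elim: ws => [|w ws IH].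
  by rewrite tword_nil; apply: (mem_sumsp (i := 0%N)) => //; apply/gtalg_gtens/gtens0.
rewrite tword_cons.
elim/(gdir_ind Vdir): w => [|a d w y wd yS]; first by rewrite linear0 mul0r rpred0.
rewrite tvec_linear mulrDl -scalerAl rpredL // {y yS a}.
have wd' : tvec w \in gT d by apply/gtalg_gtens/gtens1.
move: (tword ws) IH; apply: lspan_ind => [|a x y [e _ xe] yS].
  by rewrite mulr0 rpred0.
rewrite mulrDr -scalerAr rpredL //; apply: (mem_sumsp (i := d + e)) => //.
exact: gtalg_mul.
Qed.

Lemma gtalgT_ind (Q : T -> Prop) : Q 0 ->
  (forall a d x y, x \in gT d -> Q y -> Q (a *: x + y)) -> forall x, Q x.
Proof.
move=> Q0 QD x; move: x (gtalg_total x).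
by apply: lspan_ind => // a x y [d _ xd] Qy; apply: (QD a d).
Qed.

Lemma adams_mem d x : adams d x \in gT d.
Proof.
elim/gtalgT_ind: x => [|a e x y xe yd]; first by rewrite linear0 rpred0.
rewrite linearP rpredL // (adams_gtalg _ xe).
by case: eqP => [<- //|_]; apply: rpred0.
Qed.

Lemma adams_sum x : exists n, forall m, (n <= m)%N -> x = \sum_(d < m) adams d x.
Proof.
elim/gtalgT_ind: x => [|a e x y xe [n IH]].
  by exists 0%N => m _; rewrite big1 // => i _; rewrite linear0.
exists (maxn n e.+1) => m; rewrite geq_max => /andP[nm em].
under eq_bigr => i _ do rewrite linearP.
rewrite big_split -scaler_sumr -IH //=; congr (_ *: _ + _).
rewrite (bigD1 (Ordinal em)) //= (adams_gtalg _ xe) eqxx big1 ?addr0 // => i /negP ie.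
rewrite (adams_gtalg _ xe); case: eqP => // ei; case: ie; exact/eqP/val_inj.
Qed.

Lemma adams_mul d x y :
  adams d (x * y) = \sum_(e < d.+1) adams e x * adams (d - e) y.
Proof.
elim/gtalgT_ind: x => [|a i x z xi IH].
  by rewrite mul0r linear0 big1 // => e _; rewrite linear0 mul0r.
under eq_bigr => e _ do rewrite linearP mulrDl -scalerAl.
rewrite mulrDl -scalerAl linearP IH big_split -scaler_sumr /=; congr (_ *: _ + _).
elim/gtalgT_ind: y {IH} => [|b j y t yj IH].
  by rewrite mulr0 linear0 big1 // => e _; rewrite linear0 mulr0.
under eq_bigr => e _ do rewrite linearP mulrDr -scalerAr.
rewrite mulrDr -scalerAr linearP IH big_split -scaler_sumr /=; congr (_ *: _ + _).
rewrite (adams_gtalg _ (gtalg_mul xi yj)).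
under eq_bigr => e _ do rewrite (adams_gtalg _ xi) (adams_gtalg _ yj).
have [id|di] := leqP i d; last first.
  rewrite big1 => [|e _]; first by case: eqP => //; rewrite -[i + j]/(i + j)%N; lia.
  by have := ltn_ord e; case: eqP => [<-|_]; [lia|rewrite mul0r].
have id' : (i < d.+1)%N by [].
rewrite (bigD1 (Ordinal id')) //= eqxx big1 ?addr0 => [|e /negP ie]; last first.
  case: eqP => [ei|_]; last by rewrite mul0r.
  by case: ie; apply/eqP/val_inj.
have -> : (j == d - i)%N = (i + j == d)%N by lia.
by rewrite -[i + j]/(i + j)%N; case: eqP => // _; rewrite mulr0.
Qed.

Definition graded S := forall x d, x \in S -> adams d x \in S.

Lemma graded_lspan (P : set T) :
  (forall x d, P x -> adams d x \in lspan P) -> graded (lspan P).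
Proof.
move=> Pg x d; move: x; apply: lspan_ind => [|a x y Px yP]; first by rewrite linear0 rpred0.
by rewrite linearP rpredL // Pg.
Qed.

Lemma graded_mul S A : graded S -> graded A -> graded (S ⊙ A).
Proof.
move=> Sg Ag; apply: graded_lspan => _ d [a [b [aS bA ->]]].
rewrite adams_mul; apply: rpred_sum => e _.
by apply: mem_mul; [apply: Sg|apply: Ag].
Qed.

Lemma graded_cap (J : Type) (P : set J) (F : J -> submodClosed T) :
  (forall i, P i -> graded (F i)) -> graded (cap P F).
Proof.
move=> Fg x d /asboolP xF; apply/asboolP => i Pi.
by apply: Fg => //; apply: xF.
Qed.

Lemma graded_cap2 S A : graded S -> graded A -> graded (cap2 S A).
Proof. by move=> Sg Ag; apply: graded_cap => -[]. Qed.

Lemma graded_sumsp (J : Type) (P : set J) (F : J -> submodClosed T) :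
  (forall i, P i -> graded (F i)) -> graded (sumsp P F).
Proof.
move=> Fg; apply: graded_lspan => x d [i Pi xF].
by apply: (mem_sumsp (i := i)) => //; apply: Fg.
Qed.

Lemma graded_one : graded (oneS V).
Proof.
move=> _ d /oneSP[c ->]; rewrite linearZ /= adams1; apply: rpredZ.
by case: eqP => _; [apply: mem1|apply: rpred0].
Qed.

Lemma graded_tpow n : graded (tpow V n).
Proof.
elim: n => [|n IHn]; first by rewrite tpow0; apply: graded_one.
rewrite -add1n tpowD; apply: graded_mul => // _ d /tpow1P[v ->].
rewrite -[tvec v]mulr1 adams_vec; apply: rpred_sum => e _; rewrite adams1.
by case: eqP => _; rewrite ?mulr1 ?tvec_mem // mulr0 rpred0.
Qed.

Variable R : submodClosed T.
Hypothesis Rrel : relation_space Vg R.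
Local Notation Je := (J_even R).

Lemma graded_R : graded R.
Proof.
move=> r d /(rel_graded Rrel); move: r.
apply: lspan_ind => [|a r y [e _]]; first by rewrite linear0 rpred0.
rewrite mem_cap2 => /andP[rR re] yR; rewrite linearP rpredL // (adams_gtalg _ re).
by case: eqP => // _; apply: rpred0.
Qed.

Lemma graded_Rpow n : graded (Rpow R n).
Proof.
elim: n => [|n IHn]; first exact: graded_one.
by rewrite RpowS; apply: graded_mul => //; apply: graded_R.
Qed.

(** The bound [m] lets this be used inside the strong induction on the index of $J$. *)
Lemma graded_br_le m ms ns : (forall n, (n <= m)%N -> graded (Je n)) ->
  (sumn ns <= m)%N -> size ms = (size ns).+1 -> graded (br R ms ns).
Proof.
move=> Jg; elim: ns ms => [|n ns IH] [|l ms] //.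
  by case: ms => // _ _; rewrite br1; apply: graded_tpow.
move=> /= nm [szE]; rewrite br_cons; apply: graded_mul; first exact: graded_tpow.
apply: graded_mul; first by apply: Jg; lia.
by apply: IH => //; lia.
Qed.

Lemma graded_Je n : graded (Je n).
Proof.
have [m] := ubnP n; elim: m n => // m IH [|[|n]] nm; first exact: graded_one.
  exact: graded_R.
move=> x d; rewrite !J_even_rec //; move: x d.
apply: graded_cap2; last exact: graded_Rpow.
apply: graded_sumsp => N _; apply: graded_cap => -[ns ms] /= [szn nsn szE _].
apply: (@graded_br_le n.+1); rewrite ?nsn //; last first.
  by rewrite szE szn.
by move=> i ni; apply: IH; lia.
Qed.

Lemma graded_br ms ns : size ms = (size ns).+1 -> graded (br R ms ns).
Proof. by apply: (@graded_br_le (sumn ns)) => // n _; apply: graded_Je. Qed.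

Lemma graded_Dsp s N : graded (Dsp R s N).
Proof. by apply: graded_cap => -[ms ns] /= [szE _ _]; apply: graded_br. Qed.

Lemma graded_Jo p : graded (Jo R p).
Proof.
by apply: graded_cap2; apply: graded_mul; try exact: graded_Je; exact: graded_tpow.
Qed.

(** All the spaces are graded, so the parts of degree [d] of the coefficients decompose $x$ as well;
    by uniqueness they are the coefficients. *)
Lemma cmp_gtalg s x N d : x \in Je s.+1 -> x \in gT d -> (cmp R s x)`_N \in gT d.
Proof.
move=> xJ xd; have [c1 cD] := cmpP xJ.
pose p := \poly_(i < size (cmp R s x)) adams d (cmp R s x)`_i.
have pE i : p`_i = adams d (cmp R s x)`_i.
  by rewrite coef_poly; case: ltnP => // h; rewrite [in RHS]nth_default // linear0.
have : p = cmp R s x.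
  apply: (cmp_dec Rrel xJ); split=> [|i]; last by rewrite pE; apply: graded_Dsp.
  by rewrite poly_fam_at1 -linear_sum -(poly_at1 (leqnn _)) c1 (adams_gtalg _ xd) eqxx.
by move=> <-; rewrite pE; apply: adams_mem.
Qed.

End AdamsGrading.

(** * The direct sum of the [J_i] and its tensor powers *)

Section JSum.
Variables (k : fieldType) (V : lmodType k) (Vg : nat -> submodClosed V).
Local Notation T := (talg V).
Variable R : submodClosed T.
Hypothesis Vdir : direct_sum Vg.
Hypothesis Rrel : relation_space Vg R.
Local Notation Je := (J_even R).
Local Notation JS := (Jsum R).
Local Notation Gr := (Jgr Vg R).
Local Notation H := (hpart Gr).
Local Notation JJ := (J R).

Lemma JE i : JJ i = if odd i then Jo R i./2 else Je i./2.
Proof. by rewrite /J /Jo !prodsp_cons !mulS1. Qed.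
Lemma Jeven p : JJ p.*2 = Je p. Proof. by rewrite JE odd_double doubleK. Qed.
Lemma Jodd p : JJ p.*2.+1 = Jo R p.
Proof. by rewrite JE /= odd_double /= uphalf_double. Qed.

Lemma rfree_J i : rfree (JJ i).
Proof. by rewrite JE; case: odd; [apply: (rfree_Jo Rrel)|apply: (rfree_Je Rrel)]. Qed.
Lemma graded_J i : graded Vdir (JJ i).
Proof.
by rewrite JE; case: odd; [apply: (graded_Jo Vdir Rrel)|apply: (graded_Je Vdir Rrel)].
Qed.

Lemma J_split i j : ~~ (odd i && odd j) -> {subset JJ (i + j) <= JJ i ⊙ JJ j}.
Proof.
rewrite (JE i) (JE j) (JE (i + j)) oddD; case oi: (odd i); case oj: (odd j) => // _ x.
- have -> : ((i + j)./2 = i./2 + j./2)%N by lia.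
  exact: (Jo_split_oe Rrel).
- have -> : ((i + j)./2 = i./2 + j./2)%N by lia.
  exact: (Jo_split_eo Rrel).
- have -> : ((i + j)./2 = i./2 + j./2)%N by lia.
  exact: (Je_split Rrel).
Qed.

Lemma Jsum_predP (f : nat -> T) : f \in Jsum_pred R <->
  (forall i, f i \in JJ i) /\ exists n, forall i, (n <= i)%N -> f i = 0.
Proof.
split=> [|[fJ [n fn]]].
  move: f; apply: lspan_ind => [|a f g [i fi fj] [gJ [n gn]]].
    by split=> [i|]; [apply: rpred0|exists 0%N].
  have E j : (a *: f + g) j = a *: f j + g j by [].
  split=> [j|]; first rewrite E.
    by apply: rpredL => //; have [->//|/fj->] := eqVneq j i; apply: rpred0.
  exists (maxn i.+1 n) => j; rewrite geq_max => /andP[ij nj].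
  by rewrite E gn // fj ?scaler0 ?addr0 // gtn_eqF.
have -> : f = \sum_(i < n) (fun j => if j == i :> nat then f i else 0).
  apply/funext => j; rewrite fct_sumE.
  have [nj|jn] := leqP n j.
    rewrite fn // big1 // => i _; case: eqP => // ji; have := ltn_ord i.
    by rewrite -ji ltnNge nj.
  rewrite (bigD1 (Ordinal jn)) //= eqxx big1 ?addr0 // => i /negP ij.
  by case: eqP => // ji; case: ij; apply/eqP/val_inj.
apply: rpred_sum => i _; apply: mem_lspan; exists (i : nat); first by rewrite eqxx.
by move=> j /negbTE ->.
Qed.

Lemma Jcomp_mem (c : JS) i : Jcomp c i \in JJ i.
Proof. by have /Jsum_predP[h _] := valP c; apply: h. Qed.
Lemma Jcomp_bound (c : JS) : exists n, forall i, (n <= i)%N -> Jcomp c i = 0.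
Proof. by have /Jsum_predP[_ h] := valP c. Qed.
Lemma JcompP a (c d : JS) i : Jcomp (a *: c + d) i = a *: Jcomp c i + Jcomp d i.
Proof. by []. Qed.
Lemma JcompZ a (c : JS) i : Jcomp (a *: c) i = a *: Jcomp c i.
Proof. by []. Qed.
Lemma Jcomp_ext (c d : JS) : (forall i, Jcomp c i = Jcomp d i) -> c = d.
Proof. by move=> h; apply/val_inj/funext. Qed.
Lemma Jcomp_sum (I : Type) (s : seq I) (F : I -> JS) i :
  Jcomp (\sum_(j <- s) F j) i = \sum_(j <- s) Jcomp (F j) i.
Proof.
by elim: s => [|j s IH]; rewrite ?big_nil // !big_cons -[X in Jcomp (X + _)]scale1r
  JcompP scale1r IH.
Qed.

(** Extended by zero outside $J_i$ to be a total function. *)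
Definition jin i (x : T) : JS :=
  insubd 0 (fun j => if (j == i) && (x \in JJ i) then x else 0).
Lemma jinE i x j : Jcomp (jin i x) j = if (j == i) && (x \in JJ i) then x else 0.
Proof.
rewrite /Jcomp /jin val_insubd; case: ifP => // /negP; case.
apply/Jsum_predP; split=> [j'|].
  by case: ifP => [/andP[/eqP-> //]|_]; apply: rpred0.
by exists i.+1 => j' ij; rewrite gtn_eqF.
Qed.
Lemma jin_same i x : x \in JJ i -> Jcomp (jin i x) i = x.
Proof. by move=> xJ; rewrite jinE eqxx xJ. Qed.
Lemma jin_other i x j : j != i -> Jcomp (jin i x) j = 0.
Proof. by move=> /negbTE ji; rewrite jinE ji. Qed.

Lemma jin_linear i : linear_on (JJ i) (jin i).
Proof.
move=> a x y xJ yJ; apply: Jcomp_ext => j; rewrite JcompP !jinE xJ yJ rpredL //=.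
by case: eqP => //=; rewrite scaler0 addr0.
Qed.

Lemma jin_sum (c : JS) n : (forall i, (n <= i)%N -> Jcomp c i = 0) ->
  c = \sum_(i < n) jin i (Jcomp c i).
Proof.
move=> cn; apply: Jcomp_ext => j; rewrite Jcomp_sum.
have [nj|jn] := leqP n j.
  rewrite cn // big1 // => i _; apply: jin_other; have := ltn_ord i; lia.
rewrite (bigD1 (Ordinal jn)) //= jin_same ?Jcomp_mem // big1 ?addr0 // => i /negP ij.
by apply: jin_other; apply/negP => /eqP ji; case: ij; apply/eqP/val_inj.
Qed.

Lemma Jgr_natP p (a : nat) (c : JS) : c \in Gr (p, a%:Z) <->
  (forall j, j != p -> Jcomp c j = 0) /\ Jcomp c p \in gtalg Vg a.
Proof.
split=> [|[c1 c2]]; last by apply: mem_lspan; split=> //; exists a.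
move: c; apply: lspan_ind => [|b c d [/= c1 [a' [<-] c2]] [d1 d2]].
  by split=> //; apply: rpred0.
by split=> [j jp|]; rewrite JcompP; [rewrite c1 ?d1 // scaler0 addr0|apply: rpredL].
Qed.

Lemma Jgr_neg p n (c : JS) : c \in Gr (p, Negz n) -> c = 0.
Proof. by move: c; apply: lspan_ind => // b c d [_ [a']]. Qed.

Lemma jin_Jgr p a x : x \in JJ p -> x \in gtalg Vg a -> jin p x \in Gr (p, a%:Z).
Proof. by move=> xJ xa; apply/Jgr_natP; split=> [j /jin_other|]; rewrite ?jin_same. Qed.

Lemma jin_adams p x : x \in JJ p ->
  exists n, jin p x = \sum_(d < n) jin p (adams Vdir d x).
Proof.
move=> xJ; have [n xE] := adams_sum Vdir x; exists n; apply: Jcomp_ext => j.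
rewrite Jcomp_sum; have [->|jp] := eqVneq j p.
  rewrite jin_same // {1}[x](xE n) //; apply: eq_bigr => i _.
  by rewrite jin_same //; apply: graded_J.
by rewrite jin_other // big1 // => i _; rewrite jin_other.
Qed.

Lemma Jgr_direct : direct_sum Gr.
Proof.
split=> [c|s x us xG s0 [p b] ps].
  have [n cn] := Jcomp_bound c; rewrite (jin_sum cn); apply: rpred_sum => i _.
  have [m ->] := jin_adams (Jcomp_mem c i); apply: rpred_sum => d _.
  apply: (mem_sumsp (i := (i : nat, (d : nat)%:Z))) => //.
  by apply: jin_Jgr; [apply/graded_J/Jcomp_mem|apply: adams_mem].
case: b ps => [a|n] ps; last by apply: (@Jgr_neg p n); apply: xG.
have /Jgr_natP[x1 x2] := xG (p, a%:Z).
apply: Jcomp_ext => j; have [->|/x1 -> //] := eqVneq j p.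
(* Among the summands, only the one of index [(p, a)] survives this test map. *)
have [h hE] : {h : {linear JS -> T} | forall c, h c = adams Vdir a (Jcomp c p)}.
  by apply: linear_exists => b c d; rewrite JcompP linearP.
have := congr1 h s0; rewrite linear0 linear_sum (bigD1_seq (p, a%:Z)) //=.
rewrite hE (adams_gtalg _ _ x2) eqxx big1 ?addr0 // => -[q [b|b]] qp; last first.
  by rewrite (Jgr_neg (xG _)) linear0.
rewrite hE; have /Jgr_natP[y1 y2] := xG (q, b%:Z).
have [pq|pq] := eqVneq p q; last by rewrite y1 // linear0.
rewrite pq (adams_gtalg _ _ y2); case: eqP => // ba.
by rewrite pq ba eqxx in qp.
Qed.

Lemma hpartP p (c : JS) : c \in H p <-> forall j, j != p -> Jcomp c j = 0.
Proof.
split=> [|c0].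
  move: c; apply: lspan_ind => [//|a c d [[b|b] _ cG] d0] j jp.
    by have /Jgr_natP[c0 _] := cG; rewrite JcompP c0 // d0 // scaler0 addr0.
  by rewrite JcompP (Jgr_neg cG) d0 // scaler0 addr0.
have -> : c = jin p (Jcomp c p).
  apply: Jcomp_ext => j; rewrite jinE Jcomp_mem andbT.
  by case: eqP => [->//|/eqP/c0].
have [m ->] := jin_adams (Jcomp_mem c p); apply: rpred_sum => d _.
apply: (@hpart_mem _ _ _ _ (d : nat)%:Z).
by apply: jin_Jgr; [apply/graded_J/Jcomp_mem|apply: adams_mem].
Qed.

Lemma jin_hpart p x : jin p x \in H p.
Proof. by apply/hpartP => j; apply: jin_other. Qed.

Local Notation hpr := (hproj Jgr_direct).
Local Notation sg := (sgn Jgr_direct).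

Lemma Jcomp_lin (f : {linear JS -> JS}) i :
  {h : {linear JS -> T} | forall c, h c = Jcomp (f c) i}.
Proof. by apply: linear_exists => a c d; rewrite linearP. Qed.

Lemma Jcomp_hproj p c j : Jcomp (hpr p c) j = if j == p then Jcomp c j else 0.
Proof.
have [f fE] := Jcomp_lin (hpr p) j.
have [g gE] : {g : {linear JS -> T} | forall c, g c = if j == p then Jcomp c j else 0}.
  by apply: linear_exists => a x y; case: ifP => _ //; rewrite scaler0 addr0.
rewrite -fE -gE; move: c; apply: (gdir_ext Jgr_direct) => -[q b] c /hpart_mem cH.
rewrite fE gE (hprojE _ _ cH); have /hpartP c0 := cH.
case: (eqVneq j p) => [->|jp]; case: (eqVneq q p) => [qp|qp] //.
- by rewrite (c0 p) // eq_sym.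
- by rewrite c0 ?qp.
Qed.

Lemma Jcomp_sgn d c j : Jcomp (sg d c) j = (-1) ^+ (d * j) *: Jcomp c j.
Proof.
have [f fE] : {f : {linear JS -> T} | forall c, f c = Jcomp (sg d c) j}.
  by apply: linear_exists => a x y; rewrite sgn_linear.
have [g gE] : {g : {linear JS -> T} | forall c, g c = (-1) ^+ (d * j) *: Jcomp c j}.
  apply: linear_exists => a x y.
  by rewrite (JcompP a x y j) scalerDr !scalerA mulrC.
rewrite -fE -gE; move: c; apply: (gdir_ext Jgr_direct) => -[q b] c /hpart_mem cH.
rewrite fE gE (sgnE _ _ cH) JcompZ.
have [->|jq] := eqVneq j q; first by [].
by have /hpartP c0 := cH; rewrite (c0 _ jq) !scaler0.
Qed.

(** ** The components of a tensor, multiplied in [T(V)] *)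

Definition Qstep (c : JS) (g : seq nat -> T) : seq nat -> T :=
  fun ii => if ii is i :: ii' then Jcomp c i * g ii' else 0.
Lemma Qstep_linl g : linear (Qstep^~ g).
Proof.
move=> a c d; apply/funext => -[|i ii].
  by transitivity (a *: (0 : T) + 0); [rewrite scaler0 addr0|].
transitivity (a *: (Jcomp c i * g ii) + Jcomp d i * g ii); last by [].
by rewrite scalerAl -mulrDl.
Qed.
Lemma Qstep_linr c : linear (Qstep c).
Proof.
move=> a g h; apply/funext => -[|i ii].
  by transitivity (a *: (0 : T) + 0); [rewrite scaler0 addr0|].
transitivity (a *: (Jcomp c i * g ii) + Jcomp c i * h ii); last by [].
by rewrite scalerAr -mulrDr.
Qed.
Definition Qfold := talg_fold (fun ii : seq nat => (ii == [::])%:R : T) Qstep_linl Qstep_linr.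
Lemma Q_exists ii : {f : {linear talg JS -> T} | forall x, f x = sval Qfold x ii}.
Proof. by apply: linear_exists => a x y; rewrite linearP. Qed.

(** [Qm [:: i_1; ...; i_n]] projects to the component [J_(i_1) (x) ... (x) J_(i_n)]
    and multiplies in [T(V)]. *)
Definition Qm ii := sval (Q_exists ii).

Lemma Qm1 ii : Qm ii 1 = (ii == [::])%:R.
Proof. by rewrite (svalP (Q_exists ii)) (svalP Qfold).1. Qed.
Lemma Qm_vec ii c t :
  Qm ii (tvec c * t) = if ii is i :: ii' then Jcomp c i * Qm ii' t else 0.
Proof.
rewrite (svalP (Q_exists ii)) (svalP Qfold).2 /Qstep.
by case: ii => // i ii; rewrite (svalP (Q_exists ii)).
Qed.

Lemma Qm_cat ii jj x y : x \in tpow JS (size ii) ->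
  Qm (ii ++ jj) (x * y) = Qm ii x * Qm jj y.
Proof.
move: x; apply: tpow_ind => [|a cs z sz IH]; first by rewrite mul0r !linear0 mul0r.
rewrite mulrDl -scalerAl !linearP IH mulrDl -scalerAl; congr (_ *: _ + _).
elim: cs ii sz {IH} => [|c cs IHc] [|i ii] //= sz.
  by rewrite tword_nil mul1r Qm1 mul1r.
by rewrite tword_cons -mulrA !Qm_vec IHc ?mulrA //; case: sz.
Qed.

(** Split off the first letter and contract it by a functional [f] on [Jsum]. For each [i], the
    components in $J_i$ of the first letters and the products of the rest form a zero tensor, $J_i$
    being right free. Each of the letters involved is a finite sum of components, so the contraction
    has zero products and induction applies. *)
Lemma Qm_inj n x : x \in tpow JS n -> (forall ii, size ii = n -> Qm ii x = 0) -> x = 0.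
Proof.
elim: n x => [|n IH] x.
  rewrite tpow0 => /oneSP[c ->] /(_ [::] erefl).
  rewrite linearZ /= Qm1 /= => /(congr1 (@taug _ _)).
  rewrite linearZ linear0 /= -[X in taug X]tword_nil taug_word mulr1 => ->.
  by rewrite scale0r.
rewrite -add1n tpowD => /mul_sumP[s [sP ->]] Q0.
have {sP} [t [tP xE]] : exists t : seq (JS * talg JS),
    (forall q, q \in t -> q.2 \in tpow JS n) /\
    \sum_(q <- s) q.1 * q.2 = \sum_(q <- t) tvec q.1 * q.2.
  elim: s {Q0} sP => [|q s IHs] sP; first by exists [::]; rewrite !big_nil.
  have [|t [tP tE]] := IHs; first by move=> q' q's; apply: sP; rewrite inE q's orbT.
  have [/tpow1P[c cE] q2] := sP q (mem_head _ _).
  exists ((c, q.2) :: t); split=> [q'|]; last by rewrite !big_cons tE cE.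
  by rewrite inE => /predU1P[->|/tP].
rewrite {}xE in Q0 *.
apply: (tensor0_bilinearT (g := fun c y => tvec c * y)) => [y a u v|c|f].
- by rewrite tvec_linear mulrDl scalerAl.
- exact: mulr_linearr.
apply: IH => [|ii szi]; first by apply: rpred_seq => q /tP; apply: rpredZ.
have J0 i : tensor0 [seq (Jcomp q.1 i, Qm ii q.2) | q <- t].
  apply: (@rfree_J i) => [_ /mapP[q _ ->]|]; first exact: Jcomp_mem.
  rewrite big_map /=; have := Q0 (i :: ii); rewrite /= szi => /(_ erefl) h; rewrite -[RHS]h.
  by rewrite linear_sum; apply: eq_bigr => q _; rewrite Qm_vec.
have [n' n'P] : exists n', forall q, q \in t -> q.1 = \sum_(i < n') jin i (Jcomp q.1 i).
  have [n' n'P] : exists n', forall q, q \in t -> forall i, (n' <= i)%N -> Jcomp q.1 i = 0.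
    elim: (t) => [|q t' [m mP]]; first by exists 0%N.
    have [m' m'P] := Jcomp_bound q.1; exists (maxn m m') => q'.
    rewrite inE => /predU1P[->|/mP h] i; rewrite geq_max => /andP[mi ni]; first exact: m'P.
    exact: h.
  by exists n' => q /n'P; apply: jin_sum.
rewrite linear_sum.
have -> : \sum_(q <- t) Qm ii (f q.1 *: q.2) =
    \sum_(i < n') \sum_(q <- t) f (jin i (Jcomp q.1 i)) *: Qm ii q.2.
  rewrite exchange_big !big_seq; apply: eq_bigr => q qt /=.
  by rewrite linearZ /= {1}[q.1](n'P _ qt) linear_sum scaler_suml.
rewrite big1 // => i _.
have := @tensor0_bilinear _ _ _ _ (JJ i) [seq (Jcomp q.1 i, Qm ii q.2) | q <- t]
  (fun x y => f (jin i x) *: y).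
rewrite big_map; apply=> [y a u v uJ vJ|u a y z|q /mapP[q' _ ->]|] /=.
- by rewrite jin_linear // linearP scalerDl scalerA.
- by rewrite scalerDr !scalerA mulrC.
- exact: Jcomp_mem.
- exact: J0.
Qed.

Lemma Qm_eq n x y : x \in tpow JS n -> y \in tpow JS n ->
  (forall ii, size ii = n -> Qm ii x = Qm ii y) -> x = y.
Proof.
move=> xn yn xy; apply/eqP; rewrite -subr_eq0; apply/eqP/(@Qm_inj n).
  exact: rpredBm.
by move=> ii sz; rewrite linearB /= xy // subrr.
Qed.

Local Notation Jt := (Jtens Vg R).

Lemma JtensP ii (P : talg JS -> Prop) : P 0 ->
  (forall a cs y, all2 (fun c i => c \in H i) cs ii -> P y -> P (a *: tword cs + y)) ->
  forall x, x \in Jt ii -> P x.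
Proof.
move=> P0 PD; apply: lspan_ind => // a ? y [cs csH ->] Py; apply: PD => //.
elim: cs ii csH {y Py} => [|c cs IH] [|i ii] //= /andP[-> /IH //].
Qed.

Lemma Jtens_word ii cs : all2 (fun c i => c \in H i) cs ii -> tword cs \in Jt ii.
Proof.
move=> csH; apply: mem_lspan; exists cs => //.
by elim: cs ii csH => [|c cs IH] [|i ii] //= /andP[-> /IH].
Qed.

Lemma Jtens_cons i ii c t : c \in H i -> t \in Jt ii -> tvec c * t \in Jt (i :: ii).
Proof.
move=> cH; move: t; apply: JtensP => [|a cs y csH yJ]; first by rewrite mulr0 rpred0.
rewrite mulrDr -scalerAr rpredL // -tword_cons; apply: Jtens_word.
by rewrite /= cH.
Qed.

Lemma Jtens_tpow ii : {subset Jt ii <= tpow JS (size ii)}.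
Proof.
apply: JtensP => [|a cs y csH yJ]; first exact: rpred0.
have -> : size ii = size cs.
  by elim: cs ii csH {yJ} => [|c cs IH] [|i ii] //= /andP[_ /IH->].
rewrite rpredL ?tpow_word //; move: yJ; congr (_ \in tpow JS _).
by elim: cs ii csH => [|c cs IH] [|i ii] //= /andP[_ /IH->].
Qed.

Lemma Qm_Jtens ii jj t : t \in Jt ii -> jj != ii -> Qm jj t = 0.
Proof.
move=> tJ ne; move: t tJ; apply: JtensP => [|a cs y csH yJ]; first exact: linear0.
rewrite linearP yJ addr0; suff -> : Qm jj (tword cs) = 0 by rewrite scaler0.
elim: cs ii jj csH ne {yJ} => [|c cs IH] [|i ii] [|j jj] //=.
- by rewrite tword_nil Qm1.
- by rewrite tword_cons Qm_vec.
- move=> /andP[/hpartP c0 csH]; rewrite tword_cons Qm_vec eqseq_cons negb_and.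
  by case/orP => [/c0->|/(IH _ _ csH)->]; rewrite ?mul0r ?mulr0.
Qed.

Lemma Jtens_inj ii t t' : t \in Jt ii -> t' \in Jt ii -> Qm ii t = Qm ii t' -> t = t'.
Proof.
move=> tJ tJ' E; apply: (@Qm_eq (size ii)); rewrite ?Jtens_tpow // => jj _.
by have [->//|ne] := eqVneq jj ii; rewrite !(@Qm_Jtens ii).
Qed.

Lemma Jtens_lift ii x : x \in prodsp (map JJ ii) -> exists2 t, t \in Jt ii & Qm ii t = x.
Proof.
elim: ii x => [|i ii IH] x.
  move=> /oneSP[c ->]; exists (c%:A); last by rewrite linearZ /= Qm1.
  by apply: rpredZ; rewrite -[1]tword_nil; apply: Jtens_word.
rewrite prodsp_cons => /mul_sumP[s [sP ->]].
elim: s sP => [|q s IHs] sP.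
  by exists 0; [apply: rpred0|rewrite linear0 big_nil].
have [|t tJ tE] := IHs; first by move=> q' q's; apply: sP; rewrite inE q's orbT.
have [q1 /IH[u uJ uE]] := sP q (mem_head _ _).
exists (tvec (jin i q.1) * u + t).
  by rewrite rpredD // Jtens_cons // jin_hpart.
by rewrite linearD big_cons /= Qm_vec jin_same // uE tE.
Qed.

(** The degree [a] is distributed in all ways between the first factor and the rest, and the
    preimages of the homogeneous parts are added. *)
Lemma Jtens_lift_graded ii x a : x \in prodsp (map JJ ii) ->
  exists t, [/\ t \in Jt ii, t \in gtens Gr (size ii) (sumn ii, a%:Z) &
                Qm ii t = adams Vdir a x].
Proof.
elim: ii x a => [|i ii IH] x a.
  move=> /oneSP[c ->]; have [->|a0] := eqVneq a 0%N.
    exists (c%:A); split; last by rewrite !linearZ /= Qm1 adams1.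
      by apply: rpredZ; rewrite -[1]tword_nil; apply: Jtens_word.
    by apply/rpredZ/(gtens0 Gr).
  exists 0; split; rewrite ?rpred0 // linear0 linearZ /= adams1 (negbTE a0).
  by rewrite scaler0.
rewrite prodsp_cons => /mul_sumP[s [sP ->]].
elim: s sP => [|q s IHs] sP.
  by exists 0; split; rewrite ?rpred0 // big_nil !linear0.
have [|t [tJ tG tE]] := IHs; first by move=> q' q's; apply: sP; rewrite inE q's orbT.
have [q1 q2] := sP q (mem_head _ _).
have [u uP] := choice (fun d => IH q.2 d q2).
exists (\sum_(e < a.+1) tvec (jin i (adams Vdir e q.1)) * u (a - e)%N + t); split.
- rewrite rpredD // rpred_sum // => e _; have [uJ _ _] := uP (a - e)%N.
  by rewrite Jtens_cons // jin_hpart.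
- rewrite rpredD // rpred_sum // => e _; have [_ uG _] := uP (a - e)%N.
  have -> : (sumn (i :: ii), a%:Z) = (i, (e : nat)%:Z) + (sumn ii, (a - e)%N%:Z).
    by congr (_, _); rewrite -[RHS]PoszD subnKC // -ltnS.
  rewrite -[size (i :: ii)]add1n; apply: gtens_mul uG; apply: gtens1.
  by apply: jin_Jgr; [apply: graded_J|apply: adams_mem].
- rewrite linearD linear_sum big_cons linearD /= tE adams_mul; congr (_ + _).
  apply: eq_bigr => e _; have [_ _ uE] := uP (a - e)%N.
  by rewrite Qm_vec jin_same ?uE //; apply: graded_J.
Qed.

(** [Jprod] reads each letter in its own degree. On homogeneous letters this is the sum of all
    components, which is linear in the letter, so [Jprod] is the multiplicative extension of that
    sum. *)
Lemma Jprod_Jtens ii t : t \in Jt ii -> Jprod Vg t = Qm ii t.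
Proof.
pose s0 (c : JS) n := \sum_(i < n) Jcomp c i.
have s0E c : exists y, exists n, forall m, (n <= m)%N -> s0 c m = y.
  have [n nP] := Jcomp_bound c; exists (s0 c n), n => m nm; rewrite /s0.
  rewrite -!(big_mkord xpredT (fun i => Jcomp c i)) (big_cat_nat (n := n)) //=.
  rewrite [X in _ + X]big1_seq ?addr0 // => i.
  by rewrite mem_index_iota => /andP[_ /andP[/nP]].
have [s sP] := choice s0E.
have ls : linear s.
  move=> a c d; have [n1 h1] := sP c; have [n2 h2] := sP d.
  have [n3 h3] := sP (a *: c + d); pose m := maxn n3 (maxn n1 n2).
  rewrite -(h1 m) ?(leq_trans (leq_maxl _ _) (leq_maxr _ _)) //.
  rewrite -(h2 m) ?(leq_trans (leq_maxr _ _) (leq_maxr _ _)) //.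
  rewrite -(h3 m) ?leq_maxl // /s0 scaler_sumr -big_split.
  by apply: eq_bigr => i _; rewrite JcompP.
have s1 p c : c \in H p -> s c = Jcomp c p.
  move=> /hpartP c0; have [n h] := sP c.
  rewrite -(h (maxn n p.+1)) ?leq_maxl // /s0.
  have pm : (p < maxn n p.+1)%N by rewrite leq_max ltnSn orbT.
  rewrite (bigD1 (Ordinal pm)) //= big1 ?addr0 // => i /negP ip.
  by apply: c0; apply/negP => /eqP e; case: ip; apply/eqP/val_inj.
have [L [L1 L2]] := @talg_fold _ JS T (fun c x => s c * x) 1
  (fun x a u v => etrans (congr1 ( *%R^~ x) (ls a u v)) (mulr_linearl x a (s u) (s v)))
  (fun c => mulr_linearr (s c)).
have LE : @Jprod _ _ Vg R =1 L.
  rewrite /Jprod; apply: (hliftE Jgr_direct); elim=> [|w ws IH] wsH.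
    by rewrite /hword !big_nil.
  by have /hom_cons[wH /IH E] := wsH; rewrite hword_cons L2 E big_cons (s1 w.1).
rewrite LE; move: t; apply: JtensP => [|a cs y csH yE]; first by rewrite !linear0.
rewrite !linearP yE; congr (_ *: _ + _).
elim: cs ii csH {y yE} => [|c cs IH] [|i ii] //=; first by rewrite tword_nil L1 Qm1.
by move=> /andP[cH /IH E]; rewrite tword_cons L2 Qm_vec E (s1 i).
Qed.

End JSum.

(** * The coproducts *)

Section Coproducts.
Variables (k : fieldType) (V : lmodType k) (Vg : nat -> submodClosed V).
Local Notation T := (talg V).
Variable R : submodClosed T.
Hypothesis Vdir : direct_sum Vg.
Hypothesis Rrel : relation_space Vg R.
Local Notation Je := (J_even R).
Local Notation Vn := (tpow V).
Local Notation JS := (Jsum R).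
Local Notation JJ := (J R).
Local Notation Jt := (Jtens Vg R).
Local Notation Q := (@Qm k V R).

Lemma iota2P i j x : ~~ (odd i && odd j) -> x \in JJ (i + j) ->
  iota2 Vg R i j x \in Jt [:: i; j] /\ Q [:: i; j] (iota2 Vg R i j x) = x.
Proof.
move=> ij xJ; rewrite /iota2 (negbTE ij).
have [|t tJ tE] := @Jtens_lift _ _ _ _ Vdir Rrel [:: i; j] x.
  by rewrite !prodsp_cons mulS1; apply: (J_split Rrel).
set P := (fun _ : talg JS => _); have [] : P (xget 0 P).
  by apply: xgetPex; exists t; split=> //; rewrite (Jprod_Jtens Vdir Rrel tJ).
by move=> uJ; rewrite (Jprod_Jtens Vdir Rrel uJ).
Qed.

(** Writes partial sums with left factors in the $V^{(N-2)}$; the augmentation of the left factors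
    then keeps the summand $N = 2$ alone. *)
Lemma cmp_list a b x n : x \in Je (a + b).+1 -> exists s : seq (T * T),
  [/\ forall q, q \in s -> q.2 \in Jo R a ⊙ Jo R b,
      \sum_(N < n) (cmp R (a + b) x)`_N = \sum_(q <- s) q.1 * q.2 &
      (if (2 < n)%N then (cmp R (a + b) x)`_2 else 0) =
        \sum_(q <- s) tlen 0 q.1 * q.2].
Proof.
move=> xJ; elim: n => [|n [s [s1 s2 s3]]].
  by exists [::]; split=> //; rewrite ?big_ord0 big_nil.
rewrite big_ord_recr /= s2 ltnS.
have [n2|n2] := ltnP n 2.
  exists s; rewrite (cmp_small Rrel xJ n2) addr0; split=> //.
  by rewrite -s3 ltnNge (ltnW n2).
have [_ /(_ n)/(Dsp_Jo2 Rrel n2)/mul_sumP[t [tP tE]]] := cmpP xJ.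
exists (s ++ t); rewrite !big_cat /= -s3 -tE; split=> //.
  by move=> q; rewrite mem_cat => /orP[/s1|/tP[]].
rewrite big_seq (eq_bigr (fun q => if (n == 2)%N then q.1 * q.2 else 0)); last first.
  move=> q /tP[q1 _]; rewrite (tlen_tpow _ q1).
  have -> : (n - 2 == 0)%N = (n == 2)%N by lia.
  by case: eqP => _; rewrite ?mul0r.
rewrite -big_seq; case: (n =P 2%N) => [n2'|n2'].
  by rewrite -tE n2' ltnn add0r.
by rewrite big1 // addr0; have -> : (2 < n)%N by lia.
Qed.

Lemma Jo_prod a b x : x \in Je (a + b).+1 -> x \in T_all V ⊙ (Jo R a ⊙ Jo R b).
Proof.
move=> xJ; have [n /(_ n (leqnn n)) xE] := cmp_sum xJ.
have [s [s1 s2 _]] := cmp_list n xJ; rewrite xE s2; apply: rpred_seq => q /s1 q2.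
by apply: mem_mul => //; apply: mem_T_all.
Qed.

Lemma lfree_JoJo a b : lfree (Jo R a ⊙ Jo R b).
Proof. by apply: lfree_mul; apply: (lfree_Jo Rrel). Qed.

Lemma Jtens_sum_lift ii (s : seq (T * T)) :
  (forall q, q \in s -> q.2 \in prodsp (map JJ ii)) ->
  exists u : seq (T * talg JS), (forall q, q \in u -> q.2 \in Jt ii) /\
    \sum_(q <- s) q.1 * q.2 = \sum_(q <- u) q.1 * Jprod Vg q.2.
Proof.
elim: s => [|q s IH] sP; first by exists [::]; rewrite !big_nil.
have [|u [uJ uE]] := IH; first by move=> q' q's; apply: sP; rewrite inE q's orbT.
have [t tJ tE] := Jtens_lift Vdir Rrel (sP _ (mem_head _ _)).
exists ((q.1, t) :: u); split=> [q'|]; first by rewrite inE => /predU1P[->|/uJ].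
by rewrite !big_cons uE /= (Jprod_Jtens Vdir Rrel tJ) tE.
Qed.

Lemma Q_mem ii t : t \in Jt ii -> Q ii t \in prodsp (map JJ ii).
Proof.
move: t; apply: JtensP => [|a cs y csH yJ]; first by rewrite linear0 rpred0.
rewrite linearP rpredL // {y yJ}.
elim: cs ii csH => [|c cs IH] [|i ii] //.
  by rewrite tword_nil Qm1 mem1.
move=> /andP[_ /IH h]; rewrite tword_cons Qm_vec.
have -> : prodsp (map JJ (i :: ii)) = JJ i ⊙ prodsp (map JJ ii).
  exact: prodsp_cons.
by apply: mem_mul => //; apply: Jcomp_mem.
Qed.

(** Two expressions of $x$ with right factors in $J_{2a+1} J_{2b+1}$ are equal as tensors, this
    product being left free. So the augmentation gives the same result on the chosen one and on the
    one coming from the decomposition. *)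
Lemma iota2_oddP a b x : x \in Je (a + b).+1 ->
  iota2 Vg R a.*2.+1 b.*2.+1 x \in Jt [:: a.*2.+1; b.*2.+1] /\
  Q [:: a.*2.+1; b.*2.+1] (iota2 Vg R a.*2.+1 b.*2.+1 x) = (cmp R (a + b) x)`_2.
Proof.
move=> xJ; have oo : odd a.*2.+1 && odd b.*2.+1 by rewrite /= !odd_double.
rewrite /iota2 oo; set ii := [:: a.*2.+1; b.*2.+1].
have JJE : prodsp (map JJ ii) = Jo R a ⊙ Jo R b.
  by rewrite /ii !prodsp_cons mulS1 !Jodd.
set P := (fun _ : talg JS => _); have [] : P (xget 0 P).
  apply: xgetPex; have /mul_sumP[s [sP xE]] := Jo_prod xJ.
  have [|u [uJ uE]] := @Jtens_sum_lift ii s; first by move=> q /sP[]; rewrite JJE.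
  by exists (\sum_(q <- u) taug q.1 *: q.2), u; rewrite xE.
set t := xget 0 P; move=> u [uJ xE tE]; split.
  by rewrite tE; apply: rpred_seq => q /uJ qJ; apply: rpredZ.
have [n nP] := cmp_sum xJ.
(* At least 3 terms, so that the one of index 2 is present. *)
have [s [s1 s2 s3]] := cmp_list (maxn n 3) xJ.
rewrite -(nP _ (leq_maxl n 3)) xE in s2; rewrite leq_maxr in s3.
rewrite s3 tE linear_sum.
pose v := [seq (q.1, Jprod Vg q.2) | q <- u] ++ [seq (- q.1, q.2) | q <- s].
have := @lfree_map _ _ _ (tlen 0) v (@lfree_JoJo a b).
rewrite !big_cat !big_map /=.
have E1 (f : {linear T -> T}) :
    \sum_(q <- s) f (- q.1) * q.2 = - \sum_(q <- s) f q.1 * q.2.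
  by rewrite -sumrN; apply: eq_bigr => q _; rewrite linearN mulNr.
rewrite E1 (E1 idfun) /= -s2 subrr => h.
apply/eqP; rewrite -subr_eq0; apply/eqP; rewrite -[RHS]h //; last first.
  move=> q; rewrite mem_cat => /orP[/mapP[q' /uJ q'J ->]|/mapP[q' /s1 q'J ->]] //=.
  by have := Q_mem q'J; rewrite (Jprod_Jtens Vdir Rrel q'J) JJE.
congr (_ - _); rewrite !big_seq; apply: eq_bigr => q /uJ qJ.
by rewrite linearZ /= (Jprod_Jtens Vdir Rrel qJ) tlen0 -scalerAl mul1r.
Qed.

Lemma map_JJ_odd ii : all odd ii -> map JJ ii = map (Jo R) (map half ii).
Proof.
by elim: ii => //= i ii IH /andP[oi /IH ->]; rewrite JE oi.
Qed.

Lemma all_odd_sum ii : all odd ii -> sumn ii = ((sumn (map half ii)).*2 + size ii)%N.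
Proof. by elim: ii => //= i ii IH /andP[oi /IH ->]; lia. Qed.

(** The definition allows any decomposition into the summands. Gathering the letters in front embeds
    the summands in $V^{(N)} J_{2j_1} \cdots J_{2j_n}$, where decompositions are unique, so the
    chosen one is that of [cmp]. *)
Lemma iota_oddP ii s x : all odd ii -> (2 < size ii)%N -> sumn (map half ii) = s ->
  x \in Je s.+1 ->
  iota_odd Vg R ii x \in Jt ii /\ Q ii (iota_odd Vg R ii x) = (cmp R s x)`_(size ii).
Proof.
move=> oii n2 iis xJ; rewrite /iota_odd; set n := size ii in n2 *.
have [c1 cD] := cmpP xJ.
set P := (fun _ : talg JS => _); have [] : P (xget 0 P).
  apply: xgetPex; have [|t tJ tE] := @Jtens_lift _ _ _ _ Vdir Rrel ii (cmp R s x)`_n.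
    have := cD n; rewrite (map_JJ_odd oii) => /(Dsp_Jo Rrel iis).
    by rewrite size_map leqnn subnn tpow0 mulS1; apply.
  exists t; split=> //; pose M := maxn n.+1 (size (cmp R s x)).
  exists M, (fun N => (cmp R s x)`_N); split=> [|N||]; first exact: leq_maxl.
  - apply/asboolP => ms [szE msN]; apply: (Dsp_br _ msN iis (cD N)).
    by rewrite size_map.
  - rewrite -{1}c1 (poly_at1 (leq_maxr n.+1 _)) -/M.
    rewrite -(big_mkord xpredT (fun i => (cmp R s x)`_i)).
    have M2 : (2 <= M)%N by rewrite leq_max; apply/orP; left; lia.
    (* The sum in the definition starts at 2; the coefficients of index 0 and 1 vanish. *)
    rewrite (big_cat_nat (n := 2)) //= big_nat_recl // big_nat1.
    by rewrite !(cmp_small Rrel xJ) // !add0r.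
  - by rewrite (Jprod_Jtens Vdir Rrel tJ).
set t := xget 0 P => tJ [M [xN [nM xD xE tE]]]; split=> //.
rewrite -(Jprod_Jtens Vdir Rrel tJ) tE.
pose p := \poly_(N < M) (if (2 <= N)%N then xN N else 0).
have <- : p = cmp R s x; last by rewrite coef_poly nM (ltnW n2).
have sub N : {subset iota_summand R ii N <= oneS V ⊙ Vn N ⊙ prodsp (map Je (map half ii))}.
  move=> y /asboolP h; rewrite mul1S.
  have : y \in br R (N :: nseq (size ii) 0%N) (map half ii).
    by apply: (h (N :: nseq (size ii) 0%N)); rewrite /= size_nseq sumn_nseq addn0.
  have -> // : br R (N :: nseq (size ii) 0%N) (map half ii) =
      Vn N ⊙ prodsp (map Je (map half ii)).
  elim: (ii) N {h} => [|i ii' IH] N; first by rewrite br1 mulS1.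
  transitivity (br R (N :: 0%N :: nseq (size ii') 0%N) (i./2 :: map half ii')) => //.
  by rewrite br_cons IH prodsp_cons tpow0 mul1S.
apply: (cmp_uniq xJ _ (@rfree_one k V) (A := prodsp (map Je (map half ii)))).
- rewrite poly_fam_at1 xE -(big_mkord xpredT (fun N => if (2 <= N)%N then xN N else 0)).
  have M2 : (2 <= M)%N by lia.
  rewrite (big_cat_nat (n := 2)) //= big1_seq ?add0r => [|i]; last first.
    by rewrite mem_index_iota => /andP[_ i2]; case: ltnP => //; lia.
  by rewrite !big_nat; apply: eq_bigr => i /andP[-> _].
- elim: (map half ii) => [|j js IH]; first exact: lfree_one.
  by rewrite prodsp_cons; apply: lfree_mul => //; apply: (lfree_Je Rrel).
- move=> N; rewrite coef_poly; case: ifP => _; last exact: rpred0.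
  by case: ifP => _; [apply/sub/xD|apply: rpred0].
- move=> N y /DspP yD; apply: sub; apply/asboolP => ms [szE msN].
  by apply: yD; rewrite ?size_map.
Qed.

(** The component of the coproduct of [c] in [J_(i_1) (x) ... (x) J_(i_n)],
    multiplied in [T(V)]. *)
Definition dval ii (c : JS) : T :=
  let s := sumn (map half ii) in
  if all odd ii then (cmp R s (Jcomp c s.*2.+2))`_(size ii)
  else if size ii == 2%N then Jcomp c (sumn ii) else 0.

Lemma Jcomp_even (c : JS) s : Jcomp c s.*2.+2 \in Je s.+1.
Proof. by rewrite -doubleS -Jeven; apply: Jcomp_mem. Qed.

Lemma cmp0 s : cmp R s 0 = 0.
Proof.
by rewrite -(cmp_dec Rrel (rpred0 _) (p := 0)) //; split=> [|N];
  rewrite ?horner0 ?coef0 ?rpred0.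
Qed.

Lemma fsum_bound (X : lmodType k) (F : nat -> X) n :
  (forall i, (n <= i)%N -> F i = 0) -> \sum_(i \in [set: nat]) F i = \sum_(i < n) F i.
Proof.
move=> F0; rewrite (fsbig_ord _ n F); apply/esym; apply: fsbig_widen => // i [_ /= ni].
by apply: F0; rewrite leqNgt; apply/negP.
Qed.

End Coproducts.

(** * Components of the coproducts *)

Section CoproductComponents.
Variables (k : fieldType) (V : lmodType k) (Vg : nat -> submodClosed V).
Local Notation T := (talg V).
Variable R : submodClosed T.
Hypothesis Vdir : direct_sum Vg.
Hypothesis Rrel : relation_space Vg R.
Local Notation JS := (Jsum R).
Local Notation Jt := (Jtens Vg R).
Local Notation Q := (@Qm k V R).
Local Notation Del := (JDelta Vg R).

(** Index of the component of [c] on which [dval ii c] depends; for odd indices it is $i_1 + \dots +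
    i_n + 2 - n$. *)
Definition src ii := if all odd ii then (sumn (map half ii)).*2.+2 else sumn ii.

Lemma src_odd ii : all odd ii -> src ii = (sumn ii + 2 - size ii)%N.
Proof. by move=> oi; rewrite /src oi (all_odd_sum oi); lia. Qed.
Lemma src2 i j : src [:: i; j] = (i + j)%N.
Proof. by rewrite /src /= andbT !addn0; case: ifP => // /andP[oi oj]; lia. Qed.

Lemma dval0 ii (c : JS) : Jcomp c (src ii) = 0 -> dval ii c = 0.
Proof.
rewrite /src /dval; case: ifP => _ c0; first by rewrite c0 (cmp0 Rrel) coef0.
by case: ifP.
Qed.

Lemma iota2_dval (c : JS) l j :
  iota2 Vg R l j (Jcomp c (l + j)) \in Jt [:: l; j] /\
  Q [:: l; j] (iota2 Vg R l j (Jcomp c (l + j))) = dval [:: l; j] c.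
Proof.
rewrite /dval /= andbT addn0; case: ifP => [/andP[ol oj]|/negbT oo].
  have [a lE] : exists a, (l = a.*2.+1)%N by exists l./2; lia.
  have [b jE] : exists b, (j = b.*2.+1)%N by exists j./2; lia.
  rewrite lE jE ?addn0 /= !uphalf_double ?addn0.
  have -> : (a.*2.+1 + b.*2.+1 = (a + b).*2.+2)%N by lia.
  by apply: (iota2_oddP Vdir Rrel); apply: Jcomp_even.
rewrite ?addn0; apply: (iota2P Vdir Rrel) => //; exact: Jcomp_mem.
Qed.

Lemma iota_odd_dval (c : JS) ii i : all odd ii -> (2 < size ii)%N ->
  (sumn ii + 2 - size ii = i)%N ->
  iota_odd Vg R ii (Jcomp c i) \in Jt ii /\
  Q ii (iota_odd Vg R ii (Jcomp c i)) = dval ii c.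
Proof.
move=> oii n2 <-; rewrite /dval oii.
have -> : (sumn ii + 2 - size ii = (sumn (map half ii)).*2.+2)%N.
  by rewrite (all_odd_sum oii); lia.
by apply: (iota_oddP Vdir Rrel) => //; apply: Jcomp_even.
Qed.

Lemma Jtens_zero ii t : t \in Jt ii -> Q ii t = 0 -> t = 0.
Proof.
move=> tJ t0; apply: (Jtens_inj Vdir Rrel tJ); first exact: rpred0.
by rewrite t0 linear0.
Qed.

Definition iotas n (c : JS) i : talg JS :=
  if n is 2 then \sum_(l < i.+1) iota2 Vg R l (i - l) (Jcomp c i)
  else \sum_(ii : n.-tuple 'I_(i + n) |
               all (fun l : 'I_(i + n) => odd l) ii &&
               (\sum_(l <- ii) l == i + n - 2)%N)
             iota_odd Vg R [seq nat_of_ord l | l <- ii] (Jcomp c i).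

Arguments iotas : simpl never.

Lemma Del_iotas n c : (2 <= n)%N -> Del n c = \sum_(i \in [set: nat]) iotas n c i.
Proof. by case: n => [|[|[|n]]]. Qed.

Lemma tuple_cond i n (ii : n.-tuple 'I_(i + n)) : (2 < n)%N ->
  all (fun l : 'I_(i + n) => odd l) ii && (\sum_(l <- ii) l == i + n - 2)%N ->
  let jj := [seq nat_of_ord l | l <- ii] in
  [/\ all odd jj, size jj = n & (sumn jj + 2 - size jj = i)%N].
Proof.
move=> n2 /andP[oi /eqP si]; rewrite /= all_map size_map size_tuple; split=> //.
have -> : sumn [seq nat_of_ord l | l <- ii] = (\sum_(l <- ii) l)%N.
  by rewrite sumnE big_map.
rewrite si; lia.
Qed.

Lemma iotas_tpow n c i : (2 <= n)%N -> iotas n c i \in tpow JS n.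
Proof.
case: n => [|[|[|n]]] // _; apply: rpred_sum => l.
  move=> _; have := (iota2_dval c l (i - l)).1; rewrite subnKC -1?ltnS //.
  exact: Jtens_tpow.
move=> /tuple_cond[] // oi sz iE.
have := (iota_odd_dval c oi _ iE).1; rewrite {1}sz => /(_ isT) /Jtens_tpow.
by rewrite sz.
Qed.

Lemma iotas0 n c i : (2 <= n)%N -> Jcomp c i = 0 -> iotas n c i = 0.
Proof.
case: n => [|[|[|n]]] // _ c0; rewrite /iotas big1 // => l.
  move=> _; have := iota2_dval c l (i - l); rewrite subnKC -1?ltnS // => -[tJ tE].
  apply: (Jtens_zero tJ); rewrite tE dval0 //.
  by rewrite src2 subnKC // -ltnS.
move=> /tuple_cond[] // oi sz iE.
have [|tJ tE] := iota_odd_dval c oi _ iE; first by rewrite sz.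
by apply: (Jtens_zero tJ); rewrite tE dval0 // src_odd // iE.
Qed.

(** Distinct summands lie in distinct components, so [kk] sees at most one of them. *)
Lemma Q_iotas n c i kk : (2 <= n)%N -> size kk = n ->
  Q kk (iotas n c i) = if i == src kk then dval kk c else 0.
Proof.
case: n => [|[|n]] // _ szk; case: n szk => [|n] szk.
  case: kk szk => [|k0 [|k1 [|//]]] // _.
  rewrite src2 /iotas linear_sum /=.
  have Ql (l : 'I_i.+1) : Q [:: k0; k1] (iota2 Vg R l (i - l) (Jcomp c i)) =
      if ((l : nat) == k0) && (i - l == k1)%N then dval [:: k0; k1] c else 0.
    have := iota2_dval c l (i - l); rewrite subnKC -1?ltnS // => -[tJ tE].
    case: ifP => [/andP[/eqP <- /eqP <-] //|/negbT ne].
    apply: (Qm_Jtens Vdir Rrel tJ); apply: contra ne => /eqP[-> ->].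
    by rewrite !eqxx.
  rewrite (eq_bigr _ (fun l _ => Ql l)) -big_mkcond.
  have [ik|ik] := eqVneq i (k0 + k1)%N.
    have ki : (k0 < i.+1)%N by lia.
    rewrite (big_pred1 (Ordinal ki)) // => l /=.
    rewrite -val_eqE /=; apply/andP/eqP => [[/eqP//]|->].
    by rewrite eqxx; split=> //; apply/eqP; lia.
  by rewrite big_pred0 // => l; apply/negP => /andP[/eqP e1 /eqP e2];
    have := ltn_ord l; move/eqP: ik; lia.
have Ql (ii : n.+3.-tuple 'I_(i + n.+3)) :
  all (fun l : 'I_(i + n.+3) => odd l) ii && (\sum_(l <- ii) l == i + n.+3 - 2)%N ->
  Q kk (iota_odd Vg R [seq nat_of_ord l | l <- ii] (Jcomp c i)) =
  if [seq nat_of_ord l | l <- ii] == kk then dval kk c else 0.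
  move=> /tuple_cond[] // oi sz iE.
  have [|tJ tE] := iota_odd_dval c oi _ iE; first by rewrite sz.
  case: eqP => [<- //|ne]; apply: (Qm_Jtens Vdir Rrel tJ).
  by apply/eqP => e; apply: ne.
rewrite /iotas linear_sum (eq_bigr _ Ql) -big_mkcondr.
have srcE : all odd kk -> (sumn kk + 2 - size kk = src kk)%N.
  by move=> okk; rewrite src_odd.
have [okk|nokk] := boolP (all odd kk); last first.
  rewrite big_pred0 => [|ii]; first by case: eqP => // _; rewrite /dval (negbTE nokk) szk.
  apply/negP => /andP[/tuple_cond[] // oi _ _ /eqP e].
  by rewrite e (negbTE nokk) in oi.
have [ik|ik] := eqVneq i (src kk); last first.
  rewrite big_pred0 // => ii; apply/negP => /andP[/tuple_cond[] // oi _ iE /eqP e].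
  by move/eqP: ik; apply; rewrite -srcE // -iE e.
(* No index exceeds the sum, hence the bound imposed on the entries of the tuples excludes
   nothing. *)
have kb l : l \in kk -> (l < i + n.+3)%N.
  move=> lk; have : (l <= sumn kk)%N.
    by rewrite sumnE (big_rem l) //= leq_addr.
  by have := srcE okk; rewrite -ik szk; lia.
have [t tE] : exists t : n.+3.-tuple 'I_(i + n.+3), [seq nat_of_ord l | l <- t] = kk.
  have i0 : (0 < i + n.+3)%N by lia.
  pose t := [seq insubd (Ordinal i0) l | l <- kk].
  have szt : size t == n.+3 by rewrite size_map szk.
  exists (Tuple szt); rewrite /= -map_comp -[RHS]map_id; apply/eq_in_map => l lk /=.
  by rewrite val_insubd kb.
have sk : (sumn kk == i + n.+3 - 2)%N.
  by have := srcE okk; have := all_odd_sum okk; rewrite -ik szk; lia.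
rewrite (big_pred1 t) // => ii /=; apply/andP/eqP => [[_ /eqP e]|->].
  by apply/val_inj/(inj_map val_inj); rewrite /= e tE.
rewrite tE eqxx; split=> //; move: okk; rewrite -{1}tE all_map => ->.
by have -> : (\sum_(l <- t) l = sumn kk)%N by rewrite -tE sumnE big_map.
Qed.

Lemma dval_linear ii : linear (@dval k V R ii).
Proof.
move=> a c d; rewrite /dval; case: ifP => _; last first.
  by case: ifP => _ //; rewrite scaler0 addr0.
set s := sumn _.
have -> : cmp R s (Jcomp (a *: c + d) s.*2.+2) =
    (a%:A)%:P * cmp R s (Jcomp c s.*2.+2) + cmp R s (Jcomp d s.*2.+2).
  have [c1 cD] := cmpP (Jcomp_even c s); have [d1 dD] := cmpP (Jcomp_even d s).
  apply/esym/cmp_dec; [exact: Rrel|exact: Jcomp_even|split=> [|N]].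
    by rewrite hornerD hornerCM c1 d1 (JcompP a c d) -scalerAl mul1r.
  by rewrite coefD coefCM -scalerAl mul1r rpredL.
by rewrite coefD coefCM -scalerAl mul1r.
Qed.

Lemma Del_sum n c : (2 <= n)%N -> exists m, forall m', (m <= m')%N ->
  Del n c = \sum_(i < m') iotas n c i.
Proof.
move=> n2; have [m cm] := Jcomp_bound c; exists m => m' mm'.
rewrite Del_iotas //; apply: fsum_bound => i m'i; apply: iotas0 => //.
by apply: cm; apply: leq_trans m'i.
Qed.

Lemma Del_tpow n c : Del n c \in tpow JS n.
Proof.
case: n => [|[|n]]; try exact: rpred0.
have [m /(_ m (leqnn m)) ->] := Del_sum c (isT : (2 <= n.+2)%N).
by apply: rpred_sum => i _; apply: iotas_tpow.
Qed.

(** The coproducts are determined by these components, and the latter live in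
    [T(V)]. *)
Lemma Q_Del n c ii : size ii = n -> Q ii (Del n c) = dval ii c.
Proof.
case: n => [|[|n]] szi; last 1 first.
- have [m mP] := Del_sum c (isT : (2 <= n.+2)%N).
  rewrite (mP _ (leq_maxl m (src ii).+1)) linear_sum /=.
  have im : (src ii < maxn m (src ii).+1)%N by rewrite leq_max ltnSn orbT.
  rewrite (bigD1 (Ordinal im)) //= Q_iotas // eqxx big1 ?addr0 // => i /negP ne.
  rewrite Q_iotas //; case: eqP => // e; case: ne; exact/eqP/val_inj.
(* In arity 0 or 1 the coproduct is zero, and so are the coefficients of index less than 2. *)
- by case: ii szi => // _; rewrite linear0 /dval /= (cmp_small Rrel) ?Jcomp_even.
case: ii szi => [|i [|//]] // _; rewrite linear0 /dval /= andbT.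
by case: ifP => // _; rewrite (cmp_small Rrel) ?Jcomp_even.
Qed.

(** The maps iota are given by chosen values; linearity is inherited from the components, which are
    unique. *)
Lemma Del_linear n : linear (Del n).
Proof.
move=> a c d; apply: (Qm_eq Rrel (n := n)); rewrite ?rpredL ?Del_tpow // => ii szi.
by rewrite linearP !Q_Del // dval_linear.
Qed.

End CoproductComponents.

(** * The A-infinity identity *)

Section Identities.
Variables (k : fieldType) (V : lmodType k) (Vg : nat -> submodClosed V).
Local Notation T := (talg V).
Variable R : submodClosed T.
Hypothesis Vdir : direct_sum Vg.
Hypothesis Rrel : relation_space Vg R.
Local Notation Je := (J_even R).
Local Notation JS := (Jsum R).
Local Notation JJ := (J R).
Local Notation Gr := (Jgr Vg R).
Local Notation Jt := (Jtens Vg R).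
Local Notation Q := (@Qm k V R).
Local Notation Del := (JDelta Vg R).
Local Notation Gd := (Jgr_direct Vdir Rrel).
Local Notation sg := (sgn Gd).
Local Notation hpr := (hproj Gd).

Lemma Q_sgn d ii A : size A = size ii ->
  Q ii (tword (map (sg d) A)) = (-1) ^+ (d * sumn ii) *: Q ii (tword A).
Proof.
elim: A ii => [|c A IH] [|i ii] //= sz; first by rewrite muln0 scale1r.
rewrite !tword_cons !Qm_vec IH; last by case: sz.
by rewrite Jcomp_sgn -scalerAl -scalerAr scalerA mulnDr exprD.
Qed.

(** The [ii1 ++ mid ++ ii2]-component of [(id (x) Delta (x) id) z], without sign. *)
Lemma Q_insert r t s ii1 mid ii2 :
  size ii1 = r -> size mid = s -> size ii2 = t ->
  {E : {linear talg JS -> T} |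
    (forall z, z \in tpow JS (r + 1 + t) ->
       Q (ii1 ++ mid ++ ii2) (insert Gr r 1 t s (fun cs => Del s cs`_0) z) =
       (-1) ^+ (s * sumn ii1) *: E z) /\
    forall A c B, size A = r -> size B = t ->
      E (tword (A ++ c :: B)) = Q ii1 (tword A) * dval mid c * Q ii2 (tword B)}.
Proof.
move=> s1 sm s2; have [L [LI LE]] := insert1E Gd r t s (Del_linear Vdir Rrel s).
pose e : k := (-1) ^+ (s * sumn ii1).
have ee : e * e = 1 by rewrite -expr2 sqrr_sign.
have [E EE] : {E : {linear talg JS -> T} |
    forall z, E z = e *: Q (ii1 ++ mid ++ ii2) (L z)}.
  apply: linear_exists => a x y.
  by rewrite (linearP L) (linearP (@Qm k V R _)) scalerDr !scalerA mulrC.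
exists E; split=> [z _|A c B rA tB]; first by rewrite EE LI scalerA ee scale1r.
rewrite EE LE // catA Qm_cat; last first.
  rewrite size_cat tpowD mem_mul // ?sm ?Del_tpow //.
  by rewrite s1 -rA -(size_map (sg s)) tpow_word.
rewrite Qm_cat; last by rewrite s1 -rA -(size_map (sg s)) tpow_word.
rewrite (Q_Del Vdir Rrel) // Q_sgn ?s1 // -!scalerAl scalerA -/e ee.
by rewrite scale1r.
Qed.

Definition proj_word ii (A : seq JS) := [seq hpr q.2 q.1 | q <- zip A ii].

Lemma proj_word_hpart ii A : size A = size ii ->
  all2 (fun c i => c \in hpart Gr i) (proj_word ii A) ii.
Proof.
elim: A ii => [|c A IH] [|i ii] //= [sz].
by rewrite hproj_mem /= IH.
Qed.

Lemma Q_proj_word ii A : size A = size ii -> Q ii (tword (proj_word ii A)) = Q ii (tword A).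
Proof.
elim: A ii => [|c A IH] [|i ii] //= [sz].
by rewrite !tword_cons !Qm_vec IH // (Jcomp_hproj Vdir Rrel) eqxx.
Qed.

(** By freeness a tensor in the component [ii] is zero as soon as its product in $T(V)$ is; a map
    that sees only this component cannot detect [z]. *)
Lemma Q_support ii (X : lmodType k) (L : {linear talg JS -> X}) z :
  (forall A, size A = size ii -> L (tword A) = L (tword (proj_word ii A))) ->
  z \in tpow JS (size ii) -> Q ii z = 0 -> L z = 0.
Proof.
move=> LP zn.
have [z' z'J [zQ zL]] : exists2 z', z' \in Jt ii & Q ii z' = Q ii z /\ L z = L z'.
  move: z zn; apply: tpow_ind => [|a A y szA [y' y'J [yQ yL]]].
    by exists 0; [apply: rpred0|split].
  exists (a *: tword (proj_word ii A) + y').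
    by rewrite rpredL // Jtens_word // proj_word_hpart.
  by rewrite !linearP yQ yL Q_proj_word // LP.
rewrite zL -zQ => z0.
by rewrite (Jtens_zero Vdir Rrel z'J z0) linear0.
Qed.

Lemma dval_ext ii (c d : JS) : Jcomp c (src ii) = Jcomp d (src ii) ->
  dval ii c = dval ii d.
Proof. by rewrite /src /dval; case: ifP => _ ->. Qed.

Lemma proj_word_cat ii jj A B : size A = size ii ->
  proj_word (ii ++ jj) (A ++ B) = proj_word ii A ++ proj_word jj B.
Proof. by move=> sz; rewrite /proj_word zip_cat // map_cat. Qed.

Definition term r s t ii (c : JS) : T :=
  Q ii (insert Gr r 1 t s (fun cs => Del s cs`_0) (Del (r + 1 + t)%N c)).

Lemma term_dval0 r s t ii1 mid ii2 c :
  size ii1 = r -> size mid = s -> size ii2 = t -> (forall d : JS, dval mid d = 0) ->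
  term r s t (ii1 ++ mid ++ ii2) c = 0.
Proof.
move=> s1 sm s2 m0; have [E [EE EW]] := Q_insert s1 sm s2.
rewrite /term EE ?Del_tpow //.
suff -> : E (Del (r + 1 + t)%N c) = 0 by rewrite scaler0.
move: (Del _ c) (Del_tpow Vdir Rrel (r + 1 + t) c).
apply: (tpow_linear_ext (g := \0)) => cs /word_split[A [c' [B [rA tB ->]]]].
by rewrite EW // m0 mulr0 mul0r.
Qed.

(** For indices that are not both odd the inner $\Delta_2$ is an inclusion, so it leaves products in
    $T(V)$ unchanged and only merges two indices in the label of the component. *)
Lemma term_coassoc r t ii1 i j ii2 c :
  size ii1 = r -> size ii2 = t -> ~~ (odd i && odd j) ->
  term r 2 t (ii1 ++ [:: i; j] ++ ii2) c = dval (ii1 ++ (i + j)%N :: ii2) c.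
Proof.
move=> s1 s2 ij; have [E [EE EW]] := @Q_insert r t 2 ii1 [:: i; j] ii2 s1 erefl s2.
rewrite /term EE ?Del_tpow // mul2n -signr_odd odd_double scale1r.
have szi : size (ii1 ++ (i + j)%N :: ii2) = (r + 1 + t)%N.
  by rewrite size_cat /= s1 s2; lia.
rewrite -(Q_Del Vdir Rrel _ szi).
move: (Del _ c) (Del_tpow Vdir Rrel (r + 1 + t) c).
apply: tpow_linear_ext => cs /word_split[A [c' [B [rA tB ->]]]].
rewrite EW // tword_cat Qm_cat ?s1 -?rA ?tpow_word // tword_cons Qm_vec mulrA.
by rewrite {1}/dval /= andbT (negbTE ij) addn0.
Qed.

(** The inner operation starts in the even degree [src mid], and an outer coproduct with at least
    three factors has no component with an even index. *)
Lemma term_odd0 r s t ii1 mid ii2 c :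
  size ii1 = r -> size mid = s -> size ii2 = t -> all odd mid -> (3 <= r + 1 + t)%N ->
  term r s t (ii1 ++ mid ++ ii2) c = 0.
Proof.
move=> s1 sm s2 om n3; have [E [EE EW]] := Q_insert s1 sm s2.
rewrite /term EE ?Del_tpow //.
suff -> : E (Del (r + 1 + t)%N c) = 0 by rewrite scaler0.
pose ii := ii1 ++ src mid :: ii2.
have szi : size ii = (r + 1 + t)%N by rewrite size_cat /= s1 s2; lia.
apply: (@Q_support ii).
- rewrite szi => cs /word_split[A [c' [B [rA tB ->]]]].
  have sA : size A = size ii1 by rewrite rA.
  have sB : size B = size ii2 by rewrite tB.
  rewrite proj_word_cat // EW // -[proj_word (_ :: _) _]/(_ :: proj_word ii2 B) EW.
  + rewrite !Q_proj_word //; congr (_ * _ * _); apply: dval_ext.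
    by rewrite (Jcomp_hproj Vdir Rrel) eqxx.
  + by rewrite size_map size_zip sA s1 minnn.
  + by rewrite size_map size_zip sB s2 minnn.
- by rewrite szi Del_tpow.
- rewrite (Q_Del Vdir Rrel) // /dval szi.
  have -> : all odd ii = false.
    by rewrite all_cat /= /src om /= odd_double andbF.
  by case: eqP => // e; move: n3; rewrite e.
Qed.

Lemma tpow2_list (z : talg JS) : z \in tpow JS 2 -> exists s : seq (JS * JS),
  z = \sum_(q <- s) tword [:: q.1; q.2].
Proof.
move: z; apply: tpow_ind => [|a [|c [|d [|//]]] y // _ [s ->]].
  by exists [::]; rewrite big_nil.
exists ((a *: c, d) :: s); rewrite big_cons /=; congr (_ + _).
have [h hE] : {h : {linear JS -> talg JS} | forall c, h c = tword [:: c; d]}.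
  by apply: linear_exists => b u v; rewrite (tword_multilinear [::]).
by rewrite -!hE linearZ.
Qed.

(** What remains of [Jcomp c (i + 2h + 2)] when a factor [J_i] is split off, on
    either side, and the complementary factor [J_(2h+2)] is decomposed. *)
Definition Xval i h s (c : JS) : T :=
  if odd i then (cmpo R (i./2 + h) (Jcomp c (i + h.*2.+2)))`_s
  else (cmp R (i./2 + h) (Jcomp c (i + h.*2.+2)))`_s.

Lemma J_comp_add i h (c : JS) : Jcomp c (i + h.*2.+2) \in
  if odd i then Jo R (i./2 + h).+1 else Je (i./2 + h).+1.
Proof.
have := Jcomp_mem c (i + h.*2.+2); rewrite JE oddD /= odd_double /= addbF.
by have -> : ((i + h.*2.+2)./2 = (i./2 + h).+1)%N by lia.
Qed.

Lemma dval_pair i j (c : JS) : ~~ (odd i && odd j) -> dval [:: i; j] c = Jcomp c (i + j).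
Proof. by move=> ij; rewrite /dval /= andbT (negbTE ij) addn0. Qed.

(** The sign comes from moving $\Delta_s$ past $J_i$. Apart from it, decomposing the right factors
    of the splitting in $J_i \otimes J_{2h+2}$ gives the decomposition of the whole element. *)
Lemma term_right i mid c : all odd mid ->
  term 1 (size mid) 0 (i :: mid) c =
  (-1) ^+ (size mid * i) *: Xval i (sumn (map half mid)) (size mid) c.
Proof.
move=> om; have [E [EE EW]] := @Q_insert 1 0 (size mid) [:: i] mid [::] erefl erefl erefl.
rewrite /term -[i :: mid]cats0 -[in LHS]cat1s -catA EE ?Del_tpow // [sumn _]/= addn0.
congr (_ *: _).
set h := sumn _.
have [s zE] := tpow2_list (Del_tpow Vdir Rrel 2 c).
have QE : \sum_(q <- s) Jcomp q.1 i * Jcomp q.2 h.*2.+2 = Jcomp c (i + h.*2.+2).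
  rewrite -dval_pair; last by rewrite /= odd_double andbF.
  rewrite -(Q_Del Vdir Rrel (n := 2)) // zE linear_sum; apply: eq_bigr => q _.
  by rewrite !tword_cons tword_nil !Qm_vec Qm1 mulr1.
rewrite -[Del _ c]/(Del 2 c) zE linear_sum.
have -> : \sum_(q <- s) E (tword [:: q.1; q.2]) =
    \sum_(q <- s) Jcomp q.1 i * (cmp R h (Jcomp q.2 h.*2.+2))`_(size mid).
  apply: eq_bigr => q _; rewrite (EW [:: q.1] q.2 [::]) // tword_nil Qm1 mulr1.
  by rewrite tword1 -[tvec _]mulr1 Qm_vec Qm1 mulr1 /dval om.
pose t := [seq (Jcomp q.1 i, Jcomp q.2 h.*2.+2) | q <- s].
transitivity ((\sum_(q <- t) q.1%:P * cmp R h q.2)`_(size mid)).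
  by rewrite coef_lmulp big_map.
have tE : \sum_(q <- t) q.1 * q.2 = Jcomp c (i + h.*2.+2) by rewrite big_map.
have tJ q : q \in t -> q.1 \in JJ i /\ q.2 \in Je h.+1.
  by move=> /mapP[q' _ ->]; split; [apply: Jcomp_mem|apply: Jcomp_even].
have cJ := J_comp_add i h c; rewrite /Xval -tE; rewrite -tE in cJ.
case: ifP cJ => oi cJ.
  rewrite (cmpo_lmul Rrel _ cJ) // => q /tJ[]; rewrite JE oi => q1 q2.
  by split=> //; apply: Jo_subl.
by rewrite (cmp_lmul Rrel _ cJ) // => q /tJ[]; rewrite JE oi.
Qed.

Lemma term_left i mid c : all odd mid ->
  term 0 (size mid) 1 (mid ++ [:: i]) c = Xval i (sumn (map half mid)) (size mid) c.
Proof.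
move=> om; have [E [EE EW]] := @Q_insert 0 1 (size mid) [::] mid [:: i] erefl erefl erefl.
rewrite /term -[mid ++ _]cat0s EE ?Del_tpow // [sumn _]/= muln0 scale1r.
set h := sumn _.
have [s zE] := tpow2_list (Del_tpow Vdir Rrel 2 c).
have QE : \sum_(q <- s) Jcomp q.1 h.*2.+2 * Jcomp q.2 i = Jcomp c (h.*2.+2 + i).
  rewrite -dval_pair; last by rewrite /= odd_double.
  rewrite -(Q_Del Vdir Rrel (n := 2)) // zE linear_sum; apply: eq_bigr => q _.
  by rewrite !tword_cons tword_nil !Qm_vec Qm1 mulr1.
rewrite -[Del _ c]/(Del 2 c) zE linear_sum.
have -> : \sum_(q <- s) E (tword [:: q.1; q.2]) =
    \sum_(q <- s) (cmp R h (Jcomp q.1 h.*2.+2))`_(size mid) * Jcomp q.2 i.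
  apply: eq_bigr => q _; rewrite (EW [::] q.1 [:: q.2]) // tword_nil Qm1 mul1r.
  by rewrite tword1 -[tvec _]mulr1 Qm_vec Qm1 mulr1 /dval om.
pose t := [seq (Jcomp q.1 h.*2.+2, Jcomp q.2 i) | q <- s].
transitivity ((\sum_(q <- t) cmp R h q.1 * q.2%:P)`_(size mid)).
  by rewrite coef_rmulp big_map.
have tE : \sum_(q <- t) q.1 * q.2 = Jcomp c (i + h.*2.+2) by rewrite big_map addnC.
have tJ q : q \in t -> q.1 \in Je h.+1 /\ q.2 \in JJ i.
  by move=> /mapP[q' _ ->]; split; [apply: Jcomp_even|apply: Jcomp_mem].
have cJ := J_comp_add i h c; rewrite /Xval -tE [(i./2 + h)%N]addnC.
rewrite -tE [(i./2 + h)%N]addnC in cJ.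
case: ifP cJ => oi cJ.
  rewrite (cmpo_rmul Rrel _ cJ) // => q /tJ[q1]; rewrite JE oi => q2.
  by split=> //; apply: Jo_subr.
by rewrite (cmp_rmul Rrel _ cJ) // => q /tJ[]; rewrite JE oi.
Qed.
End Identities.

Lemma sum_ord_if (X : nmodType) n m (F : nat -> X) :
  \sum_(i < n) (if (i : nat) == m then F i else 0) = if (m < n)%N then F m else 0.
Proof.
case: ltnP => mn; last first.
  by rewrite big1 // => i _; case: eqP => // im; have := ltn_ord i; lia.
rewrite (bigD1 (Ordinal mn)) //= eqxx big1 ?addr0 // => i /negP im.
by case: eqP => // e; case: im; apply/eqP/val_inj.
Qed.

(** Inner arity 2 fits at $n-1$ places; inner arity $n-1$, with an outer $\Delta_2$, at two. For $n
    = 3$ both cases concern $s = 2$ and add up. *)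
Lemma triple_sum (X : nmodType) n (G : nat -> nat -> nat -> X) (A B : nat -> X) :
  (2 < n)%N ->
  (forall r s t, (0 < s)%N -> (r + s + t)%N = n ->
     G r s t = (if s == 2%N then A r else 0) + (if s == n.-1 then B r else 0)) ->
  \sum_(r < n.+1) \sum_(s < n.+1) \sum_(t < n.+1 | (0 < s)%N && (r + s + t == n)%N)
    G r s t = \sum_(r < n.-1) A r + (B 0%N + B 1%N).
Proof.
move=> n2 GE.
pose A' r := if (r < n.-1)%N then A r else 0.
pose B' r := if (r < 2)%N then B r else 0.
have inner r s : (r <= n)%N ->
   \sum_(t < n.+1 | (0 < s)%N && (r + s + t == n)%N) G r s t =
   (if s == 2%N then A' r else 0) + (if s == n.-1 then B' r else 0).
  move=> rn; case: (posnP s) => [->|s0].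
    rewrite big_pred0 //= add0r; case: eqP => // e; move: n2; lia.
  have [rs|rs] := leqP (r + s) n; last first.
    rewrite big_pred0 => [|t]; last by apply/negP => /andP[_ /eqP]; lia.
    rewrite /A' /B'; have [s2|_] := eqVneq s 2%N.
      have {}s2 : s = 2%N := s2.
      have -> : (r < n.-1)%N = false by lia.
      case: eqP => [sn|_]; last by rewrite addr0.
      have {}sn : s = n.-1 := sn.
      have h : (r < 2)%N = false by lia.
      by rewrite h addr0.
    case: eqP => [sn|_]; last by rewrite addr0.
    have {}sn : s = n.-1 := sn.
    have h : (r < 2)%N = false by lia.
      by rewrite h addr0.
  have tn : (n - r - s < n.+1)%N by lia.
  rewrite (big_pred1 (Ordinal tn)) /= => [|t]; last first.
    by apply/eqP/eqP => [e|->]; [apply/val_inj|]; move=> /=; lia.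
  rewrite (GE r s) //=; last by lia.
  rewrite /A' /B'; case: (eqVneq s 2%N) => [s2|_]; case: (eqVneq s n.-1) => [sn|_] //;
    try (have {}s2 : s = 2%N := s2); try (have {}sn : s = n.-1 := sn).
  - have -> : (r < n.-1)%N by lia.
    by have -> : (r < 2)%N by lia.
  - by have -> : (r < n.-1)%N by lia.
  - by have -> : (r < 2)%N by lia.
transitivity (\sum_(r < n.+1) (A' r + B' r)).
  apply: eq_bigr => r _; have rn : (r <= n)%N by rewrite -ltnS.
  rewrite (eq_bigr _ (fun (s : 'I_n.+1) _ => inner r s rn)).
  rewrite big_split /= (@sum_ord_if _ n.+1 2%N (fun=> A' r)).
  rewrite (@sum_ord_if _ n.+1 n.-1 (fun=> B' r)).
  have h1 : (2 < n.+1)%N by lia.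
  have h2 : (n.-1 < n.+1)%N by lia.
  by rewrite h1 h2.
rewrite big_split /=; congr (_ + _).
  rewrite (big_ord_widen n.+1 A); last by lia.
  by rewrite [RHS]big_mkcond.
transitivity (\sum_(r < n.+1) ((if (r : nat) == 0%N then B 0%N else 0) +
                             (if (r : nat) == 1%N then B 1%N else 0))).
  by apply: eq_bigr => -[[|[|r]] /= rn] _; rewrite /B' /= ?addr0 ?add0r.
rewrite big_split /= (@sum_ord_if _ n.+1 0%N (fun=> B 0%N)).
rewrite (@sum_ord_if _ n.+1 1%N (fun=> B 1%N)) /=.
by have h : (1 < n.+1)%N; [lia|rewrite h].
Qed.

(** * Cancellation of the signed terms in a fixed component *)

Section AooIdentity.
Variables (k : fieldType) (V : lmodType k) (Vg : nat -> submodClosed V).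
Local Notation T := (talg V).
Variable R : submodClosed T.
Hypothesis Vdir : direct_sum Vg.
Hypothesis Rrel : relation_space Vg R.
Local Notation JS := (Jsum R).
Local Notation Gd := (Jgr_direct Vdir Rrel).
Local Notation hsum := (fun ii => sumn (map half ii)).

Variables (ii : seq nat) (c : JS).
Local Notation n := (size ii).
Lemma term_Del1 r s t : (r + 1 + t = 1)%N -> term Vg r s t ii c = 0.
Proof.
move=> rt; rewrite /term rt.
have [r0 t0] : r = 0%N /\ t = 0%N by lia.
have [L [LI _]] := insert1E Gd r t s (Del_linear Vdir Rrel s).
by rewrite LI /= linear0 linear0.
Qed.

Lemma dval_not_odd jj (d : JS) : size jj != 2%N -> ~~ all odd jj -> dval jj d = 0.
Proof. by move=> s2 nj; rewrite /dval (negbTE s2) (negbTE nj). Qed.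

Hypothesis n3 : (2 < n)%N.

Definition merge r := take r ii ++ (nth 0 ii r + nth 0 ii r.+1)%N :: drop r.+2 ii.

(** Contribution of an inner $\Delta_2$ with an even index: for $s = 2$ the sign $(-1)^{rs+t}$ is
    $(-1)^t$, and $t = n-2-r$. *)
Definition Aval r : T :=
  if odd (nth 0%N ii r) && odd (nth 0%N ii r.+1) then 0
  else (-1) ^+ (n - 2 - r) *: dval (merge r) c.

(** Contribution of an outer $\Delta_2$. For [r = 0] the sign is $(-1)^t$ with $t = 1$; otherwise $r
    = 1$, $s = n-1$, and $(-1)^s$ is multiplied by the Koszul sign $(-1)^{si}$ of the first index
    $i$. *)
Definition Bval r : T :=
  if r is 0 then
    if all odd (take n.-1 ii) then
      - Xval (last 0%N ii) (hsum (take n.-1 ii)) n.-1 c else 0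
  else
    if all odd (behead ii) then
      (-1) ^+ (n.-1 * (head 0%N ii).+1) *:
      Xval (head 0%N ii) (hsum (behead ii)) n.-1 c else 0.

Arguments Bval : simpl never.
(** Inner indices that are not all odd require the inner coproduct to be $\Delta_2$; if they are all
    odd, the outer one acts on an even index and must be $\Delta_2$. *)
Lemma term_value r s t : (0 < s)%N -> (r + s + t)%N = n ->
  (-1) ^+ (r * s + t) *: term Vg r s t ii c =
  (if s == 2%N then Aval r else 0) + (if s == n.-1 then Bval r else 0).
Proof.
move=> s0 rst.
pose ii1 := take r ii; pose mid := take s (drop r ii); pose ii2 := drop (r + s) ii.
have iiE : ii = ii1 ++ mid ++ ii2.
  by rewrite /mid /ii2 addnC -drop_drop cat_take_drop cat_take_drop.
have s1 : size ii1 = r by rewrite size_takel //; lia.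
have sm : size mid = s by rewrite size_takel // size_drop; lia.
have s2 : size ii2 = t by rewrite size_drop; lia.
have AE : s = 2%N -> exists i j, [/\ mid = [:: i; j], nth 0%N ii r = i,
    nth 0%N ii r.+1 = j & merge r = ii1 ++ (i + j)%N :: ii2].
  move=> ss; have [i [j mE]] : exists i j, mid = [:: i; j].
    by move: sm; rewrite ss; case: (mid) => [|i [|j []]] // _; exists i, j.
  have ni : nth 0%N ii r = i.
    by rewrite iiE nth_cat s1 ltnn subnn mE.
  have nj : nth 0%N ii r.+1 = j.
    by rewrite iiE nth_cat s1 ltnNge leqnSn /= subSnn mE.
  exists i, j; split=> //.
  by rewrite /merge ni nj /ii2 ss addn2.
have BE : s = n.-1 -> Bval r = if all odd mid then
    if r is 0 then - Xval (last 0%N ii) (hsum mid) s c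
    else (-1) ^+ (s * (head 0%N ii).+1) *: Xval (head 0%N ii) (hsum mid) s c
    else 0.
  move=> ss; case: r rst @ii1 @mid @ii2 iiE s1 sm s2 AE => [|[|r]]; last by lia.
    by move=> rst ii1 mid *; rewrite /Bval /mid drop0 -ss.
  move=> rst ii1 mid *; rewrite /Bval /mid drop1 take_oversize -?ss //.
  by rewrite size_behead ss.
clearbody ii1 mid ii2.
have [om|nom] := boolP (all odd mid); last first.
  have -> : (if s == n.-1 then Bval r else 0) = 0.
    by case: eqP => // /BE ->; rewrite (negbTE nom).
  rewrite addr0; case: eqP => [ss|/eqP ss].
    have [i [j [mE ni nj mrg]]] := AE ss.
    have nij : ~~ (odd i && odd j) by move: nom; rewrite mE /= andbT.
    rewrite /Aval ni nj (negbTE nij) mrg.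
    have -> : term Vg r s t ii c = dval (ii1 ++ (i + j)%N :: ii2) c.
      by rewrite iiE mE ss; apply: (term_coassoc Vdir Rrel c s1 s2 nij).
    have {}ss : s = 2%N := ss.
    suff -> : (-1) ^+ (r * s + t) = (-1) ^+ (n - 2 - r) :> k by [].
    have -> : (n - 2 - r = t)%N by lia.
    by rewrite -signr_odd ss muln2 oddD odd_double signr_odd.
  rewrite iiE (term_dval0 Vdir Rrel c s1 sm s2) ?scaler0 // => d.
  by apply: dval_not_odd; rewrite ?sm.
have -> : (if s == 2%N then Aval r else 0) = 0.
  case: eqP => // /AE[i [j [mE ni nj _]]].
  by rewrite /Aval ni nj; move: om; rewrite mE /= andbT => ->.
rewrite add0r; case: eqP => [ss|ss]; last first.
  have {}ss : s <> n.-1 := ss.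
  have [rt|rt] := ltnP 2 (r + 1 + t).
    by rewrite iiE (term_odd0 Vdir Rrel c s1 sm s2 om rt) scaler0.
  by rewrite term_Del1 ?scaler0 //; lia.
rewrite (BE ss) om.
case: r rst ii1 mid ii2 iiE s1 sm s2 om {AE BE} => [|[|r]]; last by lia.
  move=> rst ii1 mid ii2 iiE s1 sm s2 om.
  have t1 : t = 1%N by lia.
  have [i i2E] : exists i, ii2 = [:: i].
    by move: s2; rewrite t1; case: (ii2) => [|i []] // _; exists i.
  have ii1E : ii1 = [::] by apply: size0nil.
  rewrite t1 [in LHS]iiE ii1E i2E -[in LHS]sm cat0s (term_left Vdir Rrel) //.
  rewrite [in last _ _]iiE i2E !last_cat /= sm mul0n add0n expr1.
  by rewrite scaleN1r.
move=> rst ii1 mid ii2 iiE s1 sm s2 om.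
have t0 : t = 0%N by lia.
have [i i1E] : exists i, ii1 = [:: i].
  by move: s1; case: (ii1) => [|i []] // _; exists i.
have ii2E : ii2 = [::] by apply: size0nil; rewrite s2.
rewrite t0 [in LHS]iiE i1E ii2E -[in LHS]sm cats0 cat1s (term_right Vdir Rrel) //.
rewrite [in head _ _]iiE i1E /= sm scalerA -exprD.
by rewrite mul1n addn0 -mulnS.
Qed.

Local Notation h := (hsum ii).
Let D : T := (cmp R h (Jcomp c h.*2.+2))`_n.-1.

Lemma size_merge r : (r.+1 < n)%N -> size (merge r) = n.-1.
Proof. by move=> rn; rewrite size_cat /= size_takel ?size_drop; lia. Qed.

Lemma split_at r : (r.+1 < n)%N ->
  ii = take r ii ++ [:: nth 0%N ii r, nth 0%N ii r.+1 & drop r.+2 ii].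
Proof.
move=> rn; rewrite -{1}(cat_take_drop r ii); congr (_ ++ _).
by rewrite (drop_nth 0%N) ?(drop_nth 0%N (n := r.+1)) // ltnW.
Qed.

Local Notation ev := (count (fun i => ~~ odd i)).

Lemma all_odd_ev jj : all odd jj = (ev jj == 0)%N.
Proof. by elim: jj => //= i jj ->; case: odd. Qed.

Lemma ev_merge r : (r.+1 < n)%N -> ~~ (odd (nth 0%N ii r) && odd (nth 0%N ii r.+1)) ->
  (ev (merge r)).+1 = ev ii.
Proof.
move=> rn; rewrite [in RHS](split_at rn) /merge !count_cat /= oddD.
by case: odd; case: odd => //= _; lia.
Qed.

Lemma hsum_merge r : (r.+1 < n)%N -> ~~ (odd (nth 0%N ii r) && odd (nth 0%N ii r.+1)) ->
  hsum (merge r) = h.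
Proof.
move=> rn oo; rewrite /merge [in RHS](split_at rn) !map_cat !sumn_cat /=; lia.
Qed.

Lemma AvalE r : (r.+1 < n)%N -> ev ii = 1%N ->
  Aval r = if odd (nth 0%N ii r) && odd (nth 0%N ii r.+1) then 0
           else (-1) ^+ (n - 2 - r) *: D.
Proof.
move=> rn e1; rewrite /Aval; case: ifPn => // oo; congr (_ *: _).
have em := ev_merge rn oo; rewrite e1 in em.
by rewrite /dval all_odd_ev (hsum_merge rn oo) size_merge //; case: em => ->.
Qed.

Lemma Xval_sum i jj : all odd jj -> (half i + hsum jj)%N = h -> odd i = false ->
  Xval i (hsum jj) n.-1 c = D.
Proof.
move=> ojj hE oi; rewrite /Xval oi hE /D.
by have -> : (i + (hsum jj).*2.+2 = h.*2.+2)%N by lia.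
Qed.

(** Without even index the two outer terms remain and cancel; a single even index
    is merged with either neighbour, a missing neighbour being replaced by the
    outer term on that side; with two even indices or more, only [n = 3] gives
    nonzero terms, by coassociativity. *)
Lemma values_cancel : \sum_(r < n.-1) Aval r + (Bval 0%N + Bval 1%N) = 0.
Proof.
have iiN : ii = rcons (take n.-1 ii) (last 0%N ii).
  have := n3; case/lastP: ii => // jj i _; rewrite size_rcons last_rcons /=.
  by rewrite -cats1 take_size_cat ?cats1.
have ii0 : ii = head 0%N ii :: behead ii by have := n3; case: (ii).
have hN : (hsum (take n.-1 ii) + half (last 0%N ii))%N = h.
  by rewrite [in RHS]iiN map_rcons sumn_rcons.
have h0 : (half (head 0%N ii) + hsum (behead ii))%N = h by rewrite [in RHS]ii0.
have evN : (ev (take n.-1 ii) + ~~ odd (last 0%N ii))%N = ev ii.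
  by rewrite [in RHS]iiN -cats1 count_cat /= addn0.
have ev0 : (~~ odd (head 0%N ii) + ev (behead ii))%N = ev ii by rewrite [in RHS]ii0.
have [e0|[e1|e2]] : ev ii = 0%N \/ ev ii = 1%N \/ (1 < ev ii)%N by lia.
- rewrite big1 ?add0r => [|r _]; last first.
    have rn := ltn_ord r; have : all odd ii by rewrite all_odd_ev e0.
    by move/all_nthP => oi; rewrite /Aval !oi //; lia.
  have oN : all odd (take n.-1 ii) by rewrite all_odd_ev; lia.
  have o0 : all odd (behead ii) by rewrite all_odd_ev; lia.
  have [oh ol] : odd (head 0%N ii) /\ odd (last 0%N ii) by lia.
  rewrite /Bval oN o0 -signr_odd oddM /= oh andbF scale1r /Xval oh ol.
  rewrite h0 [(_ + hsum (take _ _))%N]addnC hN.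
  have -> : (last 0 ii + (hsum (take n.-1 ii)).*2.+2 = h.*2.+3)%N by lia.
  have -> : (head 0 ii + (hsum (behead ii)).*2.+2 = h.*2.+3)%N by lia.
  by rewrite addNr.
- have [l ln lP] : exists2 l, (l < n)%N &
      forall j, (j < n)%N -> odd (nth 0%N ii j) = (j != l).
    have hs : has (fun i => ~~ odd i) ii by rewrite has_count e1.
    pose l := find (fun i => ~~ odd i) ii; have ln : (l < n)%N by rewrite -has_find.
    have el : odd (nth 0%N ii l) = false by apply/negbTE/(nth_find 0%N hs).
    exists l => // j jn; have [->|jl] := eqVneq j l; first by [].
    have iiE : ii = take l ii ++ nth 0%N ii l :: drop l.+1 ii.
      by rewrite -drop_nth // cat_take_drop.
    have : ev ii = (ev (take l ii) + (1 + ev (drop l.+1 ii)))%N.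
      by rewrite {1}iiE count_cat /= el.
    rewrite e1 => es; have o1 : all odd (take l ii) by rewrite all_odd_ev; lia.
    have o2 : all odd (drop l.+1 ii) by rewrite all_odd_ev; lia.
    have [jl'|jl'] := ltnP j l.
      by rewrite -(nth_take 0%N jl'); apply: (all_nthP 0%N o1); rewrite size_takel // ltnW.
    have -> : (j = l.+1 + (j - l.+1))%N by lia.
    rewrite -nth_drop; apply: (all_nthP 0%N o2); rewrite size_drop; lia.
  pose a r : T := (-1) ^+ (n - 2 - r) *: D.
  (* [Aval r] merges places [r] and [r.+1], so the even place [l] is involved for [r = l] and
     [r = l - 1] only. *)
  have AE r : (r < n.-1)%N -> Aval r =
      (if r == l then a r else 0) + (if r == l.-1 then if (0 < l)%N then a r else 0 else 0).
    move=> rn; rewrite AvalE ?lP //; try lia.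
    case: (eqVneq r l) => [rl|rl] /=.
      have {}rl : r = l := rl.
      case: eqP => [rl'|_]; last by rewrite addr0.
      have {}rl' : r = l.-1 := rl'.
      have -> : (0 < l)%N = false by lia.
      by rewrite addr0.
    case: (eqVneq r.+1 l) => [rl'|rl'] /=; rewrite add0r.
      have {}rl' : r.+1 = l := rl'.
      by rewrite -rl' /= eqxx.
    case: eqP => // rl''; case: ltnP => // l0.
    by case/eqP: rl'; rewrite rl'' prednK.
  rewrite (eq_bigr (fun r : 'I_n.-1 => (if (r : nat) == l then a r else 0) +
    (if (r : nat) == l.-1 then if (0 < l)%N then a r else 0 else 0))); last first.
    by move=> r _; apply: AE.
  rewrite big_split /= (@sum_ord_if _ n.-1 l a).
  rewrite (@sum_ord_if _ n.-1 l.-1 (fun r => if (0 < l)%N then a r else 0)).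
  have oh : odd (head 0%N ii) = (0%N != l) by rewrite -nth0 lP //; lia.
  have ol : odd (last 0%N ii) = (n.-1 != l) by rewrite -nth_last lP //; lia.
  have l1 : (l.-1 < n.-1)%N by lia.
  (* [Bval 0] contributes when the even index is the last one, [Bval 1] when it is the first:
     exactly when one of the two merges is missing. *)
  have -> : Bval 0%N = if l == n.-1 then - D else 0.
    rewrite /Bval all_odd_ev eq_sym; move: evN; rewrite e1 ol.
    case: eqVneq ol => [nl|nl] ol /= eN; last by case: eqP => //; lia.
    have -> : ev (take n.-1 ii) = 0%N by lia.
    by rewrite eqxx Xval_sum ?ol ?all_odd_ev //; lia.
  have -> : Bval 1%N = if l == 0%N then (-1) ^+ n.-1 *: D else 0.
    rewrite /Bval all_odd_ev eq_sym; move: ev0; rewrite e1 oh.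
    case: eqVneq oh => [nl|nl] oh /= eN; last by case: eqP => //; lia.
    have -> : ev (behead ii) = 0%N by lia.
    rewrite eqxx (Xval_sum _ h0 oh); last by rewrite all_odd_ev; lia.
    suff -> : (-1) ^+ (n.-1 * (head 0%N ii).+1) = (-1) ^+ n.-1 :> k by [].
    by rewrite -signr_odd oddM /= oh andbT signr_odd.
  rewrite l1 /a; case: (posnP l) => [l0|l0].
    have -> : (l < n.-1)%N by lia.
    have -> : (l == n.-1) = false by lia.
    have -> : n.-1 = (n - 2 - l).+1 by lia.
    by rewrite l0 add0r addr0 exprS mulN1r scaleNr subrr.
  have [nl|nl] := ltnP l n.-1.
    have -> : (l == n.-1) = false by lia.
    have -> : (n - 2 - l.-1 = (n - 2 - l).+1)%N by lia.
    by rewrite !addr0 exprS mulN1r scaleNr subrr.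
  have -> : l == n.-1 by lia.
  have -> : (n - 2 - l.-1 = 0)%N by lia.
  by rewrite add0r addr0 scale1r subrr.
- have -> : Bval 0%N = 0.
    by rewrite /Bval; case: ifP => //; rewrite all_odd_ev; case: odd evN => /=; lia.
  have -> : Bval 1%N = 0.
    by rewrite /Bval; case: ifP => //; rewrite all_odd_ev; case: odd ev0 => /=; lia.
  (* For $n > 3$ a merge leaves an even index among at least three, so the outer coproduct has no
     such component. *)
  rewrite addr0 addr0; have [n3'|n4] := eqVneq n 3%N; last first.
    rewrite big1 // => r _; have rn : (r.+1 < n)%N by have := ltn_ord r; lia.
    rewrite /Aval; case: ifPn => // oo; have em := ev_merge rn oo.
    rewrite dval_not_odd ?scaler0 ?size_merge ?all_odd_ev //; last by lia.
    by apply/eqP => e; case/eqP: n4; lia.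
  have [i [j [l iiE]]] : exists i j l, ii = [:: i; j; l].
    by move: n3'; case: (ii) => [|i [|j [|l []]]] // _; exists i, j, l.
  have rn0 : (1 < n)%N by lia.
  have rn1 : (2 < n)%N by lia.
  have n1E : n.-1 = 2%N by rewrite n3'.
  rewrite n1E big_ord_recl big_ord1 /=.
  have Aev r : (r.+1 < n)%N -> Aval r = (-1) ^+ (1 - r) *: Jcomp c (sumn ii).
    move=> rn; rewrite /Aval; case: ifPn => [oo|oo].
      move: oo e2; rewrite iiE; case: r rn => [|[|r]] /=; rewrite ?n3' //.
        by move=> _ /andP[-> ->]; case: odd.
      by move=> _ /andP[-> ->]; case: odd.
    have em := ev_merge rn oo.
    rewrite /dval all_odd_ev size_merge // n1E eqxx n3'.
    have -> : (ev (merge r) == 0)%N = false by lia.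
    congr (_ *: Jcomp _ _).
    by rewrite [in RHS](split_at rn) /merge !sumn_cat /=; lia.
  by rewrite !Aev // expr1 expr0 scaleN1r scale1r addNr.
Qed.
End AooIdentity.

(** * The axioms of the coalgebra *)

Section Coalgebra.
Variables (k : fieldType) (V : lmodType k) (Vg : nat -> submodClosed V).
Local Notation T := (talg V).
Variable R : submodClosed T.
Hypothesis Vdir : direct_sum Vg.
Hypothesis Rrel : relation_space Vg R.
Local Notation JS := (Jsum R).
Local Notation Gr := (Jgr Vg R).
Local Notation Jt := (Jtens Vg R).
Local Notation Q := (@Qm k V R).
Local Notation Del := (JDelta Vg R).
Local Notation Gd := (Jgr_direct Vdir Rrel).
Local Notation sg := (sgn Gd).
Local Notation eps := (Jeps R).
Local Notation eta := (Jeta R).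

Lemma insert_Del_tpow r s t z : z \in tpow JS (r + 1 + t) ->
  insert Gr r 1 t s (fun cs => Del s cs`_0) z \in tpow JS (r + s + t).
Proof.
have [L [LI LE]] := insert1E Gd r t s (Del_linear Vdir Rrel s).
rewrite LI; move: z; apply: tpow_ind => [|a cs y sz yJ]; first by rewrite linear0 rpred0.
rewrite linearP rpredL //; have [A [c [B [rA tB ->]]]] := word_split sz.
rewrite LE // !tpowD; apply: mem_mul; last by rewrite -tB tpow_word.
apply: mem_mul; last exact: Del_tpow.
by rewrite -rA -(size_map (sg s)) tpow_word.
Qed.

Lemma dval1 i (c : JS) : dval [:: i] c = 0.
Proof.
rewrite /dval /= andbT; case: ifP => // _.
by rewrite (cmp_small Rrel) // Jcomp_even.
Qed.

Lemma Jsum_identity n c : (0 < n)%N ->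
  \sum_(r < n.+1) \sum_(s < n.+1) \sum_(t < n.+1 | (0 < s)%N && (r + s + t == n)%N)
    (-1) ^+ (r * s + t) *:
    insert Gr r 1 t s (fun cs => Del s cs`_0) (Del (r + 1 + t)%N c) = 0.
Proof.
move=> n0; apply: (Qm_inj Rrel (n := n)) => [|ii szi].
  apply: rpred_sum => r _; apply: rpred_sum => s _; apply: rpred_sum => t.
  move=> /andP[_ /eqP rst]; apply: rpredZ.
  have := insert_Del_tpow s (Del_tpow Vdir Rrel (r + 1 + t) c).
  by rewrite rst.
transitivity (\sum_(r < n.+1) \sum_(s < n.+1)
   \sum_(t < n.+1 | (0 < s)%N && (r + s + t == n)%N)
    (-1) ^+ (r * s + t) *: term Vg r s t ii c).
  rewrite linear_sum; apply: eq_bigr => r _; rewrite linear_sum; apply: eq_bigr => s _.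
  by rewrite linear_sum; apply: eq_bigr => t _; rewrite linearZ.
(* For $n \le 2$ the inner or the outer coproduct is $\Delta_1 = 0$. *)
have [n3|n2] := ltnP 2 n; last first.
  rewrite big1 // => r _; rewrite big1 // => s _; rewrite big1 // => t /andP[s0 /eqP rst].
  have {}rst : (r + s + t = n)%N := rst.
  have [s1|s1] := eqVneq (s : nat) 1%N.
    have szr : (r < size ii)%N by lia.
    have -> : ii = take r ii ++ [:: nth 0%N ii r] ++ drop r.+1 ii.
      by rewrite /= -drop_nth // cat_take_drop.
    rewrite (term_dval0 Vdir Rrel) ?scaler0 // => [||d].
    - by rewrite size_takel // ltnW.
    - by rewrite size_drop; lia.
    - exact: dval1.
  have {}s1 : (s : nat) <> 1%N by apply/eqP.
  by rewrite (term_Del1 Vdir Rrel) ?scaler0 //; lia.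
subst n.
rewrite (triple_sum (G := fun r s t => (-1) ^+ (r * s + t) *: term Vg r s t ii c)
  n3 (A := Aval ii c) (B := Bval ii c)); last first.
  by move=> r s t s0 rst; apply: (term_value Vdir Rrel c n3).
exact: values_cancel.
Qed.

Lemma J0P (c : JS) : Jcomp c 0 = (eps c)%:A.
Proof.
have : Jcomp c 0 \in oneS V by have := Jcomp_mem c 0; rewrite JE Je0.
move=> /oneSP[x cE]; have -> : eps c = x; last exact: cE.
by rewrite /Jeps cE linearZ /= -[X in taug X]tword_nil taug_word mulr1.
Qed.

Lemma dval_gtalg ii (c : JS) p a : c \in Gr (p, a%:Z) -> dval ii c \in gtalg Vg a.
Proof.
move=> /Jgr_natP[c0 cp].
have ca i : Jcomp c i \in gtalg Vg a.
  by have [->//|/c0->] := eqVneq i p; apply: rpred0.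
rewrite /dval; case: ifP => _; first by apply: (cmp_gtalg Vdir Rrel) => //; apply: Jcomp_even.
by case: ifP => _ //; apply: rpred0.
Qed.

Lemma Jt_gtens ii t a : t \in Jt ii -> Q ii t \in gtalg Vg a ->
  t \in gtens Gr (size ii) (sumn ii, a%:Z).
Proof.
move=> tJ ta; have QJ := Q_mem tJ.
have [t' [tJ' t'g t'E]] := Jtens_lift_graded Vdir Rrel a QJ.
rewrite -(Jtens_inj Vdir Rrel tJ' tJ) //.
by rewrite t'E (adams_gtalg _ _ ta) eqxx.
Qed.

Lemma Del_degree n p a c : (0 < n)%N -> c \in Gr (p, a) ->
  Del n c \in sumsp (fun q => (q + 2 = p + n)%N) (fun q => gtens Gr n (q, a)).
Proof.
case: a => [a|a] n0 cG; last first.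
  rewrite (Jgr_neg cG); have [f fE] := linear_exists (Del_linear Vdir Rrel n).
  by rewrite -fE linear0 rpred0.
have [n2|n1] := leqP 2 n; last first.
  have -> : n = 1%N by lia.
  exact: rpred0.
have [m mP] := Del_sum Vdir Rrel c n2; rewrite (mP _ (leqnn m)).
apply: rpred_sum => i _; have [ip|ip] := eqVneq (i : nat) p; last first.
  have /Jgr_natP[c0 _] := cG.
  by rewrite (iotas0 Vdir Rrel) ?rpred0 // c0.
have tG ii t : size ii = n -> src ii = p -> all odd ii || (n == 2%N) ->
    t \in Jt ii -> Q ii t = dval ii c ->
    t \in sumsp (fun q => (q + 2 = p + n)%N) (fun q => gtens Gr n (q, a%:Z)).
  move=> szi si on tJ tE.
  have tg : t \in gtens Gr n (sumn ii, a%:Z).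
    by rewrite -szi; apply: Jt_gtens => //; rewrite tE; apply: dval_gtalg cG.
  apply: (mem_sumsp (i := sumn ii)) => //=.
  rewrite -si -szi /src; case: ifP on => [oi _|_ /eqP n2'].
    by have := all_odd_sum oi; lia.
  by rewrite szi n2'.
case: n n0 n2 tG {mP} => [|[|[|n]]] // _ _ tG; apply: rpred_sum => l.
  have pE : (l + (i - l) = p)%N by have := ltn_ord l; lia.
  move=> _; have [tJ tE] := iota2_dval Vdir Rrel c l (i - l).
  have : (l + (i - l) = i)%N by rewrite pE ip.
  move=> e; rewrite e in tJ tE.
  by apply: tG tJ tE; rewrite ?src2 ?orbT.
move=> /tuple_cond[] // oi sz iE.
have [|tJ tE] := iota_odd_dval Vdir Rrel c oi _ iE; first by rewrite sz.
by apply: tG tJ tE; rewrite ?oi // src_odd // iE.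
Qed.

Lemma insert_epsE r t : {L : {linear talg JS -> talg JS} |
     insert Gr r 1 t 0 (fun cs => (eps cs`_0)%:A) =1 L /\
     forall A c B, size A = r -> size B = t ->
       L (tword (A ++ c :: B)) = eps c *: tword (A ++ B)}.
Proof.
have le : linear (fun c : JS => (eps c)%:A : talg JS).
  by move=> a c d; rewrite /Jeps (JcompP a c d) linearP scalerDl scalerA.
have [L [LI LE]] := insert1E Gd r t 0 le; exists L; split=> // A c B rA tB.
rewrite LE //; have -> : map (sg 0) A = A by rewrite -[RHS]map_id; apply: eq_map.
by rewrite -scalerAr mulr1 -scalerAl -tword_cat.
Qed.

(** The component of index 0 is the scalar given by the counit, so multiplying by it in $T(V)$
    amounts to applying the counit. *)
Lemma Q_insert_eps r t ii1 ii2 z : size ii1 = r -> size ii2 = t ->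
  z \in tpow JS (r + 1 + t) ->
  Q (ii1 ++ ii2) (insert Gr r 1 t 0 (fun cs => (eps cs`_0)%:A) z) =
  Q (ii1 ++ 0%N :: ii2) z.
Proof.
move=> s1 s2; have [L [LI LE]] := insert_epsE r t; rewrite LI.
have [f fE] : {f : {linear talg JS -> T} | forall z, f z = Q (ii1 ++ ii2) (L z)}.
  by apply: linear_exists => a x y; rewrite (linearP L) (linearP (@Qm k V R _)).
rewrite -fE; move: z; apply: tpow_linear_ext => cs /word_split[A [c [B [rA tB ->]]]].
rewrite fE LE // linearZ /= !tword_cat tword_cons !Qm_cat ?s1 -?rA ?tpow_word //.
by rewrite Qm_vec J0P -scalerAl mul1r -scalerAr.
Qed.

Lemma insert_eps_tpow r t z : z \in tpow JS (r + 1 + t) ->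
  insert Gr r 1 t 0 (fun cs => (eps cs`_0)%:A) z \in tpow JS (r + t).
Proof.
have [L [LI LE]] := insert_epsE r t; rewrite LI.
move: z; apply: tpow_ind => [|a cs y sz yJ]; first by rewrite linear0 rpred0.
rewrite linearP rpredL //; have [A [c [B [rA tB ->]]]] := word_split sz.
by rewrite LE // rpredZ // -rA -tB -size_cat tpow_word.
Qed.

Lemma size_split r t (ii : seq nat) : size ii = (r + t)%N ->
  exists ii1 ii2, [/\ size ii1 = r, size ii2 = t & ii = ii1 ++ ii2].
Proof.
move=> sz; exists (take r ii), (drop r ii); split; rewrite ?cat_take_drop //.
  by rewrite size_takel // sz leq_addr.
by rewrite size_drop sz addKn.
Qed.

Lemma insert_counit n r t c : (r + 1 + t = n)%N -> n != 2%N ->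
  insert Gr r 1 t 0 (fun cs => (eps cs`_0)%:A) (Del n c) = 0.
Proof.
move=> <- n2; apply: (Qm_inj Rrel (n := (r + t)%N)) => [|ii /size_split].
  by apply: insert_eps_tpow; apply: Del_tpow.
move=> [ii1 [ii2 [s1 s2 ->]]].
have sz : size (ii1 ++ 0%N :: ii2) = (r + 1 + t)%N by rewrite size_cat /= s1 s2; lia.
rewrite Q_insert_eps ?Del_tpow // (Q_Del Vdir Rrel) // /dval sz (negbTE n2).
(* The inserted index 0 is even, which excludes a component of $\Delta_n$ for $n \ne 2$. *)
by rewrite all_cat /= andbF.
Qed.

Lemma counit_l c : insert Gr 0 1 1 0 (fun cs => (eps cs`_0)%:A) (Del 2 c) = tvec c.
Proof.
apply: (Qm_eq Rrel (n := 1)) => [||[|i []] // _].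
- by apply: (@insert_eps_tpow 0 1); apply: Del_tpow.
- by rewrite -tword1 tpow_word.
rewrite (@Q_insert_eps 0 1 [::] [:: i]) ?Del_tpow // (Q_Del Vdir Rrel (n := 2)) //.
by rewrite (dval_pair _ (isT : ~~ (odd 0 && odd i))) -[tvec _]mulr1 Qm_vec Qm1 mulr1.
Qed.

Lemma counit_r c : insert Gr 1 1 0 0 (fun cs => (eps cs`_0)%:A) (Del 2 c) = tvec c.
Proof.
apply: (Qm_eq Rrel (n := 1)) => [||[|i []] // _].
- by apply: (@insert_eps_tpow 1 0); apply: Del_tpow.
- by rewrite -tword1 tpow_word.
rewrite (@Q_insert_eps 1 0 [:: i] [::]) ?Del_tpow // (Q_Del Vdir Rrel (n := 2)) //.
by rewrite dval_pair ?andbF // addn0 -[tvec _]mulr1 Qm_vec Qm1 mulr1.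
Qed.

Lemma Del_loc_finite c : exists N, forall n, (N <= n)%N -> Del n c = 0.
Proof.
have [m cm] := Jcomp_bound c.
(* Finitely many components of [c] are nonzero, and each has a decomposition with finitely many
   terms; the 3 takes care of the even indices occurring in $\Delta_2$. *)
pose N := (maxn 3 (\max_(s < m) size (cmp R s (Jcomp c s.*2.+2))))%N.
exists N => n Nn; apply: (Qm_inj Rrel (Del_tpow Vdir Rrel n c)) => ii szi.
have n3 : (3 <= n)%N by apply: leq_trans Nn; apply: leq_maxl.
rewrite (Q_Del Vdir Rrel) // /dval szi; case: ifP => _; last first.
  by have -> : (n == 2)%N = false by lia.
set s := sumn _; have [ms|sm] := leqP m s.*2.+2; first by rewrite cm // (cmp0 Rrel) coef0.
rewrite nth_default //; apply: leq_trans Nn; rewrite leq_max; apply/orP; right.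
have sm' : (s < m)%N by lia.
exact: (leq_bigmax (F := fun s : 'I_m => size (cmp R s (Jcomp c s.*2.+2))) (Ordinal sm')).
Qed.

Lemma Jcomp_eta x i : Jcomp (eta x) i = if i == 0%N then x%:A else 0.
Proof. by []. Qed.

Lemma eps_eta x : eps (eta x) = x.
Proof. by rewrite /Jeps Jcomp_eta /= linearZ /= -[X in taug X]tword_nil taug_word mulr1. Qed.

Lemma dval_eta ii x : size ii != 2%N -> dval ii (eta x) = 0.
Proof.
move=> s2; rewrite /dval (negbTE s2); case: ifP => // _.
by rewrite Jcomp_eta /= (cmp0 Rrel) coef0.
Qed.

Lemma Del_eta n x : n != 2%N -> Del n (eta x) = 0.
Proof.
move=> n2; apply: (Qm_inj Rrel (Del_tpow Vdir Rrel n _)) => ii szi.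
by rewrite (Q_Del Vdir Rrel) // dval_eta // szi.
Qed.

Lemma Del2_eta : Del 2 (eta 1) = tvec (eta 1) * tvec (eta 1).
Proof.
apply: (Qm_eq Rrel (n := 2)) => [||[|i [|j []]] // _]; first exact: Del_tpow.
  have eT : tvec (eta 1) \in tpow JS 1 by rewrite -tword1 tpow_word.
  by rewrite -[2%N]/(1 + 1)%N tpowD mem_mul.
rewrite (Q_Del Vdir Rrel (n := 2)) // -[X in _ * X]mulr1 !Qm_vec Qm1 mulr1 !Jcomp_eta.
rewrite /dval /= andbT addn0; case: ifP => [/andP[oi oj]|_].
  have -> : (i == 0%N) = false by case: i oi.
  by rewrite Jcomp_eta /= (cmp0 Rrel) coef0 mul0r.
rewrite Jcomp_eta; case: i => [|i] /=; last by rewrite mul0r.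
by case: j => [|j] /=; rewrite ?mulr0 // scale1r mul1r.
Qed.

Lemma eta_linear : linear (eta : k^o -> JS).
Proof.
move=> a x y; apply: Jcomp_ext => i; rewrite (JcompP a _ _ i) !Jcomp_eta.
by case: eqP => _; rewrite ?scaler0 ?addr0 // scalerDl scalerA.
Qed.

Lemma eta_degree : eta 1 \in Gr (0%N, 0).
Proof.
apply/(@Jgr_natP _ _ _ _ 0 0); split=> [j /negbTE j0|].
  by rewrite Jcomp_eta j0.
rewrite Jcomp_eta /= scale1r.
exact: (gtalg_gtens (gtens0 Vg)).
Qed.

Lemma J_connected : connected Gr.
Proof.
split.
  exists (eta 1) => [|c].
    by apply/eqP => /(congr1 eps); rewrite eps_eta /Jeps linear0; apply/eqP/oner_neq0.
  split=> [/(@Jgr_natP _ _ _ _ 0 0)[c0 _]|[x ->]].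
    exists (eps c); apply: Jcomp_ext => i; rewrite (JcompZ _ _ i) Jcomp_eta.
    by have [->|/c0->] := eqVneq i 0%N; rewrite ?scaler0 // J0P scale1r.
  by apply: rpredZ; apply: eta_degree.
move=> [a|a] c a0; last exact: Jgr_neg.
move=> /Jgr_natP[c0 ca]; apply: Jcomp_ext => i.
have [->|/c0->//] := eqVneq i 0%N.
have := adams_gtalg Vdir a ca; rewrite eqxx J0P linearZ /= adams1.
have -> : (a == 0%N) = false by apply: negbTE; apply: contra a0 => /eqP ->.
by rewrite scaler0 => <-.
Qed.

Lemma eps_degree d c : d != (0%N, 0) -> c \in Gr d -> eps c = 0.
Proof.
case: d => p a d0 cG; have [p0|p0] := eqVneq p 0%N.
  case: J_connected => _ h; rewrite (h a c) //; last by rewrite -p0.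
    by rewrite /Jeps linear0.
  by apply: contra d0 => /eqP ->; rewrite p0.
have /hpartP c0 := hpart_mem cG.
by rewrite /Jeps c0 1?eq_sym // linear0.
Qed.

Theorem J_coalgebra : coaugmented_Aoo_coalgebra Gr Del eps eta.
Proof.
split.
- exact: Gd.
- exact: J_connected.
- by move=> n _; apply: Del_linear.
- exact: Del_degree.
- exact: Del_loc_finite.
- exact: Jsum_identity.
- by move=> a c d; rewrite /Jeps (JcompP a c d) linearP.
- exact: eps_degree.
- exact: insert_counit.
- exact: counit_l.
- exact: counit_r.
- exact: eta_linear.
- exact: eta_degree.
- exact: eps_eta.
- exact: Del2_eta.
- by move=> n _; apply: Del_eta.
Qed.
End Coalgebra.

(** * The graded dual *)

Section GradedDual.
Variables (k : fieldType) (C : lmodType k).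
Variable G : nat * int -> submodClosed C.
Hypothesis Gdir : direct_sum G.
Local Notation B := (gdual G).
Local Notation GB := (gdual_gr G).
Local Notation ev := (@gdual_eval k C G).
Local Notation dp d := (dproj Gdir (pred1 d)).

Definition fin_supp (f : C -> k) :=
  exists s : seq (nat * int), forall d c, d \notin s -> c \in G d -> f c = 0.

(** A functional of finite support is the sum of its restrictions to the degrees of the support,
    each of which is a generator. *)
Lemma gdual_predP (f : C -> k^o) : f \in gdual_pred G <-> scalar f /\ fin_supp f.
Proof.
split=> [|[fl [s sP]]].
  move: f; apply: lspan_ind => [|a f g [fl [d fd]] [gl [s sP]]].
    split=> [a x y|]; first by rewrite mulr0 addr0.
    by exists [::].
  split=> [b x y|].
    transitivity (a * f (b *: x + y) + g (b *: x + y)); first by [].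
    transitivity (b * (a * f x + g x) + (a * f y + g y)); last by [].
    by rewrite fl gl; ring.
  exists (d :: s) => d' c; rewrite inE negb_or => /andP[d'd d's] cG.
  transitivity (a * f c + g c); first by [].
  by rewrite (fd d') // (sP d') // mulr0 addr0.
have [g gE] := scalar_exists fl.
have -> : f = \sum_(d <- undup s) (fun c => f (dp d c)).
  apply/funext => c; rewrite fct_sumE.
  have [s' [us' cE]] := dproj_sum Gdir c.
  rewrite -(@big_supp _ _ _ (undup s) (undup (s ++ s')) (fun d => f (dp d c) : k^o)).
  - rewrite {1}(cE (undup (s ++ s'))) ?undup_uniq // => [|d ds'].
      by rewrite -gE linear_sum; apply: eq_bigr => d _; rewrite gE.
    by rewrite mem_undup mem_cat ds' orbT.
  - exact: undup_uniq.
  - exact: undup_uniq.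
  - by move=> d; rewrite !mem_undup mem_cat => ->.
  - by move=> d; rewrite mem_undup => ds; apply: (sP d) => //; apply: dproj_mem.
apply: rpred_seq => d _; apply: mem_lspan; split=> [a x y|].
  by rewrite linearP fl.
exists d => d' c d'd cG; rewrite (dprojE _ _ cG) /= (negbTE d'd).
by rewrite -gE linear0.
Qed.

Lemma evP (f : B) : scalar (ev f).
Proof. by have /gdual_predP[] := valP f. Qed.
Lemma ev_supp (f : B) : fin_supp (ev f).
Proof. by have /gdual_predP[] := valP f. Qed.
Lemma evL a (f g : B) c : ev (a *: f + g) c = a * ev f c + ev g c.
Proof. by []. Qed.
Lemma evZ a (f : B) c : ev (a *: f) c = a * ev f c.
Proof. by []. Qed.
Lemma ev0 c : ev (0 : B) c = 0.
Proof. by []. Qed.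
Lemma evZr (f : B) a c : ev f (a *: c) = a * ev f c.
Proof. by have [g gE] := scalar_exists (evP f); rewrite -!gE linearZ. Qed.
Lemma ev0r (f : B) : ev f 0 = 0.
Proof. by have [g gE] := scalar_exists (evP f); rewrite -gE linear0. Qed.
Lemma ev_sum (I : Type) (s : seq I) (F : I -> B) c :
  ev (\sum_(i <- s) F i) c = \sum_(i <- s) ev (F i) c.
Proof.
by elim: s => [|i s IH]; rewrite ?big_nil ?ev0 // !big_cons -[X in ev (X + _)]scale1r
  evL mul1r IH.
Qed.
Lemma ev_linear c : linear (fun f : B => ev f c : k^o).
Proof. by []. Qed.

Lemma gdual_ext (f g : B) : ev f =1 ev g -> f = g.
Proof. by move=> fg; apply/val_inj/funext. Qed.

Lemma gdual_ext_hom (f g : B) : (forall d c, c \in G d -> ev f c = ev g c) -> f = g.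
Proof.
move=> fg; apply: gdual_ext.
elim/(gdir_ind Gdir) => [|a d x y /fg xE yE]; first by rewrite !ev0r.
by rewrite !evP xE yE.
Qed.

Lemma to_gdualE (f : C -> k^o) : scalar f -> fin_supp f -> ev (to_gdual G f) = f.
Proof.
move=> fl fs; rewrite /gdual_eval /to_gdual val_insubd.
by have -> : f \in gdual_pred G by apply/gdual_predP.
Qed.

(** Functionals of degree [d] are supported in degree [dualdeg d] of [C]: the Adams degree changes
    sign, while the other one is counted cohomologically. *)
Definition dualdeg (d : nat * int) : nat * int := (d.1, - d.2).
Lemma dualdegK : involutive dualdeg.
Proof. by case=> p a; rewrite /dualdeg /= opprK. Qed.

Lemma gdual_grP d (f : B) : f \in GB d <->
  forall d' c, d' != dualdeg d -> c \in G d' -> ev f c = 0.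
Proof.
split=> [|fd]; last exact: mem_lspan.
move: f; apply: lspan_ind => [//|a f g fd gd] d' c d'd cG.
by rewrite evL (fd d') // (gd d') // mulr0 addr0.
Qed.

Lemma gdual_cut_exists d (f : B) : {g : B | forall c, ev g c = ev f (dp d c)}.
Proof.
exists (to_gdual G (fun c => ev f (dp d c))) => c; rewrite to_gdualE //.
  by move=> a x y; rewrite linearP evP.
exists [:: d] => d' c'; rewrite inE => d'd cG.
by rewrite (dprojE _ _ cG) /= (negbTE d'd) ev0r.
Qed.

Lemma gdual_direct : direct_sum GB.
Proof.
split=> [f|s x us xG s0 d ds].
  have [s sP] := ev_supp f.
  have -> : f = \sum_(d <- undup s) sval (gdual_cut_exists d f).
    apply: gdual_ext_hom => d c cG; rewrite ev_sum.
    under eq_bigr => e _ do rewrite (svalP (gdual_cut_exists e f)) (dprojE _ _ cG) /=.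
    have [dS|dS] := boolP (d \in s).
      rewrite (bigD1_seq d) ?mem_undup ?undup_uniq //= eqxx big1 ?addr0 // => e ed.
      by rewrite eq_sym (negbTE ed) ev0r.
    rewrite (sP d) // big_seq big1 // => e; rewrite mem_undup => es.
    by case: eqP => [de|_]; [rewrite de es in dS|rewrite ev0r].
  apply: rpred_seq => d _; apply: (mem_sumsp (i := dualdeg d)) => //.
  apply/gdual_grP => d' c; rewrite dualdegK => d'd cG.
  by rewrite (svalP (gdual_cut_exists d f)) (dprojE _ _ cG) /= (negbTE d'd) ev0r.
apply: gdual_ext_hom => e c cG; rewrite ev0.
have [ed|ed] := eqVneq e (dualdeg d); last first.
  by have /gdual_grP h := xG d; apply: (h e c).
have := congr1 (fun f => ev f c) s0; rewrite ev0 ev_sum (bigD1_seq d) //=.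
rewrite big1 ?addr0 // => d' d'd; have /gdual_grP h := xG d'; apply: (h e c) => //.
by apply: contra d'd; rewrite ed => /eqP/(congr1 dualdeg); rewrite !dualdegK => ->.
Qed.

Lemma gdual_hpart p (f : B) : f \in hpart GB p ->
  forall q c, c \in hpart G q -> q != p -> ev f c = 0.
Proof.
move=> fp q c + qp.
move: c; apply: lspan_ind => [|b c c' [a _ cG] c'0]; first exact: ev0r.
rewrite evP c'0 addr0 (_ : ev f c = 0) ?mulr0 // {c' c'0 b}.
move: f fp; apply: lspan_ind => [//|b f f' [a' _ fG] f'0].
rewrite evL f'0 (_ : ev f c = 0) ?mulr0 ?addr0 //.
have /gdual_grP h := fG; apply: (h (q, a) c) => //.
by apply: contra qp => /eqP[->].
Qed.

End GradedDual.

(** Exponent of the sign [c_(f_1 ... f_m)] acquires on vectors of the degrees of the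
    [f_l], together with that of the transpose of a map of degree [n]. *)
Fixpoint dsign n ps : nat :=
  if ps is p :: ps' then (p * (n + sumn ps') + dsign n ps')%N else 0%N.

Lemma dsignE n ps : dsign n ps = (n * sumn ps + dsign 0 ps)%N.
Proof. by elim: ps => [|p ps /= ->]; rewrite ?muln0 //=; lia. Qed.

Lemma dsign_cat ps qs : dsign 0 (ps ++ qs) = (dsign 0 ps + dsign 0 qs + sumn ps * sumn qs)%N.
Proof. by elim: ps => [|p ps IH] //=; rewrite ?addn0 // IH sumn_cat; lia. Qed.

Lemma sign_parity (k : fieldType) (m n : nat) : odd m = odd n -> (-1) ^+ m = (-1) ^+ n :> k.
Proof. by move=> e; rewrite -signr_odd e signr_odd. Qed.

(** * Koszul signs as linear operators *)

Section SignOperator.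
Variables (k : fieldType) (C : lmodType k).
Variable G : nat * int -> submodClosed C.
Hypothesis Gdir : direct_sum G.
Local Notation en := (evn Gdir).

Lemma sgn_tvec_linl (x : talg C) : linear (fun c => tvec (sgn Gdir 1 c) * x).
Proof. by move=> a u v; rewrite sgn_linear tvec_linear mulrDl scalerAl. Qed.
Lemma sgn_tvec_linr c : linear (fun x : talg C => tvec (sgn Gdir 1 c) * x).
Proof. by move=> a u v; rewrite mulrDr scalerAr. Qed.
Definition total_sign : {linear talg C -> talg C} :=
  sval (talg_fold 1 sgn_tvec_linl sgn_tvec_linr).
Lemma total_signE ws : homogeneous G ws ->
  total_sign (hword ws) = (-1) ^+ sumn [seq w.1 | w <- ws] *: hword ws.
Proof.
have [s1 sv] := svalP (talg_fold 1 sgn_tvec_linl sgn_tvec_linr).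
elim: ws => [_|w ws IH /hom_cons[wH /IH E]]; first by rewrite /hword big_nil scale1r s1.
rewrite hword_cons sv E (sgnE _ _ wH) mul1n linearZ /= -scalerAl -scalerAr scalerA.
by rewrite exprD.
Qed.

(** An even letter contributes no sign. An odd one contributes $(-1)^n$ and the sign of the total
    degree of the letters after it, in accordance with the recursion of [dsign]. *)
Definition sign_step n c (x : talg C) : talg C :=
  tvec (en c) * x + (-1) ^+ n *: (tvec (c - en c) * total_sign x).
Lemma sign_step_linl n x : linear (sign_step n ^~ x).
Proof.
move=> a u v; rewrite /sign_step (linearP en) opprD addrACA -scalerBr !tvec_linear !mulrDl.
by rewrite !scalerDr -!scalerAl !scalerA [_ * a]mulrC addrACA.
Qed.
Lemma sign_step_linr n c : linear (sign_step n c).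
Proof.
move=> a u v; rewrite /sign_step (linearP total_sign) !mulrDr -!scalerAr !scalerDr !scalerA.
by rewrite [_ * a]mulrC addrACA.
Qed.
Definition sign_op n : {linear talg C -> talg C} :=
  sval (talg_fold 1 (sign_step_linl n) (sign_step_linr n)).

Lemma sign_opE n ws : homogeneous G ws ->
  sign_op n (hword ws) = (-1) ^+ dsign n [seq w.1 | w <- ws] *: hword ws.
Proof.
have [s1 sv] := svalP (talg_fold 1 (sign_step_linl n) (sign_step_linr n)).
elim: ws => [_|w ws IH /hom_cons[wH wsH]]; first by rewrite /hword big_nil scale1r s1.
rewrite hword_cons sv (IH wsH) /sign_step (evnE _ wH) linearZ /= (total_signE wsH).
case: ifP => ow.
  rewrite subr0 linear0 mul0r add0r -!scalerAr !scalerA -!exprD.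
  have e : odd (n + (dsign n [seq w0.1 | w0 <- ws] + sumn [seq w0.1 | w0 <- ws])) =
      odd (dsign n [seq w0.1 | w0 <- w :: ws]).
    by rewrite /= !oddD oddM ow oddD; case: (odd n); case: (odd (sumn _)); case: (odd (dsign _ _)).
  by rewrite (sign_parity k e).
rewrite subrr linear0 mul0r scaler0 addr0 -scalerAr.
have e : odd (dsign n [seq w0.1 | w0 <- ws]) = odd (dsign n [seq w0.1 | w0 <- w :: ws]).
  by rewrite /= oddD oddM ow.
by rewrite (sign_parity k e).
Qed.

End SignOperator.

(** * Unsigned pairing of functionals with tensors *)

Section Pairing.
Variables (k : fieldType) (C : lmodType k).
Variable G : nat * int -> submodClosed C.
Hypothesis Gdir : direct_sum G.
Local Notation B := (gdual G).
Local Notation ev := (@gdual_eval k C G).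

Definition pair_step (c : C) (h : seq B -> k^o) : seq B -> k^o :=
  fun gs => if gs is g :: gs' then ev g c * h gs' else 0.
Lemma pair_step_linl h : linear (pair_step^~ h).
Proof.
move=> a u v; apply/funext => -[|g gs].
  by transitivity (a *: (0 : k^o) + 0); [rewrite scaler0 addr0|].
transitivity (a * (ev g u * h gs) + ev g v * h gs); last by [].
by rewrite /pair_step (evP Gdir); ring.
Qed.
Lemma pair_step_linr c : linear (pair_step c).
Proof.
move=> a u v; apply/funext => -[|g gs].
  by transitivity (a *: (0 : k^o) + 0); [rewrite scaler0 addr0|].
transitivity (a * (ev g c * u gs) + ev g c * v gs); last by [].
transitivity (ev g c * (a * u gs + v gs)); first by [].
by ring.
Qed.
Definition pair_fold :=
  talg_fold (fun gs : seq B => (gs == [::])%:R : k^o) pair_step_linl pair_step_linr.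
Lemma pair_exists gs : {f : {linear talg C -> k^o} | forall x, f x = sval pair_fold x gs}.
Proof. by apply: linear_exists => a x y; rewrite linearP. Qed.

(** [f_1 (x) ... (x) f_m], without sign. *)
Definition pairing gs := sval (pair_exists gs).

Lemma pair1 gs : pairing gs 1 = (gs == [::])%:R.
Proof. by rewrite (svalP (pair_exists gs)) (svalP pair_fold).1. Qed.
Lemma pair_vec gs c t :
  pairing gs (tvec c * t) = if gs is g :: gs' then ev g c * pairing gs' t else 0.
Proof.
rewrite (svalP (pair_exists gs)) (svalP pair_fold).2 /pair_step.
by case: gs => // g gs; rewrite (svalP (pair_exists gs)).
Qed.

Lemma pair_tvec g c : pairing [:: g] (tvec c) = ev g c.
Proof. by rewrite -[tvec c]mulr1 pair_vec pair1 mulr1. Qed.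

Lemma pair_cat gs hs x y : x \in tpow C (size gs) ->
  pairing (gs ++ hs) (x * y) = pairing gs x * pairing hs y.
Proof.
move: x; apply: tpow_ind => [|a cs z sz IH]; first by rewrite mul0r !linear0 mul0r.
transitivity (a * pairing (gs ++ hs) (tword cs * y) + pairing (gs ++ hs) (z * y)).
  by rewrite mulrDl -scalerAl linearP.
transitivity ((a * pairing gs (tword cs) + pairing gs z) * pairing hs y); last by rewrite linearP.
rewrite IH mulrDl -mulrA; congr (_ * _ + _).
elim: cs gs sz {IH} => [|c cs IHc] [|g gs] //= sz.
  by rewrite tword_nil mul1r pair1 mul1r.
by rewrite tword_cons -mulrA !pair_vec IHc ?mulrA //; case: sz.
Qed.

Lemma pair_word gs cs : size gs = size cs ->
  pairing gs (tword cs) = \prod_(q <- zip gs cs) ev q.1 q.2.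
Proof.
elim: gs cs => [|g gs IH] [|c cs] //= sz; first by rewrite tword_nil pair1 big_nil.
by rewrite tword_cons pair_vec IH ?big_cons //; case: sz.
Qed.

Lemma pair_size gs cs : size gs != size cs -> pairing gs (tword cs) = 0.
Proof.
elim: gs cs => [|g gs IH] [|c cs] //= sz; first by rewrite tword_cons pair_vec.
  by rewrite tword_nil pair1.
by rewrite tword_cons pair_vec IH ?mulr0.
Qed.

Lemma pair_linl c s1 s2 a u v :
  pairing (s1 ++ (a *: u + v) :: s2) c = a * pairing (s1 ++ u :: s2) c + pairing (s1 ++ v :: s2) c.
Proof.
have W cs : pairing (s1 ++ (a *: u + v) :: s2) (tword cs) =
    a * pairing (s1 ++ u :: s2) (tword cs) + pairing (s1 ++ v :: s2) (tword cs).
  elim: s1 cs => [|g s1' IH] [|c' cs] /=.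
  - by rewrite tword_nil !pair1 mulr0 addr0.
  - by rewrite tword_cons !pair_vec evL; ring.
  - by rewrite tword_nil !pair1 mulr0 addr0.
  - by rewrite tword_cons !pair_vec IH; ring.
elim/talg_ind: c => [|b cs y IH]; first by rewrite !linear0 mulr0 addr0.
rewrite !(linearP (pairing _)) IH.
transitivity (b * pairing (s1 ++ (a *: u + v) :: s2) (tword cs) +
  (a * pairing (s1 ++ u :: s2) y + pairing (s1 ++ v :: s2) y)); first by [].
transitivity (a * (b * pairing (s1 ++ u :: s2) (tword cs) + pairing (s1 ++ u :: s2) y) +
  (b * pairing (s1 ++ v :: s2) (tword cs) + pairing (s1 ++ v :: s2) y)); last by [].
by rewrite W; ring.
Qed.

End Pairing.

(** * The dual products as linear maps *)

Section DualMultiplication.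
Variables (k : fieldType) (C : lmodType k).
Variable G : nat * int -> submodClosed C.
Variables (Delta : nat -> C -> talg C) (eps : C -> k) (eta : k -> C).
Hypothesis HC : coaugmented_Aoo_coalgebra G Delta eps eta.
Let Gdir : direct_sum G := coalg_bigraded HC.
Local Notation B := (gdual G).
Local Notation GB := (gdual_gr G).
Local Notation ev := (@gdual_eval k C G).
Local Notation GBdir := (gdual_direct Gdir).
Local Notation pairing := (pairing Gdir).
Local Notation degs := (map (@fst nat B)).
Local Notation vecs := (map (@snd nat B)).

Lemma ev_hpart p q (f : B) c : f \in hpart GB p -> c \in hpart G q -> q != p -> ev f c = 0.
Proof. by move=> fp cq; apply: (gdual_hpart Gdir fp cq). Qed.

Lemma ev_sgn d p (f : B) c : f \in hpart GB p ->
  ev f (sgn Gdir d c) = (-1) ^+ (d * p) * ev f c.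
Proof.
move=> fp; elim/(hpart_ind Gdir): c => [|a q x y xq IH].
  have [g gE] := linear_exists (sgn_linear Gdir d).
  by rewrite -gE linear0 (ev0r Gdir) mulr0.
rewrite sgn_linear !(evP Gdir) IH (sgnE _ _ xq) (evZr Gdir).
have [->|qp] := eqVneq q p; first by ring.
by rewrite (ev_hpart fp xq qp); ring.
Qed.

Lemma pair_sgn d fs A : homogeneous GB fs ->
  pairing (vecs fs) (tword (map (sgn Gdir d) A)) =
  (-1) ^+ (d * sumn (degs fs)) * pairing (vecs fs) (tword A).
Proof.
elim: fs A => [|f fs IH] [|c A] /=.
- by rewrite muln0 mul1r.
- by rewrite !tword_cons !pair_vec mulr0.
- by rewrite tword_nil !pair1 mulr0.
move=> /hom_cons[fp fsH]; rewrite !tword_cons !pair_vec (ev_sgn _ _ fp) IH //.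
by rewrite mulnDr exprD mulrACA.
Qed.

Lemma pair_mismatch fs ws : homogeneous GB fs -> homogeneous G ws -> degs fs != map fst ws ->
  pairing (vecs fs) (hword ws) = 0.
Proof.
elim: fs ws => [|f fs IH] [|w ws] //=.
- by rewrite hword_cons pair_vec.
- by rewrite /hword big_nil pair1.
move=> /hom_cons[fp fsH] /hom_cons[wp wsH]; rewrite eqseq_cons negb_and hword_cons pair_vec.
case/orP=> ne; last by rewrite IH ?mulr0.
by rewrite (ev_hpart fp wp) ?mul0r // eq_sym.
Qed.

Lemma pairing_exponent (fs : seq (nat * B)) :
  (\sum_(l < size fs) nth 0%N (degs fs) l * \sum_(f <- drop l.+1 fs) f.1 =
  dsign 0 (degs fs))%N.
Proof.
elim: fs => [|f fs IH] /=; first by rewrite big_ord0.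
rewrite big_ord_recl /= drop0 add0n -IH sumnE big_map; congr (_ + _)%N.
Qed.

(** The sign in [dual_pairing] is computed from the degrees of the vectors as well. Where the
    pairing is nonzero these equal the degrees of the functionals, so the sign is constant. *)
Lemma dual_pairingE fs z : homogeneous GB fs ->
  dual_pairing fs z = (-1) ^+ dsign 0 (degs fs) * pairing (vecs fs) z.
Proof.
move=> fsH; have [L LE] : {L : {linear talg C -> k^o} |
    forall z, L z = (-1) ^+ dsign 0 (degs fs) * pairing (vecs fs) z}.
  apply: linear_exists => a x y; rewrite (linearP (pairing _)).
  transitivity ((-1) ^+ dsign 0 (degs fs) * (a * pairing (vecs fs) x + pairing (vecs fs) y)).
    by [].
  transitivity (a * ((-1) ^+ dsign 0 (degs fs) * pairing (vecs fs) x) +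
     (-1) ^+ dsign 0 (degs fs) * pairing (vecs fs) y); last by [].
  by rewrite mulrDr mulrCA.
rewrite -LE; refine (@hliftE _ _ _ Gdir k^o _ L _ z) => ws wsH; rewrite LE.
case: eqP => [sz|/eqP sz]; last first.
  by rewrite hwordE pair_size ?mulr0 // !size_map eq_sym.
have [E|ne] := eqVneq (degs fs) (map fst ws); last first.
  rewrite pair_mismatch // mulr0.
  have := pair_mismatch fsH wsH ne; rewrite hwordE pair_word ?size_map //.
  have -> : \prod_(q <- zip fs ws) ev q.1.2 q.2.2 =
      \prod_(q <- zip (vecs fs) [seq w.2 | w <- ws]) ev q.1 q.2.
    elim: (fs) (ws) => [|f fs' IH] [|w ws'] /=; rewrite ?big_nil // !big_cons IH //.
  by move=> ->; rewrite mulr0.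
rewrite hwordE pair_word ?size_map // -pairing_exponent E; congr (_ * _).
elim: (fs) (ws) => [|f fs' IH] [|w ws'] /=; rewrite ?big_nil // !big_cons IH //.
Qed.

(** Each functional has finite support, so the total degrees that pair nontrivially are among
    finitely many sums. This is what puts the products in the graded dual. *)
Lemma pair_total_supp gs : exists S : seq (nat * int), forall m e z,
  e \notin S -> z \in gtens G m e -> pairing gs z = 0.
Proof.
have [S SP] : exists S : seq (nat * int), forall es cs, all2 (fun c e => c \in G e) cs es ->
    \sum_(e <- es) e \notin S -> pairing gs (tword cs) = 0.
  elim: gs => [|g gs [S IH]].
    exists [:: 0] => -[|e es] [|c cs] //=; first by rewrite big_nil inE eqxx.
    by rewrite tword_cons pair_vec.
  have [S' S'P] := ev_supp Gdir g.
  exists [seq d + e | d <- S', e <- S] => -[|e es] [|c cs] //=.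
    by rewrite tword_nil pair1.
  move=> /andP[cG csG]; rewrite big_cons tword_cons pair_vec => eS.
  have [eS'|eS'] := boolP (e \in S'); last by rewrite (S'P _ _ eS' cG) mul0r.
  rewrite (IH _ _ csG) ?mulr0 //; apply: contra eS => esS.
  by apply/allpairsP; exists (e, \sum_(e <- es) e).
exists S => m e z eS; move: z; apply: (lspan_linear (g := \0)) => x [es [_ esE]]; move: x.
apply: (lspan_linear (g := \0)) => _ [cs csG ->]; apply: (SP es); last by rewrite esE.
by elim: cs es csG {esE} => [|c cs IH] [|e' es] //= /andP[-> /IH].
Qed.

Lemma pair_gtens gs ds m e z : all2 (fun g d => g \in GB d) gs ds ->
  z \in gtens G m e -> e != \sum_(d <- ds) dualdeg d -> pairing gs z = 0.
Proof.
have W es cs : all2 (fun g d => g \in GB d) gs ds ->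
    all2 (fun c e => c \in G e) cs es -> \sum_(e <- es) e != \sum_(d <- ds) dualdeg d ->
    pairing gs (tword cs) = 0.
  elim: gs ds es cs => [|g gs IH] [|d ds] [|e' es] [|c cs] //=.
  - by rewrite !big_nil eqxx.
  - by rewrite tword_cons pair_vec.
  - by rewrite tword_nil pair1.
  move=> /andP[gd gsd] /andP[cG csG]; rewrite tword_cons pair_vec !big_cons => ne.
  have [ed|ed] := eqVneq e' (dualdeg d); last first.
    by rewrite (proj1 (gdual_grP d g) gd _ _ ed cG) mul0r.
  rewrite (IH _ _ _ gsd csG) ?mulr0 //; apply: contra ne => /eqP ->.
  by rewrite ed.
move=> gsd + ez; move: z; apply: (lspan_linear (g := \0)) => x [es [_ esE]]; move: x.
apply: (lspan_linear (g := \0)) => _ [cs csG ->]; apply: (W es) => //; last by rewrite esE.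
by elim: cs es csG {esE} => [|c cs IH] [|e' es] //= /andP[-> /IH].
Qed.

Section Arity.
Variables (n : nat) (n0 : (0 < n)%N).

Lemma pair_Delta_linear gs : scalar (fun c => pairing gs (Delta n c) : k).
Proof. by move=> a x y; rewrite (coalg_linear HC n0) (linearP (pairing _)). Qed.

Lemma pair_Delta_deg gs p a c : c \in G (p, a) ->
  (forall q z, (q + 2 = p + n)%N -> z \in gtens G n (q, a) -> pairing gs z = 0) ->
  pairing gs (Delta n c) = 0.
Proof.
move=> cG z0; have := coalg_degree HC n0 cG.
by apply: (lspan_linear (g := \0)) => z [q qE zG]; apply: (z0 q).
Qed.

Lemma pair_Delta_supp gs : fin_supp G (fun c => pairing gs (Delta n c) : k).
Proof.
have [S SP] := pair_total_supp gs.
(* [Delta n] raises the homological degree by $n - 2$. *)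
exists [seq ((d.1 + 2 - n)%N, d.2) | d <- S] => -[p a] c dS cG.
apply: (pair_Delta_deg cG) => q z qE; apply: SP; apply: contra dS => qS.
by apply/mapP; exists (q, a) => //=; congr (_, _); lia.
Qed.

Definition dual_word gs : B :=
  if size gs == n then to_gdual G (fun c => pairing gs (Delta n c)) else 0.

Lemma dual_wordE gs c : size gs = n -> ev (dual_word gs) c = pairing gs (Delta n c).
Proof.
move=> sz; rewrite /dual_word sz eqxx (to_gdualE Gdir) //.
  exact: pair_Delta_linear.
exact: pair_Delta_supp.
Qed.

Lemma dual_word_multilinear : multilinear dual_word.
Proof.
move=> s1 s2 a u v; have [sz|sz] := eqVneq (size (s1 ++ u :: s2)) n; last first.
  rewrite /dual_word !size_cat /= in sz *.
  by rewrite (negbTE sz) scaler0 addr0.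
apply: gdual_ext => c; rewrite evL !dual_wordE ?pair_linl //;
  by rewrite -sz !size_cat.
Qed.

(** The signs are applied first, by a linear operator, so that what remains is multilinear in the
    functionals. *)
Definition mult : {linear talg B -> B} :=
  sval (talg_universal dual_word_multilinear) \o sign_op GBdir n.

Lemma mult_hword fs : homogeneous GB fs ->
  mult (hword fs) = (-1) ^+ dsign n (degs fs) *: dual_word (vecs fs).
Proof.
move=> fsH; rewrite /mult /= (sign_opE _ _ fsH) linearZ /= hwordE.
by rewrite (svalP (talg_universal dual_word_multilinear)).
Qed.

Lemma ev_mult fs c : homogeneous GB fs -> size fs = n ->
  ev (mult (hword fs)) c = (-1) ^+ dsign n (degs fs) * pairing (vecs fs) (Delta n c).
Proof. by move=> fsH sz; rewrite mult_hword // evZ dual_wordE ?size_map. Qed.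

Lemma dual_multE : dual_mult G Delta n =1 mult.
Proof.
apply: (hliftE GBdir) => fs fsH.
case: eqP => [sz|/eqP sz]; last first.
  by rewrite mult_hword // /dual_word size_map (negbTE sz) scaler0.
have E c : (-1) ^+ (n * \sum_(f <- fs) f.1) * dual_pairing fs (Delta n c) =
    (-1) ^+ dsign n (degs fs) * pairing (vecs fs) (Delta n c).
  rewrite (dual_pairingE _ fsH) mulrA -exprD [in RHS]dsignE.
  by have -> : \sum_(f <- fs) f.1 = sumn (degs fs) by rewrite sumnE big_map.
apply: gdual_ext => c; rewrite ev_mult // (to_gdualE Gdir) ?E //.
  by move=> a x y; rewrite !E pair_Delta_linear mulrDr mulrCA.
have [S SP] := pair_Delta_supp (vecs fs).
by exists S => d c' dS cG; rewrite E (SP d c') // mulr0.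
Qed.

End Arity.
End DualMultiplication.

Lemma dualdeg_sum (ds : seq (nat * int)) :
  \sum_(d <- ds) dualdeg d = dualdeg (\sum_(d <- ds) d).
Proof.
elim: ds => [|d ds IH]; first by rewrite !big_nil /dualdeg /= oppr0.
by rewrite !big_cons IH /dualdeg /= opprD.
Qed.

Section HomogeneousLifts.
Variables (k : fieldType) (C : lmodType k).
Variable G : nat * int -> submodClosed C.

Lemma all2_hom cs (ds : seq (nat * int)) : all2 (fun c d => c \in G d) cs ds ->
  exists ws, [/\ homogeneous G ws, [seq w.2 | w <- ws] = cs & [seq w.1 | w <- ws] = map fst ds].
Proof.
elim: cs ds => [|c cs IH] [|[p a] ds] //=; first by exists [::].
move=> /andP[cG /IH[ws [wsH <- <-]]]; exists ((p, c) :: ws); split=> //.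
by apply/hom_cons; split=> //; apply: hpart_mem cG.
Qed.

Lemma gtensP n e (P : talg C -> Prop) : P 0 ->
  (forall a ws y, homogeneous G ws -> size ws = n -> sumn [seq w.1 | w <- ws] = e.1 ->
     P y -> P (a *: hword ws + y)) ->
  forall x, x \in gtens G n e -> P x.
Proof.
move=> P0 PD x; move: x; apply: lspan_ind => // b z y [ds [szd dsE] zG] Py.
move: z zG b y Py; apply: lspan_ind => [b y Py|a z z' [cs csG ->] IH b y Py].
  by rewrite scaler0 add0r.
rewrite scalerDr scalerA -addrA.
have {}csG : all2 (fun c d => c \in G d) cs ds.
  by elim: cs ds csG {szd dsE} => [|c cs IHc] [|d ds] //= /andP[-> /IHc].
have [ws [wsH wsE wdE]] := all2_hom csG.
have -> : \prod_(w <- cs) tvec w = hword ws by rewrite hwordE wsE.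
apply: PD => //; last exact: IH.
  by rewrite -(size_map fst) wdE size_map.
rewrite wdE -dsE sumnE big_map.
by rewrite (big_morph fst (id1 := 0) (op1 := +%R)).
Qed.

End HomogeneousLifts.

(** * The axioms of the dual algebra *)

Section DualAlgebra.
Variables (k : fieldType) (C : lmodType k).
Variable G : nat * int -> submodClosed C.
Variables (Delta : nat -> C -> talg C) (eps : C -> k) (eta : k -> C).
Hypothesis HC : coaugmented_Aoo_coalgebra G Delta eps eta.
Let Gdir : direct_sum G := coalg_bigraded HC.
Local Notation B := (gdual G).
Local Notation GB := (gdual_gr G).
Local Notation ev := (@gdual_eval k C G).
Local Notation GBdir := (gdual_direct Gdir).
Local Notation pairing := (pairing Gdir).
Local Notation degs := (map (@fst nat B)).
Local Notation vecs := (map (@snd nat B)).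
Local Notation mult := (mult HC).
Local Notation m := (dual_mult G Delta).

Lemma pair_hom_gtens fs n e z : homogeneous GB fs -> z \in gtens G n e ->
  sumn (degs fs) != e.1 -> pairing (vecs fs) z = 0.
Proof.
move=> fsH + ne; move: z; apply: gtensP => [|a ws y wsH _ wsE y0]; first exact: linear0.
rewrite linearP y0 (pair_mismatch HC fsH wsH) ?scaler0 ?addr0 //.
by apply: contra ne => /eqP ->; rewrite wsE.
Qed.

Lemma ev_hproj q f d c : c \in G d ->
  ev (hproj GBdir q f) c = if d.1 == q then ev f c else 0.
Proof.
move=> cG; elim/(gdir_ind GBdir): f => [|a d' x y xG IH].
  by rewrite linear0 ev0; case: ifP.
rewrite linearP !evL IH; case: d' xG => p a' /hpart_mem xH.
rewrite (hprojE _ _ xH); have cH : c \in hpart G d.1 by case: d cG {IH} => e b /hpart_mem.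
case: (eqVneq p q) => pq; case: (eqVneq d.1 q) => dq //.
- by rewrite (ev_hpart HC xH cH) ?pq // mulr0 addr0.
- by rewrite (ev_hpart HC xH cH) ?ev0 // dq eq_sym.
- by rewrite ev0 mulr0 addr0.
Qed.

Lemma mem_gdual_hpart q f : (forall d c, c \in G d -> d.1 != q -> ev f c = 0) ->
  f \in hpart GB q.
Proof.
move=> f0; have -> : f = hproj GBdir q f; last exact: hproj_mem.
apply: (gdual_ext_hom Gdir) => d c cG; rewrite (ev_hproj _ _ cG).
by case: eqVneq => // /(f0 d c cG).
Qed.

(** The degree is $\sum p_l + 2 - n$. When this is negative the product is zero and lies in every
    degree, so one of the same parity is given; signs depend on the parity alone. *)
Lemma mult_hpart n (n0 : (0 < n)%N) fs : homogeneous GB fs -> size fs = n ->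
  exists2 q, odd q = odd (sumn (degs fs) + n) & mult n0 (hword fs) \in hpart GB q.
Proof.
move=> fsH sz; have ev0' p a c : (p + n != sumn (degs fs) + 2)%N -> c \in G (p, a) ->
    ev (mult n0 (hword fs)) c = 0.
  move=> pn cG; rewrite ev_mult // (pair_Delta_deg n0 cG) ?mulr0 // => q z qE zG.
  apply: (pair_hom_gtens fsH zG); apply: contra pn => /eqP /= ->.
  by rewrite qE.
have [nP|Pn] := leqP n (sumn (degs fs) + 2).
  exists (sumn (degs fs) + 2 - n)%N; first by rewrite oddB // !oddD addbF.
  apply: mem_gdual_hpart => -[p a] c cG /= pq; apply: (ev0' p a c) => //.
  by apply: contra pq => /eqP <-; rewrite addnK.
exists (sumn (degs fs) + n)%N => //.
rewrite (_ : mult n0 _ = 0) ?rpred0 //; apply: (gdual_ext_hom Gdir) => -[p a] c cG.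
by rewrite (ev0' p a c) // neq_ltn orbC (leq_trans Pn) // leq_addl.
Qed.

Lemma dual_mult_degree n p a x : (0 < n)%N -> x \in gtens GB n (p, a) ->
  m n x \in sumsp (fun q => (q + n = p + 2)%N) (fun q => GB (q, a)).
Proof.
move=> n0; rewrite (dual_multE HC n0); set S := sumsp _ _.
move: x; apply: lspan_ind => [|b x y [ds [szd dsE] xG] yS]; first by rewrite linear0 rpred0.
rewrite linearP rpredL //; move: x xG {y yS b}.
apply: lspan_ind => [|b _ y [gs gsd ->] yS]; first by rewrite linear0 rpred0.
rewrite linearP rpredL // {y yS b}.
have {}gsd : all2 (fun g d => g \in GB d) gs ds.
  by elim: gs ds gsd {szd dsE} => [|c cs IHc] [|d ds] //= /andP[-> /IHc].
have [fs [fsH fsE fdE]] := all2_hom gsd.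
have sz : size gs = n by rewrite -szd; elim: (gs) (ds) gsd => [|? ? IH] [|? ?] //= /andP[_ /IH ->].
have -> : \prod_(w <- gs) tvec w = hword fs by rewrite hwordE fsE.
rewrite mult_hword // rpredZ // fsE.
have ev0' p' a' c : ~ ((p' + n = p + 2)%N /\ a' = - a) -> c \in G (p', a') ->
    ev (dual_word HC n gs) c = 0.
  move=> ne cG; rewrite dual_wordE // (pair_Delta_deg n0 cG) // => q z qE zG.
  apply: (pair_gtens HC gsd zG); apply/eqP => E; apply: ne.
  by move: E; rewrite dualdeg_sum dsE /dualdeg /= => -[<- ->].
have [nP|Pn] := leqP n (p + 2).
  apply: (mem_sumsp (i := (p + 2 - n)%N)); first by rewrite /= subnK.
  apply/gdual_grP => -[p' a'] c d'd cG; apply: (ev0' p' a') => // -[pE aE].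
  by move/eqP: d'd; apply; rewrite /dualdeg /= aE; congr (_, _); lia.
rewrite (_ : dual_word HC n gs = 0) ?rpred0 //.
apply: (gdual_ext_hom Gdir) => -[p' a'] c cG.
by rewrite (ev0' p' a') // => -[pE _]; lia.
Qed.

Lemma Delta_tpow n c : (0 < n)%N -> Delta n c \in tpow C n.
Proof.
move=> n0; have [f fE] := linear_exists (coalg_linear HC n0); rewrite -fE.
elim/(gdir_ind Gdir): c => [|a [p b] x y xG yT]; first by rewrite linear0 rpred0.
rewrite linearP rpredL // fE; have := coalg_degree HC n0 xG.
apply: sumsp_sub => q z _; move: z; apply: gtensP => [|e ws z' _ wn _ zT]; first exact: rpred0.
by rewrite rpredL // hwordE -wn -(size_map snd) tpow_word.
Qed.

(** The sign has two sources: moving $\Delta_s$ past the vectors paired with [fs1], and the sign in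
    the product of [fs2]. *)
Lemma pair_insert r s t (s0 : (0 < s)%N) fs1 fs2 fs3 z :
  homogeneous GB fs1 -> homogeneous GB fs2 -> size fs1 = r -> size fs2 = s -> size fs3 = t ->
  z \in tpow C (r + 1 + t) ->
  pairing (vecs fs1 ++ mult s0 (hword fs2) :: vecs fs3) z =
  (-1) ^+ (s * sumn (degs fs1) + dsign s (degs fs2)) *
  pairing (vecs fs1 ++ vecs fs2 ++ vecs fs3) (insert G r 1 t s (fun cs => Delta s cs`_0) z).
Proof.
move=> f1H f2H s1 s2 s3; have [L [LI LE]] := insert1E Gdir r t s (coalg_linear HC s0).
rewrite LI; set e := (-1) ^+ _; set gs := _ ++ _ ++ _.
have [f fE] : {f : {linear talg C -> k^o} | forall z, f z = e * pairing gs (L z)}.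
  apply: linear_exists => a x y; rewrite (linearP L) (linearP (pairing _)).
  transitivity (e * (a * pairing gs (L x) + pairing gs (L y))); first by [].
  transitivity (a * (e * pairing gs (L x)) + e * pairing gs (L y)); last by [].
  by rewrite mulrDr mulrCA.
rewrite -fE; move: z; apply: tpow_linear_ext => cs /word_split[A [c [D [rA tD ->]]]].
rewrite fE LE // tword_cat pair_cat ?size_map ?s1 -?rA ?tpow_word //.
rewrite tword_cons pair_vec ev_mult // /gs -mulrA pair_cat; last first.
  by rewrite size_map s1 -rA -(size_map (sgn Gdir s)) tpow_word.
rewrite (pair_sgn HC _ _ f1H) pair_cat ?size_map ?s2 ?Delta_tpow // /e exprD.
set e1 := (-1) ^+ (s * _); set e2 := (-1) ^+ dsign _ _.
have e11 : e1 * e1 = 1 by rewrite -expr2 sqrr_sign.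
by rewrite -[e1 * e2]mulrC -!mulrA [e1 * (e1 * _)]mulrA e11 mul1r mulrCA.
Qed.

Lemma mult_slot_multilinear s : (0 < s)%N ->
  multilinear_at s (fun bs : seq B => tvec (m s (\prod_(b <- bs) tvec b))).
Proof.
move=> s0 s1 s2 a u v _; rewrite !(dual_multE HC s0).
rewrite -[\prod_(b <- _) _]/(tword (s1 ++ (a *: u + v) :: s2)) tword_multilinear.
by rewrite linearP tvec_linear.
Qed.

Lemma insert_mult_hword r s t fs : (0 < s)%N -> homogeneous GB fs -> size fs = (r + s + t)%N ->
  insert GB r s t s (fun bs => tvec (m s (\prod_(b <- bs) tvec b))) (hword fs) =
  (-1) ^+ (s * sumn (degs (take r fs))) *:
  (hword (take r fs) * tvec (m s (hword (take s (drop r fs)))) * hword (drop (r + s) fs)).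
Proof.
move=> s0 fsH sz; have [L [LI LE]] := insertE GBdir r t s (mult_slot_multilinear s0).
rewrite LI hwordE LE /insert_word size_map sz eqxx -!map_take -!map_drop -!map_comp.
rewrite -map_take -[X in tword X * _ * _]/[seq sgn GBdir s w.2 | w <- take r fs] tword_sgn.
  rewrite -!scalerAl -hwordE.
  have -> : \sum_(w <- take r fs) w.1 = sumn (degs (take r fs)) by rewrite sumnE big_map.
  by rewrite -[\prod_(b <- _) _]/(tword _) -hwordE.
by move=> w /mem_take; apply: fsH.
Qed.

(** The factor relating the two terms depends on $n$ and the degrees, not on $r$, $s$, $t$, so it
    can be taken out of the sum over all terms. *)
Lemma dual_term fs n r s t c : homogeneous GB fs -> size fs = n -> (0 < s)%N -> (r + s + t = n)%N ->
  (-1) ^+ (r + s * t) *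
    ev (m (r + 1 + t) (insert GB r s t s
          (fun bs => tvec (m s (\prod_(b <- bs) tvec b))) (hword fs))) c =
  (-1) ^+ (n + n.+1 * sumn (degs fs) + dsign 0 (degs fs)) *
    ((-1) ^+ (r * s + t) * pairing (vecs fs)
      (insert G r 1 t s (fun cs => Delta s cs`_0) (Delta (r + 1 + t)%N c))).
Proof.
move=> fsH sz s0 rst; rewrite insert_mult_hword ?sz //.
pose fs1 := take r fs; pose fs2 := take s (drop r fs); pose fs3 := drop (r + s) fs.
have fsE : fs = fs1 ++ fs2 ++ fs3.
  by rewrite /fs2 /fs3 addnC -drop_drop cat_take_drop cat_take_drop.
have s1 : size fs1 = r by rewrite size_takel //; lia.
have s2 : size fs2 = s by rewrite size_takel // size_drop; lia.
have s3 : size fs3 = t by rewrite size_drop; lia.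
rewrite -/fs1 -/fs2 -/fs3; clearbody fs1 fs2 fs3.
have h1 : homogeneous GB fs1 by move=> w w1; apply: fsH; rewrite fsE mem_cat w1.
have h2 : homogeneous GB fs2 by move=> w w2; apply: fsH; rewrite fsE !mem_cat w2 orbT.
have h3 : homogeneous GB fs3 by move=> w w3; apply: fsH; rewrite fsE !mem_cat w3 !orbT.
have N0 : (0 < r + 1 + t)%N by lia.
rewrite (dual_multE HC N0) (dual_multE HC s0) linearZ /= evZ.
have [q qodd bq] := mult_hpart s0 h2 s2; set b := mult s0 _ in bq *.
have h' : homogeneous GB (fs1 ++ (q, b) :: fs3).
  move=> w; rewrite mem_cat inE => /orP[/h1 //|/predU1P[-> //|/h3 //]].
have -> : hword fs1 * tvec b * hword fs3 = hword (fs1 ++ (q, b) :: fs3).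
  by rewrite !hwordE map_cat tword_cat /= tword_cons mulrA.
rewrite (ev_mult HC N0 _ h'); last by rewrite size_cat /= s1 s3; lia.
rewrite !map_cat /= (pair_insert s0 h1 h2 s1 s2 s3); last exact: Delta_tpow.
have -> : vecs fs = vecs fs1 ++ vecs fs2 ++ vecs fs3 by rewrite fsE !map_cat.
move: (pairing _ _) => X; rewrite !mulrA -!exprD; congr (_ * _); apply: sign_parity.
rewrite fsE !map_cat -rst !(dsignE (_ + _)) !(dsignE s) !dsign_cat /= !sumn_cat /=.
rewrite !(oddD, oddM) /= !(oddD, oddM) qodd oddD.
(* A congruence modulo 2 in the lengths, the degrees and the internal sign exponents of the three
   blocks. *)
move: (odd r) (odd s) (odd t) (odd (sumn (degs fs1))) (odd (sumn (degs fs2)))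
  (odd (sumn (degs fs3))) (odd (dsign 0 (degs fs1))) (odd (dsign 0 (degs fs2)))
  (odd (dsign 0 (degs fs3))) => b1 b2 b3 b4 b5 b6 b7 b8 b9.
by case: b1 b2 b3 b4 b5 b6 b7 b8 b9 => [] [] [] [] [] [] [] [] [].
Qed.

Lemma insert_mult_linear r s t : (0 < s)%N ->
  linear (fun x => m (r + 1 + t) (insert GB r s t s
    (fun bs => tvec (m s (\prod_(b <- bs) tvec b))) x)).
Proof.
move=> s0 a x y; have [L [LI _]] := insertE GBdir r t s (mult_slot_multilinear s0).
have N0 : (0 < r + 1 + t)%N by lia.
by rewrite !LI !(dual_multE HC N0) (linearP L) linearP.
Qed.

Definition identity_sum n x : B :=
  \sum_(r < n.+1) \sum_(s < n.+1) \sum_(t < n.+1 | (0 < s)%N && (r + s + t == n)%N)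
    (-1) ^+ (r + s * t) *:
    m (r + 1 + t)%N
      (insert GB r s t s (fun bs => tvec (m s (\prod_(b <- bs) tvec b))) x).

Lemma identity_sum_linear n : linear (identity_sum n).
Proof.
move=> a x y; rewrite /identity_sum scaler_sumr -big_split; apply: eq_bigr => r _ /=.
rewrite scaler_sumr -big_split; apply: eq_bigr => s _ /=.
rewrite scaler_sumr -big_split; apply: eq_bigr => t /andP[s0 _] /=.
by rewrite (insert_mult_linear r t s0 a x y) scalerDr !scalerA mulrC.
Qed.

Lemma dual_identity n x : (0 < n)%N -> x \in tpow B n -> identity_sum n x = 0.
Proof.
move=> n0; have [S SE] := linear_exists (identity_sum_linear n); rewrite -SE.
move: x; apply: (hom_tpow_ind GBdir) => [|a fs y fsH sz IH]; first exact: linear0.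
rewrite linearP IH addr0 SE (_ : identity_sum n _ = 0) ?scaler0 // {S SE a y IH}.
apply: gdual_ext => c; rewrite ev0.
have [E EE] := linear_exists (@ev_linear _ _ G c); rewrite -EE /identity_sum.
pose K : k := (-1) ^+ (n + n.+1 * sumn (degs fs) + dsign 0 (degs fs)).
transitivity (K * pairing (vecs fs) (\sum_(r < n.+1) \sum_(s < n.+1)
    \sum_(t < n.+1 | (0 < s)%N && (r + s + t == n)%N) (-1) ^+ (r * s + t) *:
    insert G r 1 t s (fun cs => Delta s cs`_0) (Delta (r + 1 + t)%N c))); last first.
  by rewrite (coalg_identity HC) // linear0 mulr0.
rewrite !linear_sum mulr_sumr; apply: eq_bigr => r _.
rewrite !linear_sum mulr_sumr; apply: eq_bigr => s _.
rewrite !linear_sum mulr_sumr; apply: eq_bigr => t /andP[s0 /eqP rst].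
rewrite EE evZ (dual_term c fsH sz s0 rst); congr (_ * _).
by rewrite linearZ.
Qed.

Local Notation u := (dual_unit G eps 1).

Lemma dual_unitE x c : ev (dual_unit G eps x) c = x * eps c.
Proof.
rewrite /dual_unit (to_gdualE Gdir) //.
  by move=> a y z; rewrite (coalg_counit_linear HC) mulrDr mulrCA.
exists [:: (0%N, 0)] => d c'; rewrite inE => d0 cG.
by rewrite (coalg_counit_degree HC d0 cG) mulr0.
Qed.

Lemma dual_unit_degree : u \in GB (0%N, 0).
Proof.
by apply/gdual_grP => d c d0 cG; rewrite dual_unitE (coalg_counit_degree HC _ cG) ?mulr0.
Qed.

Lemma u_hpart : u \in hpart GB 0.
Proof. exact: hpart_mem dual_unit_degree. Qed.

(** Plugging in the unit is dual to applying the counit. *)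
Lemma pair_unit r t gs1 gs2 z : size gs1 = r -> size gs2 = t -> z \in tpow C (r + 1 + t) ->
  pairing (gs1 ++ u :: gs2) z =
  pairing (gs1 ++ gs2) (insert G r 1 t 0 (fun cs => (eps cs`_0)%:A) z).
Proof.
move=> s1 s2; have le : linear (fun c => (eps c)%:A : talg C).
  by move=> a x y; rewrite (coalg_counit_linear HC) scalerDl scalerA.
have [L [LI LE]] := insert1E Gdir r t 0 le; rewrite LI.
have [f fE] : {f : {linear talg C -> k^o} | forall z, f z = pairing (gs1 ++ gs2) (L z)}.
  by apply: linear_exists => a x y; rewrite (linearP L) (linearP (pairing _)).
rewrite -fE; move: z; apply: tpow_linear_ext => cs /word_split[A [c [D [rA tD ->]]]].
rewrite fE LE // tword_cat pair_cat ?s1 -?rA ?tpow_word //.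
rewrite tword_cons pair_vec dual_unitE mul1r.
have -> : map (sgn Gdir 0) A = A by rewrite -[RHS]map_id; apply: eq_map.
have -> : tword A * (eps c)%:A * tword D = eps c *: (tword A * tword D).
  by rewrite -scalerAr mulr1 -scalerAl.
rewrite linearZ pair_cat ?s1 -?rA ?tpow_word //.
exact: mulrCA.
Qed.

Lemma dual_unit_insert n r t x : (r + 1 + t = n)%N -> n != 2%N -> x \in tpow B (r + t) ->
  m n (insert GB r 0 t 0 (fun=> tvec u) x) = 0.
Proof.
move=> rtn n2; have n0 : (0 < n)%N by lia.
have Fl : @multilinear_at k B (talg B) 0 (fun=> tvec u) by [].
have [L [LI LE]] := insertE GBdir r t 0 Fl; rewrite LI (dual_multE HC n0).
move: x; apply: (hom_tpow_ind GBdir) => [|a fs y fsH sz IH]; first by rewrite !linear0.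
rewrite !linearP IH addr0 hwordE LE /insert_word size_map addn0 sz eqxx.
rewrite (_ : mult n0 _ = 0) ?scaler0 //.
have -> : map (sgn GBdir 0) (take r (vecs fs)) = take r (vecs fs).
  by rewrite -[RHS]map_id; apply: eq_map.
pose fs' := take r fs ++ (0%N, u) :: drop r fs.
have h' : homogeneous GB fs'.
  move=> w; rewrite mem_cat inE => /orP[/mem_take/fsH //|/predU1P[->|/mem_drop/fsH //]].
  exact: u_hpart.
have -> : tword (take r (vecs fs)) * tvec u * tword (drop r (vecs fs)) = hword fs'.
  by rewrite hwordE map_cat tword_cat /= tword_cons mulrA map_take map_drop.
have st : size (take r fs) = r by rewrite size_takel // sz leq_addr.
have sd : size (drop r fs) = t by rewrite size_drop sz addKn.
apply: gdual_ext => c; rewrite ev0 ev_mult //; last by rewrite size_cat /= st sd -rtn; lia.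
have -> : vecs fs' = vecs (take r fs) ++ u :: vecs (drop r fs) by rewrite map_cat.
rewrite (@pair_unit r t) ?size_map //.
  by rewrite (coalg_counit HC) // linear0 mulr0.
by rewrite rtn Delta_tpow.
Qed.

Lemma mult2_unit_r b : m 2 (tvec b * tvec u) = b.
Proof.
rewrite (dual_multE HC (isT : (0 < 2)%N)).
elim/(hpart_ind GBdir): b => [|a p b b' bp IH]; first by rewrite linear0 mul0r linear0.
rewrite tvec_linear mulrDl -scalerAl linearP IH; congr (_ *: _ + _).
have fsH : homogeneous GB [:: (p, b); (0%N, u)].
  by apply/hom_cons; split=> //; apply/hom_cons; split=> //; apply: u_hpart.
have -> : tvec b * tvec u = hword [:: (p, b); (0%N, u)].
  by rewrite !hword_cons /hword big_nil mulr1.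
apply: gdual_ext => c; rewrite ev_mult //.
have -> : vecs [:: (p, b); (0%N, u)] = [:: b] ++ u :: [::] by [].
rewrite (@pair_unit 1 0) ?Delta_tpow // (coalg_counit_r HC) pair_tvec.
(* The unit has degree 0 and the arity is even, so the exponent is even. *)
by rewrite (@sign_parity k _ 0) ?mul1r //= !(oddD, oddM) /= andbF.
Qed.

Lemma mult2_unit_l b : m 2 (tvec u * tvec b) = b.
Proof.
rewrite (dual_multE HC (isT : (0 < 2)%N)).
elim/(hpart_ind GBdir): b => [|a p b b' bp IH]; first by rewrite linear0 mulr0 linear0.
rewrite tvec_linear mulrDr -scalerAr linearP IH; congr (_ *: _ + _).
have fsH : homogeneous GB [:: (0%N, u); (p, b)].
  by apply/hom_cons; split; [apply: u_hpart|apply/hom_cons].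
have -> : tvec u * tvec b = hword [:: (0%N, u); (p, b)].
  by rewrite !hword_cons /hword big_nil mulr1.
apply: gdual_ext => c; rewrite ev_mult //.
have -> : vecs [:: (0%N, u); (p, b)] = [::] ++ u :: [:: b] by [].
rewrite (@pair_unit 0 1) ?Delta_tpow // (coalg_counit_l HC) pair_tvec.
by rewrite (@sign_parity k _ 0) ?mul1r //= !(oddD, oddM) /= andbF.
Qed.

Lemma ev_eta p (b : B) : b \in hpart GB p -> p != 0%N -> ev b (eta 1) = 0.
Proof.
move=> bp p0; apply: (ev_hpart HC bp (hpart_mem (coalg_coaug_degree HC))).
by rewrite eq_sym.
Qed.

Lemma dual_aug2 b b' :
  dual_aug G eta (m 2 (tvec b * tvec b')) = dual_aug G eta b * dual_aug G eta b'.
Proof.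
rewrite (dual_multE HC (isT : (0 < 2)%N)) /dual_aug.
elim/(hpart_ind GBdir): b => [|a p b b1 bp IH].
  by rewrite linear0 mul0r linear0 !ev0 mul0r.
rewrite tvec_linear mulrDl -scalerAl linearP !evL IH mulrDl -mulrA; congr (_ * _ + _).
elim/(hpart_ind GBdir): b' {IH} => [|a' p' b' b2 bp' IH].
  by rewrite linear0 mulr0 linear0 !ev0 mulr0.
rewrite tvec_linear mulrDr -scalerAr linearP !evL IH mulrDr mulrCA; congr (_ * _ + _).
have fsH : homogeneous GB [:: (p, b); (p', b')].
  by apply/hom_cons; split=> //; apply/hom_cons.
have -> : tvec b * tvec b' = hword [:: (p, b); (p', b')].
  by rewrite !hword_cons /hword big_nil mulr1.
rewrite ev_mult // (coalg_coaug2 HC) /= pair_vec pair_tvec.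
have [p0|p0] := eqVneq p 0%N; last by rewrite (ev_eta bp p0) mul0r mulr0.
by rewrite (@sign_parity k _ 0) ?mul1r //= p0 !(oddD, oddM) /= andbF.
Qed.

Lemma dual_aug_vanish n x : (0 < n)%N -> n != 2%N -> x \in tpow B n ->
  dual_aug G eta (m n x) = 0.
Proof.
move=> n0 n2; rewrite (dual_multE HC n0) /dual_aug.
move: x; apply: (hom_tpow_ind GBdir) => [|a fs y fsH sz IH].
  by rewrite linear0 ev0.
rewrite linearP evL IH addr0 ev_mult // (coalg_coaug HC n0 n2) linear0.
by rewrite !mulr0.
Qed.

Lemma dual_connected : connected GB.
Proof.
have [[e0 e0n0 e0P] conn] := coalg_connected HC.
have ee : eps (eta 1) = 1 := coalg_counit_coaug HC 1.
have uE : ev u (eta 1) = 1 by rewrite dual_unitE mul1r.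
split; last first.
  move=> a x a0 /gdual_grP xG; apply: (gdual_ext_hom Gdir) => d c cG; rewrite ev0.
  have [dE|ne] := eqVneq d (dualdeg (0%N, a)); last exact: (xG _ _ ne cG).
  rewrite (conn (- a) c) ?(ev0r Gdir) ?oppr_eq0 //.
  by rewrite dE in cG.
exists u => [|x].
  apply/eqP => u0; move: uE; rewrite u0 ev0 => /esym/eqP; rewrite oner_eq0 //.
split=> [/gdual_grP xG|[a ->]]; last by apply: rpredZ; apply: dual_unit_degree.
(* The coaugmentation spans the component of bidegree 0 of [C], so a functional of bidegree 0 is
   determined by its value there. *)
have /e0P[z zE] := coalg_coaug_degree HC.
have z0 : z != 0.
  by apply/eqP => z0; move: uE; rewrite zE z0 scale0r (ev0r Gdir) => /esym/eqP; rewrite oner_eq0.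
exists (ev x (eta 1)); apply: (gdual_ext_hom Gdir) => d c cG.
rewrite evZ dual_unitE mul1r.
have [d0|d0] := eqVneq d (0%N, 0); last first.
  by rewrite (coalg_counit_degree HC d0 cG) mulr0; apply: (xG _ _ d0 cG).
rewrite d0 in cG; have /e0P[y yE] := cG.
have {yE cG} cE : c = (y / z) *: eta 1 by rewrite zE scalerA mulfVK.
have epsZ : eps c = y / z.
  have [g gE] := scalar_exists (coalg_counit_linear HC).
  by rewrite cE -gE linearZ /= gE ee mulr1.
by rewrite epsZ cE (evZr Gdir) mulrC.
Qed.

Theorem dual_algebra :
  augmented_Aoo_algebra GB m (dual_unit G eps) (dual_aug G eta).
Proof.
split.
- exact: GBdir.
- exact: dual_connected.
- by move=> n x y a n0 _ _; rewrite !(dual_multE HC n0) linearP.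
- exact: dual_mult_degree.
- exact: dual_identity.
- by move=> a x y; apply: gdual_ext => c; rewrite evL !dual_unitE mulrDl mulrA.
- exact: dual_unit_degree.
- exact: dual_unit_insert.
- exact: mult2_unit_r.
- exact: mult2_unit_l.
- by [].
- move=> d b d0 /gdual_grP bG; apply: (bG _ _ _ (coalg_coaug_degree HC)).
  by apply: contra d0 => /eqP/(congr1 dualdeg); rewrite dualdegK /dualdeg /= oppr0 => <-.
- by move=> x; rewrite /dual_aug dual_unitE (coalg_counit_coaug HC) mulr1.
- exact: dual_aug2.
- exact: dual_aug_vanish.
Qed.

Lemma dual_minimal : minimal_coalgebra Delta -> minimal_algebra m.
Proof.
move=> D1 x; rewrite (dual_multE HC (isT : (0 < 1)%N)).
move: x; apply: (hom_tpow_ind GBdir) => [|a fs y fsH sz IH]; first exact: linear0.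
rewrite linearP IH addr0; suff -> : mult (isT : (0 < 1)%N) (hword fs) = 0 by rewrite scaler0.
by apply: gdual_ext => c; rewrite ev0 ev_mult // D1 linear0 mulr0.
Qed.

End DualAlgebra.

(** * The dual products in terms of the maps iota *)

Section LastClause.
Variables (k : fieldType) (V : lmodType k) (Vg : nat -> submodClosed V).
Variable R : submodClosed (talg V).
Hypothesis Vdir : direct_sum Vg.
Hypothesis Rrel : relation_space Vg R.
Local Notation JS := (Jsum R).
Local Notation G := (Jgr Vg R).
Local Notation Gd := (Jgr_direct Vdir Rrel).
Local Notation Del := (JDelta Vg R).
Local Notation HC := (J_coalgebra Vdir Rrel).
Local Notation B := (gdual G).
Local Notation GB := (gdual_gr G).
Local Notation ev := (@gdual_eval k JS G).
Local Notation pairJ := (pairing (coalg_bigraded HC)).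

Lemma ev_proj p (f : B) c : f \in hpart GB p -> ev f (hproj Gd p c) = ev f c.
Proof.
move=> fp; elim/(hpart_ind Gd): c => [|a q x y xq IH]; first by rewrite linear0.
rewrite linearP !(evP Gd) IH (hprojE _ _ xq); congr (_ * _ + _).
by case: eqVneq => // qp; rewrite (ev0r Gd) (ev_hpart HC fp xq).
Qed.

Lemma pair_proj ii (fs : seq B) A : size fs = size ii -> size A = size ii ->
  homogeneous GB (zip ii fs) ->
  pairJ fs (tword A) = pairJ fs (tword (proj_word Vdir Rrel ii A)).
Proof.
elim: ii fs A => [|i ii IH] [|f fs] [|c A] //= [szf] [szA] /hom_cons[fi fsH].
rewrite /proj_word /= !tword_cons !pair_vec (ev_proj c fi); congr (_ * _).
exact: IH.
Qed.

Lemma dual_mult_iota ii (fs : seq B) c : (3 <= size ii)%N -> size fs = size ii ->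
  (forall l, (l < size ii)%N -> nth 0 fs l \in hpart GB (nth 0%N ii l)) ->
  ev (dual_mult G Del (size ii) (\prod_(f <- fs) tvec f)) c =
  if all odd ii then
    (-1) ^+ (size ii * sumn ii) *
    dual_pairing (zip ii fs) (iota_odd Vg R ii (Jcomp c (sumn ii + 2 - size ii)))
  else 0.
Proof.
move=> n3 szf fH; have n0 : (0 < size ii)%N by lia.
have degE : map fst (zip ii fs) = ii by rewrite -/(unzip1 _) unzip1_zip ?szf.
have vecE : map snd (zip ii fs) = fs by rewrite -/(unzip2 _) unzip2_zip ?szf.
have zH : homogeneous GB (zip ii fs).
  elim: ii fs szf fH {n3 n0 degE vecE} => [|i ii IH] [|f fs] //= [szf] fH.
  apply/hom_cons; split; first exact: (fH 0%N).
  by apply: IH => // l; apply: (fH l.+1).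
have -> : \prod_(f <- fs) tvec f = hword (zip ii fs) by rewrite hwordE vecE.
rewrite (dual_multE HC n0) ev_mult //; last by rewrite size_zip szf minnn.
rewrite degE vecE.
have supp z : z \in tpow JS (size ii) -> Qm R ii z = 0 -> pairJ fs z = 0.
  apply: (@Q_support _ _ _ _ Vdir Rrel ii _ (pairJ fs)) => A szA.
  exact: pair_proj.
case: ifPn => oi; last first.
  rewrite (supp _ (Del_tpow Vdir Rrel _ c)) ?mulr0 // (Q_Del Vdir Rrel) //.
  by rewrite /dval (negbTE oi) gtn_eqF.
have [|tJ tQ] := iota_odd_dval Vdir Rrel c oi _ erefl; first exact: n3.
rewrite (dual_pairingE HC _ zH) degE vecE mulrA -exprD -dsignE; congr (_ * _).
apply/eqP; rewrite -subr_eq0 -linearB; apply/eqP/supp.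
  by apply: rpredBm; [apply: Del_tpow|apply: (Jtens_tpow tJ)].
by rewrite linearB /= (Q_Del Vdir Rrel) // tQ subrr.
Qed.

End LastClause.

Theorem proposition4p4 (k : fieldType) (V : lmodType k)
    (Vg : nat -> submodClosed V) (R : submodClosed (talg V))
    (A : algType k) (pi : {lrmorphism talg V -> A}) :
  positive_grading Vg -> relation_space Vg R -> presentation R pi ->
  multi_Koszul R pi ->
  let G := Jgr Vg R in
  let Delta := JDelta Vg R in
  let m := dual_mult G Delta in
  [/\ coaugmented_Aoo_coalgebra G Delta (Jeps R) (Jeta R),
      minimal_coalgebra Delta,
      augmented_Aoo_algebra (gdual_gr G) m
        (dual_unit G (Jeps R)) (dual_aug G (Jeta R)),
      minimal_algebra m &
      forall (ii : seq nat) (fs : seq (gdual G)),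
        (3 <= size ii)%N -> size fs = size ii ->
        (forall l, (l < size ii)%N ->
           nth 0 fs l \in hpart (gdual_gr G) (nth 0%N ii l)) ->
        forall c : Jsum R,
          gdual_eval (m (size ii) (\prod_(f <- fs) tvec f)) c =
          if all odd ii then
            (-1) ^+ (size ii * sumn ii) *
            dual_pairing (zip ii fs)
              (iota_odd Vg R ii (Jcomp c (sumn ii + 2 - size ii)))
          else 0].
Proof.
move=> [Vdir _ _] Rrel _ _; have HC := J_coalgebra Vdir Rrel.
split=> //.
- exact: dual_algebra HC.
- exact: (dual_minimal HC).
- by move=> ii fs n3 szf fH c; apply: dual_mult_iota.
Qed.
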